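(* Let $\alpha: C^\infty(M)\to C^\infty(M,\mathcal{Q})$ be a smooth action of a compact quantum group $\mathcal{Q}$ on a compact smooth manifold $M$. Then $\alpha$ admits a lift $d\alpha$ as a well-defined $\alpha$-equivariant unitary representation of $\mathcal{Q}$ on the Hilbert bimodule of one-forms $\Omega^1(C^\infty(M))$ (with the $C^\infty(M)$-valued inner product of some Riemannian structure on $M$) satisfying $d\alpha(df)=(d\otimes\mathrm{id})\alpha(f)$ for all $f\in C^\infty(M)$, if and only if there is a Riemannian structure on $M$ such that $\alpha$ is inner product preserving, i.e. $$\langle\langle (d\otimes\mathrm{id})\alpha(f),(d\otimes\mathrm{id})\alpha(g)\rangle\rangle=\alpha(\langle\langle df,dg\rangle\rangle)\quad\text{for all } f,g\in C^\infty(M).$$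
   Context: A compact quantum group (CQG) is a unital $C^*$-algebra $\mathcal{Q}$ with a coassociative unital $*$-homomorphism $\Delta:\mathcal{Q}\to\mathcal{Q}\hat{\otimes}\mathcal{Q}$ (minimal tensor product) such that the linear spans of $\Delta(\mathcal{Q})(\mathcal{Q}\otimes 1)$ and $\Delta(\mathcal{Q})(1\otimes\mathcal{Q})$ are norm-dense in $\mathcal{Q}\hat{\otimes}\mathcal{Q}$. $C^\infty(M)$ is the algebra of complex-valued smooth functions with its usual Fréchet topology (uniform convergence of all partial derivatives on compact subsets of charts); $C^\infty(M)\hat{\otimes}\mathcal{Q}=C^\infty(M,\mathcal{Q})$ is the Fréchet algebra of smooth $\mathcal{Q}$-valued functions. A smooth action of $\mathcal{Q}$ on $M$ is a continuous $*$-homomorphism $\alpha:C^\infty(M)\to C^\infty(M,\mathcal{Q})$ with $(\alpha\otimes\mathrm{id})\alpha=(\mathrm{id}\otimes\Delta)\alpha$ and with the span of $\alpha(C^\infty(M))(1\otimes\mathcal{Q})$ Fréchet dense in $C^\infty(M,\mathcal{Q})$; if $M$ has boundary it is also assumed that the closed ideal $\{f\in C^\infty(M): f|_{\partial M}=0\}$ is invariant under $\alpha$. $\Omega^1(C^\infty(M))$ is the $C^\infty(M)$-bimodule of smooth complex one-forms. A Riemannian structure on $M$ gives it the $C^\infty(M)$-valued inner product $\langle\langle\omega,\eta\rangle\rangle(x)=\langle\omega(x),\eta(x)\rangle$, conjugate-linear in the first variable, computed in the complexified cotangent space $T_x^*M$; this makes it a Hilbert bimodule. $\Omega^1(C^\infty(M))\bar{\otimes}\mathcal{Q}$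 is the space of smooth $\mathcal{Q}$-valued one-forms (locally $\sum_i dx_i\,\Omega_i$ with $\Omega_i$ smooth $\mathcal{Q}$-valued). It is a $C^\infty(M,\mathcal{Q})$-bimodule by pointwise left and right multiplication in the $\mathcal{Q}$-component, with $C^\infty(M,\mathcal{Q})$-valued inner product determined by $\langle\langle\omega\otimes q,\eta\otimes q'\rangle\rangle=\langle\langle\omega,\eta\rangle\rangle\otimes q^*q'$. The map $d\otimes\mathrm{id}:C^\infty(M,\mathcal{Q})\to\Omega^1(C^\infty(M))\bar{\otimes}\mathcal{Q}$ is locally $F\mapsto\sum_i dx_i\frac{\partial F}{\partial x_i}$. For a Hilbert $C^\infty(M)$-bimodule $\mathcal{E}$, an $\alpha$-equivariant unitary representation of $\mathcal{Q}$ on $\mathcal{E}$ is a $\mathbb{C}$-linear map $\Gamma:\mathcal{E}\to\mathcal{E}\bar{\otimes}\mathcal{Q}$ such that: (1) $\Gamma(\xi f)=\Gamma(\xi)\alpha(f)$ and $\Gamma(f\xi)=\alpha(f)\Gamma(\xi)$ for $f\in C^\infty(M)$, $\xi\in\mathcal{E}$; (2) $\langle\langle\Gamma(\xi),\Gamma(\xi')\rangle\rangle=\alpha(\langle\langle\xi,\xi'\rangle\rangle)$; (3) $(\Gamma\otimes\mathrm{id})\Gamma=(\mathrm{id}\otimes\Delta)\Gamma$; (4) the closed linear span of $\Gamma(\mathcal{E})(1\otimes\mathcal{Q})$ is $\mathcal{E}\bar{\otimes}\mathcal{Q}$. *)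

(* Defs.v *)
From HB Require Import structures.
From mathcomp Require Import all_boot all_order all_algebra.
From mathcomp Require Import all_classical all_reals all_analysis.
From mathcomp Require Import complex.

Set Implicit Arguments.
Unset Strict Implicit.
Unset Printing Implicit Defensive.

Import Order.TTheory GRing.Theory Num.Theory numFieldNormedType.Exports.

Local Open Scope classical_set_scope.
Local Open Scope ring_scope.

(******************************************************************************)
(*                     C*-algebras and Hilbert spaces                         *)
(******************************************************************************)

(* The multiplication is not the one of a pzRingType: joining the ring and    *)
(* norm structures outside of numDomainType is impossible in the hierarchy.   *)
HB.mixin Record NormedModule_isPreCStar (C : numClosedFieldType) A
    of NormedModule C A := {
  amul : A -> A -> A;
  aone : A;
  star : A -> A;
  amulA : associative amul;
  amul1l : left_id aone amul;
  amul1r : right_id aone amul;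
  amul_linl : forall (c : C) (a b d : A),
    amul (c *: a + b) d = c *: amul a d + amul b d;
  amul_linr : forall (c : C) (a b d : A),
    amul d (c *: a + b) = c *: amul d a + amul d b;
  star_antilin : forall (c : C) (a b : A),
    star (c *: a + b) = c^* *: star a + star b;
  starM : forall a b : A, star (amul a b) = amul (star b) (star a);
  starK : involutive star;
  amul_norm : forall a b : A, `|amul a b| <= `|a| * `|b|;
  cstar_identity : forall a : A, `|amul (star a) a| = `|a| ^+ 2
}.

(* unital C*-algebras, except that completeness is not required *)
#[short(type="preCStarType")]
HB.structure Definition PreCStar (C : numClosedFieldType) :=
  {A of NormedModule_isPreCStar C A & NormedModule C A}.

#[short(type="cstarType")]
HB.structure Definition CStar (C : numClosedFieldType) :=
  {A of PreCStar C A & CompleteNormedModule C A}.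

Reserved Notation "a ** b" (at level 40, left associativity).
Notation "a ** b" := (amul a b) : ring_scope.

Section ScalarsPreCStar.
Variable C : numClosedFieldType.

Let mul_linl (c : C) (a b d : C^o) : (c *: a + b) * d = c *: (a * d) + b * d.
Proof. by rewrite mulrDl scalerAl. Qed.
Let mul_linr (c : C) (a b d : C^o) : d * (c *: a + b) = c *: (d * a) + d * b.
Proof. by rewrite mulrDr scalerAr. Qed.
Let conj_antilin (c : C) (a b : C^o) :
  (c *: a + b : C)^* = c^* *: ((a : C)^* : C^o) + (b : C)^*.
Proof. by rewrite rmorphD rmorphM. Qed.
Let conjM (a b : C^o) : (a * b : C)^* = (b : C)^* * (a : C)^*.
Proof. by rewrite rmorphM mulrC. Qed.
Let conjK : involutive (fun a : C^o => (a : C)^* : C^o).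
Proof. exact: conjCK. Qed.
Let mul_norm (a b : C^o) : `|a * b| <= `|a| * `|b|.
Proof. by rewrite normrM. Qed.
Let conj_norm (a : C^o) : `|((a : C)^* : C^o) * a| = `|a| ^+ 2.
Proof. by rewrite normrM norm_conjC expr2. Qed.

HB.instance Definition _ := @NormedModule_isPreCStar.Build C C^o
  (fun a b => a * b) 1 (fun a => (a : C)^* : C^o) (@mulrA C) (@mul1r C)
  (@mulr1 C) mul_linl mul_linr conj_antilin conjM conjK mul_norm conj_norm.

End ScalarsPreCStar.

Definition star_hom (C : numClosedFieldType) (A B : cstarType C)
    (h : A -> B) : Prop :=
  [/\ forall (c : C) (a b : A), h (c *: a + b) = c *: h a + h b,
      forall a b : A, h (a ** b) = h a ** h b &
      forall a : A, h (star a) = star (h a)].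

HB.mixin Record CompleteNormedModule_isHilbert (C : numClosedFieldType) H
    of CompleteNormedModule C H := {
  hip : H -> H -> C;
  hip_linr : forall (c : C) (x y z : H),
    hip z (c *: x + y) = c * hip z x + hip z y;
  hip_conj : forall x y : H, hip y x = (hip x y)^*;
  hip_norm : forall x : H, hip x x = `|x| ^+ 2
}.

#[short(type="hilbertType")]
HB.structure Definition Hilbert (C : numClosedFieldType) :=
  {H of CompleteNormedModule_isHilbert C H & CompleteNormedModule C H}.

(* *-representation of A by bounded operators on H *)
Definition representation (C : numClosedFieldType) (A : cstarType C)
    (H : hilbertType C) (pi : A -> H -> H) : Prop :=
  [/\ forall a, continuous (pi a) /\
        forall (c : C) (x y : H), pi a (c *: x + y) = c *: pi a x + pi a y,
      forall (c : C) (a b : A) (x : H),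
        pi (c *: a + b) x = c *: pi a x + pi b x,
      forall (a b : A) (x : H), pi (a ** b) x = pi a (pi b x) &
      forall (a : A) (x y : H), hip (pi (star a) x) y = hip x (pi a y)].

(******************************************************************************)
(*                  Minimal (spatial) tensor product                          *)
(******************************************************************************)

(* squared norm of the vector \sum_i x i \otimes y i of H \otimes K *)
Definition tensor_sqnorm (C : numClosedFieldType) (H K : hilbertType C)
    (I : finType) (x : I -> H) (y : I -> K) : C :=
  \sum_i \sum_j hip (x i) (x j) * hip (y i) (y j).

(* c bounds the norm of (pi \otimes rho)(\sum_k a k \otimes b k) on           *)
(* H \otimes K for all representations pi and rho                             *)
Definition spatial_bound (C : numClosedFieldType) (A B : cstarType C)
    (m : nat) (a : 'I_m -> A) (b : 'I_m -> B) (c : C) : Prop :=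
  forall (H K : hilbertType C) (pi : A -> H -> H) (rho : B -> K -> K),
    representation pi -> representation rho ->
    forall (l : nat) (x : 'I_l -> H) (y : 'I_l -> K),
      tensor_sqnorm (fun kl : 'I_m * 'I_l => pi (a kl.1) (x kl.2))
                    (fun kl : 'I_m * 'I_l => rho (b kl.1) (y kl.2))
        <= c ^+ 2 * tensor_sqnorm x y.

(* (T, t) is the C*-algebra completion of the algebraic tensor product of A   *)
(* and B for the spatial norm, t a b being a \otimes b                        *)
Record min_tensor (C : numClosedFieldType) (A B T : cstarType C)
    (t : A -> B -> T) : Prop := MinTensor {
  tens_linl : forall (c : C) (a a' : A) (b : B),
    t (c *: a + a') b = c *: t a b + t a' b;
  tens_linr : forall (c : C) (a : A) (b b' : B),
    t a (c *: b + b') = c *: t a b + t a b';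
  tensM : forall (a a' : A) (b b' : B),
    t (a ** a') (b ** b') = t a b ** t a' b';
  tens_star : forall (a : A) (b : B), t (star a) (star b) = star (t a b);
  tens1 : t aone aone = aone;
  tens_norm : forall (m : nat) (a : 'I_m -> A) (b : 'I_m -> B) (c : C),
    0 <= c -> `|\sum_k t (a k) (b k)| <= c <-> spatial_bound a b c;
  tens_dense : closure [set z : T | exists (m : nat) (a : 'I_m -> A)
    (b : 'I_m -> B), z = \sum_k t (a k) (b k)] = setT
}.

(******************************************************************************)
(*                       Compact quantum groups                               *)
(******************************************************************************)

(* qg2 and qg3 are the minimal tensor products of two and three copies of qg, *)
(* the last one being both (qg \otimes qg) \otimes qg, through qtensl, and    *)
(* qg \otimes (qg \otimes qg), through qtensr                                 *)
Record cqg (C : numClosedFieldType) : Type := CQG {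
  qg :> cstarType C;
  qg2 : cstarType C;
  qg3 : cstarType C;
  qtens : qg -> qg -> qg2;
  qtensl : qg2 -> qg -> qg3;
  qtensr : qg -> qg2 -> qg3;
  qtensP : min_tensor qtens;
  qtenslP : min_tensor qtensl;
  qtensrP : min_tensor qtensr;
  qtensA : forall a b c : qg, qtensl (qtens a b) c = qtensr a (qtens b c);
  Delta : qg -> qg2;
  Delta_hom : star_hom Delta;
  Delta1 : Delta aone = aone;
  (* D1 = Delta \otimes id and D2 = id \otimes Delta *)
  Delta_coassoc : exists D1 D2 : qg2 -> qg3,
    [/\ star_hom D1 /\ continuous D1, star_hom D2 /\ continuous D2,
        forall a b : qg, D1 (qtens a b) = qtensl (Delta a) b,
        forall a b : qg, D2 (qtens a b) = qtensr a (Delta b) &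
        forall a : qg, D1 (Delta a) = D2 (Delta a)];
  Delta_densel : closure [set z : qg2 | exists (m : nat) (a b : 'I_m -> qg),
    z = \sum_k Delta (a k) ** qtens (b k) aone] = setT;
  Delta_denser : closure [set z : qg2 | exists (m : nat) (a b : 'I_m -> qg),
    z = \sum_k Delta (a k) ** qtens aone (b k)] = setT
}.

(******************************************************************************)
(*                Smooth maps with values in a complex normed space           *)
(******************************************************************************)

Definition toC (R : realType) (x : R) : R[i]^o := (x%:C)%C.

Section Smooth.
Variables (R : realType) (n : nat) (E : normedModType R[i]).
Implicit Types (S : set 'rV[R]_n) (f : 'rV[R]_n -> E).

(* filter of the nonzero increments h -> 0 such that x + h e_i stays in S *)
Definition increments S (i : 'I_n) (x : 'rV[R]_n) : set_system R :=
  within [set h | S (x + h *: delta_mx 0 i)] (0 : R)^'.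

Definition diff_quotient f (i : 'I_n) (x : 'rV[R]_n) (h : R) : E :=
  toC h^-1 *: (f (x + h *: delta_mx 0 i) - f x).

(* i-th partial derivative along S; when S is relatively open in a half-space *)
(* this is the usual one, taken one-sided in the normal direction at the      *)
(* points of the boundary hyperplane                                          *)
Definition partial S f (i : 'I_n) (x : 'rV[R]_n) : E :=
  lim (diff_quotient f i x @ increments S i x).

Definition partials S f (s : seq 'I_n) : 'rV[R]_n -> E :=
  foldr (fun i g => partial S g i) f s.

(* For S relatively open in R^n or in a half-space. At boundary points this   *)
(* amounts to the existence of local smooth extensions (Seeley).              *)
Definition smooth_on S f : Prop := forall s : seq 'I_n,
  {within S, continuous (partials S f s)} /\
  forall (i : 'I_n) (x : 'rV[R]_n), S x ->
    cvg (diff_quotient (partials S f s) i x @ increments S i x).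

End Smooth.

(******************************************************************************)
(*                     Smooth manifolds with boundary                         *)
(******************************************************************************)

(* R^n, or its half-space of points with a nonnegative 0-th coordinate *)
Definition model (R : realType) (n : nat) (half : bool) : set 'rV[R]_n :=
  [set x | half -> forall i : 'I_n, val i = 0%N -> 0 <= x 0 i].

Definition transition_dom (R : realType) (n : nat) (M chart : Type)
    (dom : chart -> set M) (cod : chart -> set 'rV[R]_n)
    (psi : chart -> 'rV[R]_n -> M) (a b : chart) : set 'rV[R]_n :=
  cod a `&` psi a @^-1` dom b.

(* The atlas is any smooth atlas, not necessarily the maximal one; chart_at   *)
(* selects a chart around each point. The chart a is the homeomorphism phi a  *)
(* from dom a onto cod a, of inverse psi a.                                   *)
Record manifold (R : realType) (n : nat) : Type := Manifold {
  point_of :> topologicalType;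
  chart : Type;
  half : chart -> bool;
  dom : chart -> set point_of;
  cod : chart -> set 'rV[R]_n;
  phi : chart -> point_of -> 'rV[R]_n;
  psi : chart -> 'rV[R]_n -> point_of;
  chart_at : point_of -> chart;
  manifold_hausdorff : hausdorff_space point_of;
  manifold_countable : @second_countable point_of;
  dom_open : forall a, open (dom a);
  cod_open : forall a, exists2 O, open O & cod a = O `&` @model R n (half a);
  phi_cod : forall a p, dom a p -> cod a (phi a p);
  psi_dom : forall a x, cod a x -> dom a (psi a x);
  phiK : forall a p, dom a p -> psi a (phi a p) = p;
  psiK : forall a x, cod a x -> phi a (psi a x) = x;
  phi_continuous : forall a, {within dom a, continuous (phi a)};
  psi_continuous : forall a, {within cod a, continuous (psi a)};
  chart_atP : forall p, dom (chart_at p) p;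
  transition_smooth : forall a b (j : 'I_n),
    smooth_on (transition_dom dom cod psi a b)
              (fun x => toC (phi b (psi a x) 0 j))
}.

Section Manifold.
Variables (R : realType) (n : nat) (M : manifold R n).
Implicit Types (p : M) (a b : chart M).

Definition boundary : set M :=
  [set p | exists a, [/\ half a, dom a p &
     exists i : 'I_n, val i = 0%N /\ phi a p 0 i = 0]].

(* Jacobian matrix of the change of charts phi b \o psi a at phi a p *)
Definition jacobian a b p (j i : 'I_n) : R[i]^o :=
  partial (transition_dom (@dom _ _ M) (@cod _ _ M) (@psi _ _ M) a b)
          (fun x => toC (phi b (psi a x) 0 j)) i (phi a p).

Section Values.
Variable E : normedModType R[i].

(* C^oo(M, E) is the subspace of the smooth elements of M -> E *)
Definition smooth (F : M -> E) : Prop :=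
  forall a, smooth_on (cod a) (F \o psi a).

(* w a p i is the coefficient of dx_i at p in the chart a *)
Definition one_form : Type := chart M -> M -> 'I_n -> E.

HB.instance Definition _ :=
  GRing.Lmodule.copy one_form (chart M -> M -> 'I_n -> E).

(* Coefficients are 0 outside of the domain of the chart, so that smooth      *)
(* one-forms are equal if and only if they are equal as elements of one_form  *)
Definition smooth_form (w : one_form) : Prop :=
  [/\ forall a i, smooth_on (cod a) (fun x => w a (psi a x) i),
      forall a p i, ~ dom a p -> w a p i = 0 &
      forall a b p i, dom a p -> dom b p ->
        w a p i = \sum_j jacobian a b p j i *: w b p j].

(* d for E = C, d \otimes id for E = Q *)
Definition ext_d (F : M -> E) : one_form := fun a p i =>
  if `[< dom a p >] then partial (cod a) (F \o psi a) i (phi a p) else 0.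

(* Topology of uniform convergence of all partial derivatives on compact      *)
(* subsets of charts, for a space X of smooth objects with local expressions  *)
(* loc F a j: filter of the neighborhoods of F, generated by finite           *)
(* intersections of conditions on a partial derivative on a compact set.      *)
Definition frechet_nbhs (X J : Type) (sm : X -> Prop)
    (loc : X -> chart M -> J -> 'rV[R]_n -> E) (F : X) : set_system X :=
  [set B | exists (m : nat) (a : 'I_m -> chart M) (j : 'I_m -> J)
      (K : 'I_m -> set 'rV[R]_n) (s : 'I_m -> seq 'I_n) (e : R),
    [/\ forall k, compact (K k) /\ K k `<=` cod (a k), 0 < e &
        forall G, sm G ->
          (forall k x, K k x ->
             `|partials (cod (a k)) (loc F (a k) (j k)) (s k) x -
               partials (cod (a k)) (loc G (a k) (j k)) (s k) x| < toC e) ->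
          B G]].

Definition fun_nbhs : (M -> E) -> set_system (M -> E) :=
  frechet_nbhs smooth (fun F a (_ : unit) => F \o psi a).

Definition form_nbhs : one_form -> set_system one_form :=
  frechet_nbhs smooth_form (fun w a i x => w a (psi a x) i).

End Values.

Record riemannian : Type := Riemannian {
  metric :> chart M -> M -> 'M[R]_n;
  metric_smooth : forall a i j,
    smooth_on (cod a) (fun x => toC (metric a (psi a x) i j));
  metric_sym : forall a p, dom a p -> (metric a p)^T = metric a p;
  metric_pos : forall a p (v : 'rV[R]_n), dom a p -> v != 0 ->
    0 < (v *m metric a p *m v^T) 0 0;
  metric_change : forall a b p i k, dom a p -> dom b p ->
    toC (metric a p i k) =
      \sum_j \sum_l jacobian a b p j i * toC (metric b p j l)
                    * jacobian a b p l k
}.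

(* << w, w' >>: the inverse of the matrix of the metric on tangent vectors is *)
(* the matrix of the induced inner product on cotangent vectors. The value    *)
(* does not depend on the chart.                                              *)
Definition form_ip (E : preCStarType R[i]) (g : riemannian)
    (w w' : one_form E) : M -> E := fun p =>
  let a := chart_at p in
  \sum_i \sum_j toC (invmx (g a p) i j) *: (star (w a p i) ** w' a p j).

End Manifold.

(* smX and smY are the predicates defining spaces of smooth objects, nX and   *)
(* nY their neighborhood filters. The values of L on the elements of X that   *)
(* are not smooth are irrelevant.                                             *)
Definition smooth_linear (C : pzRingType) (X Y : lmodType C) (smX : X -> Prop)
    (smY : Y -> Prop) (L : X -> Y) : Prop :=
  (forall x, smX x -> smY (L x)) /\
  (forall (c : C) (x y : X), smX x -> smX y -> L (c *: x + y) = c *: L x + L y).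

Definition smooth_continuous (X Y : Type) (smX : X -> Prop)
    (nX : X -> set_system X) (nY : Y -> set_system Y) (L : X -> Y) : Prop :=
  forall x, smX x -> nY (L x) `<=` L @ nX x.

Definition smooth_dense (X : Type) (smX : X -> Prop)
    (nX : X -> set_system X) (S : set X) : Prop :=
  forall x, smX x -> forall B, nX x B -> S `&` B !=set0.

(******************************************************************************)
(*                  Smooth actions and equivariant lifts                      *)
(******************************************************************************)

Section Action.
Variables (R : realType) (n : nat) (M : manifold R n) (Q : cqg R[i]).
Let C : preCStarType R[i] := R[i]^o.
Let Q1 : cstarType R[i] := qg Q.
Let Q2 : cstarType R[i] := qg2 Q.

Record smooth_action (alpha : (M -> C) -> (M -> Q1)) : Prop := SmoothAction {
  action_linear : smooth_linear (@smooth _ _ M C) (@smooth _ _ M Q1) alpha;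
  action_mul : forall f g : M -> C, smooth f -> smooth g ->
    alpha (fun p => f p ** g p) = fun p => alpha f p ** alpha g p;
  action_star : forall f : M -> C, smooth f ->
    alpha (fun p => star (f p)) = fun p => star (alpha f p);
  action_continuous : smooth_continuous (@smooth _ _ M C)
    (@fun_nbhs _ _ M C) (@fun_nbhs _ _ M Q1) alpha;
  (* alpha2 = alpha \otimes id, the continuous extension of                   *)
  (* f \otimes q |-> alpha f \otimes q to C^oo(M, Q)                          *)
  action_coassoc : exists alpha2 : (M -> Q1) -> (M -> Q2),
    [/\ smooth_linear (@smooth _ _ M Q1) (@smooth _ _ M Q2) alpha2,
        smooth_continuous (@smooth _ _ M Q1)
          (@fun_nbhs _ _ M Q1) (@fun_nbhs _ _ M Q2) alpha2,
        forall (f : M -> C) (q : Q1), smooth f ->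
          alpha2 (fun p => f p *: q) = fun p => qtens (alpha f p) q &
        forall f : M -> C, smooth f ->
          alpha2 (alpha f) = fun p => Delta (alpha f p)];
  action_dense : smooth_dense (@smooth _ _ M Q1) (@fun_nbhs _ _ M Q1)
    [set F | exists (m : nat) (f : 'I_m -> M -> C) (q : 'I_m -> Q1),
       (forall k, smooth (f k)) /\
       F = fun p => \sum_k alpha (f k) p ** q k];
  (* the elements of C^oo(M, Q) vanishing on the boundary form the closed     *)
  (* ideal generated by the f \otimes q with f vanishing on the boundary      *)
  action_boundary : forall f : M -> C, smooth f ->
    (forall p, boundary p -> f p = 0) -> forall p, boundary p -> alpha f p = 0
}.

Record equivariant_rep (g : riemannian M) (alpha : (M -> C) -> (M -> Q1))
    (Gamma : one_form M C -> one_form M Q1) : Prop := EquivariantRep {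
  rep_linear :
    smooth_linear (@smooth_form _ _ M C) (@smooth_form _ _ M Q1) Gamma;
  rep_mulr : forall (w : one_form M C) (f : M -> C),
    smooth_form w -> smooth f ->
    Gamma (fun a p i => w a p i ** f p) =
      fun a p i => Gamma w a p i ** alpha f p;
  rep_mull : forall (w : one_form M C) (f : M -> C),
    smooth_form w -> smooth f ->
    Gamma (fun a p i => f p ** w a p i) =
      fun a p i => alpha f p ** Gamma w a p i;
  rep_ip : forall w w' : one_form M C, smooth_form w -> smooth_form w' ->
    form_ip g (Gamma w) (Gamma w') = alpha (form_ip g w w');
  (* Gamma2 = Gamma \otimes id, as above *)
  rep_coassoc : exists Gamma2 : one_form M Q1 -> one_form M Q2,
    [/\ smooth_linear (@smooth_form _ _ M Q1) (@smooth_form _ _ M Q2) Gamma2,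
        smooth_continuous (@smooth_form _ _ M Q1)
          (@form_nbhs _ _ M Q1) (@form_nbhs _ _ M Q2) Gamma2,
        forall (w : one_form M C) (q : Q1), smooth_form w ->
          Gamma2 (fun a p i => w a p i *: q) =
            fun a p i => qtens (Gamma w a p i) q &
        forall w : one_form M C, smooth_form w ->
          Gamma2 (Gamma w) = fun a p i => Delta (Gamma w a p i)];
  rep_dense : smooth_dense (@smooth_form _ _ M Q1) (@form_nbhs _ _ M Q1)
    [set W | exists (m : nat) (w : 'I_m -> one_form M C) (q : 'I_m -> Q1),
       (forall k, smooth_form (w k)) /\
       W = fun a p i => \sum_k Gamma (w k) a p i ** q k]
}.

Definition inner_product_preserving (g : riemannian M)
    (alpha : (M -> C) -> (M -> Q1)) : Prop :=
  forall f f' : M -> C, smooth f -> smooth f' ->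
    form_ip g (ext_d (alpha f)) (ext_d (alpha f')) =
      alpha (form_ip g (ext_d f) (ext_d f')).

End Action.

(* Main.v *)
Require Import Defs.
From mathcomp Require Import all_boot all_order all_algebra perm.
From mathcomp Require Import all_classical all_reals all_analysis.
From mathcomp Require Import complex.
From mathcomp Require Import ring lra.

(** Why the equivalence holds.

    If a lift Gamma exists, then << d(alpha f), d(alpha g) >> is
    << Gamma(df), Gamma(dg) >>, that is alpha(<< df, dg >>).

    Conversely let the inner product be invariant. By compactness there are
    finitely many functions g_i and operators c_i with
    w = sum_i d(g_i) c_i(w) for every smooth one-form w, with values in any
    space (decomp_ex). This forces the lift to be
    Gamma(w) = sum_i d(alpha g_i) alpha(c_i(w)) (form_lift), and invariance
    gives << d(alpha h), Gamma(w) >> = alpha(<< dh, w >>) (lift_pair). All the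
    identities that Gamma has to satisfy can be tested against the forms
    d(alpha h), because a smooth form W orthogonal to all of them vanishes:
    by density of the action it is orthogonal to every exact form dF
    (exact_orth), and if b is a bump function in a chart the exact forms
    d(b x_k) and db determine the coefficients of W (exact_forms_nondeg).
    The compatibility with the left module structure amounts to the
    commutation of alpha(f) with d(alpha h) (d_comm): invariance, applied to
    << d(alpha k), d(alpha (f h)) >>, shows that the commutator is orthogonal
    to all the d(alpha k).

    For coassociativity Gamma (x) id is defined by the same formula (lift2)
    from alpha2 = alpha (x) id. That alpha2 is multiplicative and that
    Gamma (x) id intertwines d with itself are clear on the functions f (x) q,
    whose sums are dense in C^oo(M, Q) (alg_dense), and extend by continuity
    (tensor_eq). Delta and q |-> q (x) 1 are bounded, as are all
    star homomorphisms (star_hom_blin), and so commute with d. The density of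
    the span of the Gamma(w) q follows from that of the action, applied to the
    g_i and then to the coefficients c_i(W).

    The analysis behind this is done on the regions of R^n in which each point
    has a nondegenerate box as a neighborhood (locbox): they include the open
    subsets of half-spaces, and one-sided partial derivatives are unique on
    them. Families of C^k functions that converge locally uniformly with their
    derivatives (ccfam) account at once for smoothness (constant families) and
    for continuity in the Frechet topologies. The density of C^oo (x) E in the
    E-valued smooth functions is proved on a box with Bernstein polynomials,
    one variable at a time (tens_approx), and globalized with bump
    functions. *)

Set Implicit Arguments.
Unset Strict Implicit.
Unset Printing Implicit Defensive.

Import Order.TTheory GRing.Theory Num.Theory numFieldNormedType.Exports.

Local Open Scope classical_set_scope.
Local Open Scope ring_scope.

(** * The real-valued norm of a complex normed space *)
Section RealNorm.
Variables (R : realType).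
Implicit Type E : normedModType R[i].

(** The norm of a space over R[i] is an element of R[i], whose order is
    partial; nm x is the same number in R. *)
Definition nm E (x : E) : R := complex.Re `|x|.

Lemma nmE E (x : E) : `|x| = toC (nm x) :> R[i].
Proof. by rewrite /nm /toC RRe_real // ger0_real. Qed.

Lemma nm_le E (x : E) (e : R) : (`|x| <= (toC e : R[i])) = (nm x <= e).
Proof. by rewrite nmE lecR. Qed.

Lemma nm_lt E (x : E) (e : R) : (`|x| < (toC e : R[i])) = (nm x < e).
Proof. by rewrite nmE ltcR. Qed.

Lemma nm_ge0 E (x : E) : 0 <= nm x.
Proof. by rewrite -ler0c -[(_)%:C%C]/(toC _ : R[i]) -nmE. Qed.

Lemma nm0 E : nm (0 : E) = 0.
Proof. by rewrite /nm normr0. Qed.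

Lemma nm0_eq E (x : E) : nm x = 0 -> x = 0.
Proof. by move=> h; apply: normr0_eq0; rewrite nmE h. Qed.

Lemma nmD E (x y : E) : nm (x + y) <= nm x + nm y.
Proof.
by rewrite -lecR /= rmorphD /= -![(_)%:C%C]/(toC _ : R[i]) -!nmE ler_normD.
Qed.

Lemma nmN E (x : E) : nm (- x) = nm x.
Proof. by rewrite /nm normrN. Qed.

Lemma nmB E (x y : E) : nm (x - y) = nm (y - x).
Proof. by rewrite -nmN opprB. Qed.

Lemma nm_toC (r : R) : nm (toC r : R[i]^o) = `|r|.
Proof.
rewrite /nm /toC normc_def /= expr0n addr0 sqrtr_sqr //.
Qed.

Lemma nmZ E (c : R[i]) (x : E) : nm (c *: x) = nm (c : R[i]^o) * nm x.
Proof.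
have : (toC (nm (c *: x)) : R[i]) = toC (nm (c : R[i]^o) * nm x).
  by rewrite -nmE normrZ (nmE x) (nmE (c : R[i]^o)) /toC rmorphM.
by move=> /(congr1 (@complex.Re R)).
Qed.

Lemma nmZr E (r : R) (x : E) : nm (toC r *: x) = `|r| * nm x.
Proof. by rewrite nmZ nm_toC. Qed.

Lemma nm_small E (x : E) : (forall e : R, 0 < e -> nm x <= e) -> x = 0.
Proof.
move=> h; apply: nm0_eq; apply/eqP; rewrite eq_le nm_ge0 andbT.
by apply/ler_addgt0Pr => e e0; rewrite add0r; exact: h.
Qed.

Lemma nm_sum E (I : Type) (r : seq I) (P : pred I) (f : I -> E) :
  nm (\sum_(i <- r | P i) f i) <= \sum_(i <- r | P i) nm (f i).
Proof.
elim/big_ind2 : _ => [|x a y b xa yb|//]; first by rewrite nm0.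
by apply: le_trans (nmD _ _) _; rewrite lerD.
Qed.

Lemma cvg_nmP E (T : Type) (F : set_system T) (FF : Filter F) (f : T -> E) l :
  f @ F --> l <-> forall e : R, 0 < e -> \forall t \near F, nm (f t - l) < e.
Proof.
split=> [/cvgrPdist_lt h e e0|h].
  have /h : (0 : R[i]) < toC e by rewrite /toC ltcR.
  by apply: filterS => t; rewrite distrC nm_lt.
apply/cvgrPdist_lt => e e0.
have eE : e = toC (complex.Re e) by rewrite /toC RRe_real // gtr0_real.
have /h : 0 < complex.Re e by move: e0; rewrite {1}eE /toC ltcR.
by apply: filterS => t; rewrite distrC eE nm_lt.
Qed.

End RealNorm.

(** * Boxes in R^n *)
Section Box.
Variables (R : realType) (n : nat).
Implicit Types (x y : 'rV[R]_n) (S : set 'rV[R]_n).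

Definition near_pt x (d : R) y := forall i, `|y 0 i - x 0 i| < d.

Lemma near_ptP x (A : set 'rV[R]_n) :
  nbhs x A <-> exists2 d : R, 0 < d & forall y, near_pt x d y -> A y.
Proof.
split=> [/nbhs_ballP[e /= e0 h]|[d d0 h]].
  exists e => // y xy; apply: h; split => // i j /=.
  by rewrite (ord1 i) -ball_normE /= distrC; exact: xy.
apply/nbhs_ballP; exists d => //= y xy; apply: h => i.
by have := xy.2 0 i; rewrite -ball_normE /= distrC.
Qed.

Lemma near_ptxx x d : 0 < d -> near_pt x d x.
Proof. by move=> d0 i; rewrite subrr normr0. Qed.

Lemma near_pt_le x d d' y : d <= d' -> near_pt x d y -> near_pt x d' y.
Proof. by move=> dd h i; exact: lt_le_trans (h i) dd. Qed.

Lemma near_pt_trans x d y d' z : near_pt x d y -> near_pt y d' z ->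
  near_pt x (d + d') z.
Proof.
move=> h h' i; rewrite (le_lt_trans (ler_distD (y 0 i) _ _))// addrC.
by rewrite ltrD.
Qed.

Definition box (l u : 'rV[R]_n) : set 'rV[R]_n := [set y | forall i, l 0 i <= y 0 i <= u 0 i].

Definition nondeg (l u : 'rV[R]_n) := forall i, l 0 i < u 0 i.

(** The regions on which differential calculus is done: boxes, half-spaces and
    their relatively open subsets. Inside of the box one can move along every
    axis, so that one-sided partial derivatives are unique (is_part_uniq), and
    its convexity gives mean value inequalities. *)
Definition locbox S := forall x, S x -> exists l u,
  [/\ nondeg l u, box l u x, box l u `<=` S &
      exists2 d : R, 0 < d & forall y, S y -> near_pt x d y -> box l u y].

Lemma locbox_box l u : nondeg l u -> locbox (box l u).
Proof. by move=> lu x Sx; exists l, u; split => //; exists 1. Qed.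

Definition ball_box (l u x : 'rV[R]_n) (r : R) : 'rV[R]_n * 'rV[R]_n :=
  (\row_i Num.max (l 0 i) (x 0 i - r), \row_i Num.min (u 0 i) (x 0 i + r)).

(** Shrink the box around x to the points within distance r of x, with r so
    small that they are in O. *)
Lemma locbox_open S (O : set 'rV[R]_n) : locbox S ->
  (forall x, S x -> O x -> exists2 d : R, 0 < d & forall y, S y -> near_pt x d y -> O y) ->
  locbox (S `&` O).
Proof.
move=> Sb Oo x [Sx Ox].
have [l [u [lu xlu luS [d d0 dlu]]]] := Sb x Sx.
have [e e0 eO] := Oo x Sx Ox.
pose r := e / 2.
have r0 : 0 < r by rewrite divr_gt0.
(* r = e / 2 keeps the closed box inside of the open one of radius e *)
exists (ball_box l u x r).1, (ball_box l u x r).2; split.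
- move=> i; rewrite !mxE; have := lu i; have /andP[] := xlu i.
  by rewrite gt_max !lt_min; move=> *; repeat (apply/andP; split); lra.
- move=> i; rewrite !mxE; have /andP[] := xlu i.
  by rewrite ge_max !le_min; move=> *; repeat (apply/andP; split); lra.
- move=> y yb; have yl : box l u y.
    by move=> i; have := yb i; rewrite !mxE ge_max !le_min => /andP[/andP[-> _] /andP[-> _]].
  split; first exact: luS.
  apply: eO; first exact: luS.
  move=> i; have := yb i; rewrite !mxE ge_max !le_min.
  move=> /andP[/andP[_ h1] /andP[_ h2]]; apply: (@le_lt_trans _ _ r); last first.
    by rewrite /r; lra.
  by rewrite ler_norml; apply/andP; split; lra.
- exists (Num.min d r); first by rewrite lt_min d0.
  move=> y [Sy _] xy i; rewrite !mxE ge_max !le_min.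
  have xyd : near_pt x d y by apply: near_pt_le xy; rewrite ge_min lexx.
  have /(_ i) /andP[-> ->] := dlu y Sy xyd.
  have : `|y 0 i - x 0 i| < r by apply: lt_le_trans (xy i) _; rewrite ge_min lexx orbT.
  by rewrite ltr_norml => /andP[? ?] /=; apply/andP; split; lra.
Qed.

End Box.

(** * Differential calculus along boxes *)
Section Mvt.
Variables (R : realType) (E : normedModType R[i]).

(** Lets an estimate end with any constant multiple of e, under the assumption
    e <= 1, which bounds the products of errors. *)
Lemma eps_weak (P : R -> Prop) (C : R) :
  (forall e e' : R, e <= e' -> P e -> P e') -> 0 <= C ->
  (forall e : R, 0 < e -> e <= 1 -> P (C * e)) -> forall e : R, 0 < e -> P e.
Proof.
move=> mP C0 h e e0.
have C1 : 0 < C + 1 by lra.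
apply: (mP (C * Num.min 1 (e / (C + 1)))).
  apply: (@le_trans _ _ (C * (e / (C + 1)))).
    by rewrite ler_wpM2l// ge_min lexx orbT.
  by rewrite mulrA ler_pdivrMr// mulrC ler_wpM2l; lra.
by apply: h; rewrite ?ge_min ?lexx// lt_min ltr01 divr_gt0.
Qed.

Lemma fin_delta m (P : 'I_m -> R -> Prop) :
  (forall j (d d' : R), d' <= d -> P j d -> P j d') ->
  (forall j, exists2 d : R, 0 < d & P j d) -> exists2 d : R, 0 < d & forall j, P j d.
Proof.
move=> mP h.
have [d hd] := choice (fun j => let: ex_intro2 d h1 h2 := h j in
   ex_intro (fun d => 0 < d /\ P j d) d (conj h1 h2)).
exists (\big[Num.min/1]_j d j).
  by apply: lt_bigmin => [|j _]; [exact: ltr01|case: (hd j)].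
by move=> j; apply: mP (hd j).2; exact: bigmin_le_cond.
Qed.

(** Let c be the supremum of the s such that nm (f s - f 0) <= (K + e) s. The
    local bound at c shows that c is itself such an s, and then that there are
    larger ones unless c = 1. *)
Lemma mvt_ineq (f : R -> E) (K : R) :
  (forall s, 0 <= s <= 1 -> forall e : R, 0 < e -> exists2 d : R, 0 < d &
     forall s', 0 <= s' <= 1 -> `|s' - s| < d ->
       nm (f s' - f s) <= (K + e) * `|s' - s|) ->
  nm (f 1 - f 0) <= K.
Proof.
move=> hf; apply/ler_addgt0Pr => e e0.
pose A : set R := [set s | 0 <= s <= 1 /\ nm (f s - f 0) <= (K + e) * s].
have A0 : A 0 by split; rewrite ?lexx ?ler01// subrr nm0 mulr0.
have A1 : ubound A 1 by move=> s [/andP[]].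
have sA : has_sup A by split; [exists 0|exists 1].
pose c := sup A.
have c01 : 0 <= c <= 1.
  by apply/andP; split; [apply: ub_le_sup A0; exists 1|apply: ge_sup => //; exists 0].
have [d d0 hd] := hf c c01 e e0.
have Ac : A c.
  split=> //.
  have [s As] := sup_adherent d0 sA; rewrite -/c => cs.
  have sc : s <= c by apply: ub_le_sup As; exists 1.
  have s01 : 0 <= s <= 1 by case: As.
  have sd : `|s - c| < d by rewrite ler0_norm; lra.
  have := hd s s01 sd; rewrite ler0_norm ?subr_le0// nmB => h1.
  have -> : f c - f 0 = (f c - f s) + (f s - f 0) by rewrite addrA subrK.
  apply: le_trans (nmD _ _) _; case: As => _ h2.
  have -> : (K + e) * c = (K + e) * - (s - c) + (K + e) * s by ring.
  by rewrite lerD.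
suff c1 : c = 1 by case: Ac => _; rewrite c1 mulr1.
have /andP[c_ge0 c1] := c01.
apply/eqP; rewrite eq_le c1 leNgt /=; apply/negP => lc1.
pose s := Num.min (c + d / 2) 1.
have cs : c < s by rewrite lt_min lc1 andbT; lra.
have s01 : 0 <= s <= 1.
  by rewrite (ltW (le_lt_trans c_ge0 cs))/= /s ge_min lexx orbT.
have sd : `|s - c| < d.
  rewrite ger0_norm ?subr_ge0 1?ltW// ltrBlDr; apply: (@le_lt_trans _ _ (c + d / 2)).
    by rewrite ge_min lexx.
  by lra.
suff As : A s.
  have : s <= c by apply: ub_le_sup As; exists 1.
  lra.
split=> //.
have := hd s s01 sd; rewrite ger0_norm; last by rewrite subr_ge0 ltW.
move=> h1.
have -> : f s - f 0 = (f s - f c) + (f c - f 0) by rewrite addrA subrK.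
apply: le_trans (nmD _ _) _; case: Ac => _ h2.
have -> : (K + e) * s = (K + e) * (s - c) + (K + e) * c by ring.
by rewrite lerD.
Qed.

End Mvt.

Section Partial.
Variables (R : realType) (n : nat).
Implicit Types (x y : 'rV[R]_n) (S : set 'rV[R]_n) (i j : 'I_n) (h : R).

Definition stp i x h : 'rV[R]_n := x + h *: delta_mx 0 i.

Lemma stpE i x h j : stp i x h 0 j = x 0 j + h *+ (i == j).
Proof. by rewrite !mxE eqxx /= eq_sym mulr_natr. Qed.

Lemma stp0 i x : stp i x 0 = x.
Proof. by rewrite /stp scale0r addr0. Qed.

Lemma stpD i x h h' : stp i (stp i x h) h' = stp i x (h + h').
Proof. by rewrite /stp -addrA -scalerDl. Qed.

Lemma stpC i j x h h' : stp i (stp j x h) h' = stp j (stp i x h') h.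
Proof. by rewrite /stp -!addrA (addrC (h *: _)). Qed.

Lemma near_stp i x h d : `|h| < d -> near_pt x d (stp i x h).
Proof.
move=> hd j; rewrite stpE addrC addKr.
by case: (i == j); rewrite ?mulr1n// mulr0n normr0; exact: le_lt_trans hd.
Qed.

(** d is the i-th partial derivative of f at x along S. The estimate is
    multiplied by h, so that it makes sense, and obeys the rules of calculus,
    even when no increment stays inside of S. *)
Definition is_part (E : normedModType R[i]) S (f : 'rV[R]_n -> E) i x (d : E) :=
  forall e : R, 0 < e -> exists2 de : R, 0 < de &
    forall h, `|h| < de -> S (stp i x h) ->
      nm (f (stp i x h) - f x - toC h *: d) <= e * `|h|.

Definition contS (E : normedModType R[i]) S (f : 'rV[R]_n -> E) :=
  forall x, S x -> forall e : R, 0 < e -> exists2 de : R, 0 < de &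
    forall y, S y -> near_pt x de y -> nm (f y - f x) <= e.

Section One.
Variable E : normedModType R[i].
Implicit Types (f g : 'rV[R]_n -> E) (d : E).

Lemma contSP S f : contS S f <-> {within S, continuous f}.
Proof.
rewrite subspace_continuousP; split=> h x Sx.
  apply/cvg_nmP => e e0.
  have [de de0 hde] := h x Sx _ (divr_gt0 e0 (ltr0Sn R 1)).
  apply/near_ptP; exists de => // y xy /= Sy.
  by apply: le_lt_trans (hde y Sy xy) _; lra.
move=> e e0; have /cvg_nmP/(_ e e0)/near_ptP[de de0 hde] := h x Sx.
by exists de => // y Sy xy; exact/ltW/hde.
Qed.

Lemma contSS S S' f : S' `<=` S -> contS S f -> contS S' f.
Proof.
move=> sS h x Sx e e0; have [d d0 hd] := h x (sS _ Sx) e e0.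
by exists d => // y Sy; apply: hd; exact: sS.
Qed.

Lemma contS_eq S f g : (forall x, S x -> f x = g x) -> contS S f -> contS S g.
Proof.
move=> fg h x Sx e e0; have [d d0 hd] := h x Sx e e0.
by exists d => // y Sy; rewrite -!fg//; apply: hd.
Qed.

Lemma is_part_eq S f g i x d : S x -> (forall y, S y -> f y = g y) ->
  is_part S f i x d -> is_part S g i x d.
Proof.
move=> Sx fg h e e0; have [de d0 hd] := h e e0.
by exists de => // k kd Sk; rewrite -!fg//; apply: hd.
Qed.

Lemma is_partS S S' f i x d : S' `<=` S -> is_part S f i x d ->
  is_part S' f i x d.
Proof.
move=> sS h e e0; have [de d0 hd] := h e e0.
by exists de => // k kd Sk; apply: hd => //; exact: sS.
Qed.

Lemma is_part_local S S' f i x d :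
  (exists2 r : R, 0 < r & forall y, S y -> near_pt x r y -> S' y) ->
  is_part S' f i x d -> is_part S f i x d.
Proof.
move=> [r r0 hr] h e e0; have [de d0 hd] := h e e0.
exists (Num.min de r); first by rewrite lt_min d0.
move=> k; rewrite lt_min => /andP[kd kr] Sk; apply: hd => //.
by apply: hr => //; exact: near_stp.
Qed.

(** In each direction move towards the farther side of the box. The segments k
    0 i can be followed simultaneously, as mixed second differences require. *)
Lemma box_dir (l u x : 'rV[R]_n) : nondeg l u -> box l u x ->
  forall r : R, 0 < r -> exists k : 'rV[R]_n,
    (forall i, k 0 i != 0 /\ `|k 0 i| < r) /\
    (forall s : 'I_n -> R, (forall i, 0 <= s i <= 1) ->
       box l u (\row_i (x 0 i + s i * k 0 i))).
Proof.
move=> lu xlu r r0.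
pose w i : R := Num.min (r / 2) ((u 0 i - l 0 i) / 2).
have w0 i : 0 < w i by rewrite lt_min divr_gt0//= divr_gt0// subr_gt0.
have wr i : w i < r.
  by apply: (@le_lt_trans _ _ (r / 2)); [rewrite ge_min lexx|lra].
have wl i : w i <= (u 0 i - l 0 i) / 2 by rewrite ge_min lexx orbT.
exists (\row_i if x 0 i <= (u 0 i + l 0 i) / 2 then w i else - w i); split.
  move=> i; rewrite !mxE; case: ifP => _; split.
  - by rewrite gt_eqF.
  - by rewrite gtr0_norm.
  - by rewrite oppr_eq0 gt_eqF.
  - by rewrite normrN gtr0_norm.
move=> s hs i; rewrite !mxE; have := hs i; have := xlu i.
move=> /andP[a1 a2] /andP[a3 a4].
have sw : 0 <= s i * w i <= w i.
  by have := w0 i; move=> ?; apply/andP; split; nra.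
case: ifPn => [|/negP/negP]; rewrite -?ltNge => c; have := wl i => ?.
  by apply/andP; split; lra.
by rewrite mulrN; apply/andP; split; lra.
Qed.

Lemma locbox_dir S x i : locbox S -> S x ->
  forall r : R, 0 < r -> exists k, [/\ k != 0, `|k| < r & S (stp i x k)].
Proof.
move=> Sb Sx r r0; have [l [u [lu xlu luS _]]] := Sb x Sx.
have [k [k0 hk]] := box_dir lu xlu r0.
exists (k 0 i); have [? ?] := k0 i; split => //; apply: luS.
have <- : \row_j (x 0 j + (i == j)%:R * k 0 j) = stp i x (k 0 i).
  apply/rowP => j; rewrite stpE mxE.
  by case: eqP => [->|]; rewrite ?mul1r ?mul0r.
by apply: hk => j; case: (i == j); rewrite ?ler01 ?lexx.
Qed.

End One.
End Partial.

Section Zmod.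
Variable V : zmodType.

Lemma sub_sub (a b c : V) : a - b = (c - b) - (c - a).
Proof. by rewrite opprB [RHS]addrC addrA subrK. Qed.

Lemma sub_tele (a b c : V) : a - b = (a - c) + (c - b).
Proof. by rewrite addrA subrK. Qed.

Lemma subD_sub (a a' b b' : V) : (a + a') - (b + b') = (a - b) + (a' - b').
Proof. by rewrite opprD addrACA. Qed.

End Zmod.

Section PartialRules.
Variables (R : realType) (n : nat).
Implicit Types (x y : 'rV[R]_n) (S : set 'rV[R]_n) (i j : 'I_n) (h : R).
Implicit Types (E : normedModType R[i]).

Lemma is_part_uniq E S (f : 'rV[R]_n -> E) i x d d' : locbox S -> S x ->
  is_part S f i x d -> is_part S f i x d' -> d = d'.
Proof.
move=> Sb Sx h h'; apply/eqP; rewrite -subr_eq0; apply/eqP/nm_small => e e0.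
have e2 : 0 < e / 2 by rewrite divr_gt0.
have [r r0 hr] := h _ e2; have [r' r'0 hr'] := h' _ e2.
have rr0 : 0 < Num.min r r' by rewrite lt_min r0.
have [k [k0 kr Sk]] := locbox_dir i Sb Sx rr0.
move: kr; rewrite lt_min => /andP[kr kr'].
have {hr}a := hr k kr Sk; have {hr'}b := hr' k kr' Sk.
have k1 : 0 < `|k| by rewrite normr_gt0.
rewrite -(ler_pM2l k1) -nmZr scalerBr.
have -> : toC k *: d - toC k *: d' =
  (f (stp i x k) - f x - toC k *: d') - (f (stp i x k) - f x - toC k *: d).
  exact: sub_sub.
apply: le_trans (nmD _ _) _; rewrite nmN; lra.
Qed.

(** The limit that defines partial is thereby unique. *)
Lemma increments_proper S i x : locbox S -> S x ->
  ProperFilter (increments S i x).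
Proof.
move=> Sb Sx; apply: Build_ProperFilter_ex => A.
rewrite /increments /within /= => /nbhs_ballP[e /= e0 he].
have [k [k0 ke Sk]] := locbox_dir i Sb Sx e0.
exists k; apply: he => //.
by rewrite -ball_normE /= sub0r normrN.
Qed.

Lemma is_part_cvg E S (f : 'rV[R]_n -> E) i x d :
  is_part S f i x d -> diff_quotient f i x @ increments S i x --> d.
Proof.
move=> h; apply/cvg_nmP => e e0.
have e2 : 0 < e / 2 by rewrite divr_gt0.
have [r r0 hr] := h _ e2.
rewrite /increments /within /=; apply/nbhs_ballP; exists r => // k /=.
rewrite -ball_normE /= sub0r normrN => kr k0 Sk.
have {hr}a := hr k kr Sk.
rewrite /diff_quotient -/(stp i x k).
have k1 : 0 < `|k| by rewrite normr_gt0.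
rewrite -(ltr_pM2l k1) -nmZr scalerBr scalerA -rmorphM mulfV//.
rewrite rmorph1 scale1r; apply: le_lt_trans a _.
by rewrite mulrC ltr_pM2l//; lra.
Qed.

Lemma is_part_partial E S (f : 'rV[R]_n -> E) i x d : locbox S -> S x ->
  is_part S f i x d -> partial S f i x = d.
Proof.
move=> Sb Sx h; have := increments_proper i Sb Sx => P.
by apply: cvg_lim; [exact: norm_hausdorff|exact: is_part_cvg].
Qed.

Lemma cvg_is_part E S (f : 'rV[R]_n -> E) i x :
  cvg (diff_quotient f i x @ increments S i x) ->
  is_part S f i x (partial S f i x).
Proof.
move=> h e e0.
have /cvg_nmP/(_ e e0) : diff_quotient f i x @ increments S i x --> partial S f i x.
  exact: h.
rewrite /increments /within /= => /nbhs_ballP[r /= r0 hr].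
exists r => // k kr Sk.
have [->|k0] := eqVneq k 0.
  by rewrite stp0 subrr sub0r /toC rmorph0 scale0r oppr0 nm0 normr0 mulr0.
have k1 : 0 < `|k| by rewrite normr_gt0.
have := hr k; rewrite /= -ball_normE /= sub0r normrN => /(_ kr k0 Sk) /ltW.
rewrite -(ler_pM2l k1) -nmZr scalerBr scalerA -rmorphM mulfV//.
by rewrite rmorph1 scale1r mulrC.
Qed.

Lemma is_part_weak E S (f : 'rV[R]_n -> E) i x d C : 0 <= C ->
  (forall e : R, 0 < e -> e <= 1 -> exists2 de : R, 0 < de &
    forall h, `|h| < de -> S (stp i x h) ->
      nm (f (stp i x h) - f x - toC h *: d) <= C * e * `|h|) ->
  is_part S f i x d.
Proof.
move=> C0 h; apply: (eps_weak _ C0) => // e e' ee [de d0 hd].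
exists de => // k kd Sk; apply: le_trans (hd k kd Sk) _.
by rewrite ler_wpM2r.
Qed.

Lemma contS_weak E S (f : 'rV[R]_n -> E) :
  (forall x, S x -> exists2 C : R, 0 <= C &
    forall e : R, 0 < e -> e <= 1 -> exists2 de : R, 0 < de &
    forall y, S y -> near_pt x de y -> nm (f y - f x) <= C * e) -> contS S f.
Proof.
move=> h x Sx; have [C C0 hC] := h x Sx.
apply: (eps_weak _ C0) => // e e' ee [de d0 hd].
by exists de => // y Sy xy; apply: le_trans (hd y Sy xy) _.
Qed.

Lemma is_part_lip E S (f : 'rV[R]_n -> E) i x d : is_part S f i x d ->
  exists2 de : R, 0 < de & forall h, `|h| < de -> S (stp i x h) ->
    nm (f (stp i x h) - f x) <= (nm d + 1) * `|h|.
Proof.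
move=> /(_ 1 ltr01)[de d0 hd]; exists de => // k kd Sk.
rewrite -[_ - f x](subrK (toC k *: d)); apply: le_trans (nmD _ _) _.
by have := hd k kd Sk; rewrite nmZr; lra.
Qed.

Lemma is_part_cst E S (c : E) i x : is_part S (fun=> c) i x 0.
Proof.
move=> e e0; exists 1 => // k _ _.
by rewrite subrr scaler0 subrr nm0 mulr_ge0 ?(ltW e0).
Qed.

Lemma contS_cst E S (c : E) : contS S (fun=> c).
Proof. by move=> x Sx e e0; exists 1 => // y _ _; rewrite subrr nm0 ltW. Qed.

Lemma is_partD E S (f g : 'rV[R]_n -> E) i x d d' :
  is_part S f i x d -> is_part S g i x d' ->
  is_part S (fun y => f y + g y) i x (d + d').
Proof.
move=> hf hg; apply: (@is_part_weak _ _ _ _ _ _ 2) => // e e0 _.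
have [r r0 hr] := hf e e0; have [r' r'0 hr'] := hg e e0.
exists (Num.min r r'); first by rewrite lt_min r0.
move=> k; rewrite lt_min => /andP[kr kr'] Sk.
have -> : f (stp i x k) + g (stp i x k) - (f x + g x) - toC k *: (d + d') =
  (f (stp i x k) - f x - toC k *: d) + (g (stp i x k) - g x - toC k *: d').
  by rewrite scalerDr [_ - (f x + g x)]subD_sub subD_sub.
apply: le_trans (nmD _ _) _.
by have := hr k kr Sk; have := hr' k kr' Sk; lra.
Qed.

End PartialRules.

(** * Bounded bilinear maps *)
Section Bilinear.
Variables (R : realType) (n : nat).
Implicit Types (x y : 'rV[R]_n) (S : set 'rV[R]_n) (i j : 'I_n) (h : R).
Implicit Types (E : normedModType R[i]).

(** Covers the product of a scalar and a vector, the product of an algebra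
    and, with a constant scalar, linear maps (blin_bilin). Homogeneity is over
    the real scalars because of the involution, which is antilinear. *)
Record bdd_bilin E1 E2 E3 (m : E1 -> E2 -> E3) : Prop := BddBilin {
  bilDl : forall a b c, m (a + b) c = m a c + m b c;
  bilDr : forall a b c, m a (b + c) = m a b + m a c;
  bilZl : forall (r : R) a b, m (toC r *: a) b = toC r *: m a b;
  bilZr : forall (r : R) a b, m a (toC r *: b) = toC r *: m a b;
  bil_bdd : exists2 K : R, 0 <= K & forall a b, nm (m a b) <= K * nm a * nm b }.

Lemma toCN1 : toC (-1) = -1 :> R[i]^o.
Proof. by rewrite /toC rmorphN rmorph1. Qed.

Section One.
Variables (E1 E2 E3 : normedModType R[i]) (m : E1 -> E2 -> E3).
Hypothesis mP : bdd_bilin m.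

Lemma bilBl a b c : m (a - b) c = m a c - m b c.
Proof. by rewrite (bilDl mP) -[- b]scaleN1r -toCN1 (bilZl mP) toCN1 scaleN1r. Qed.

Lemma bilBr a b c : m a (b - c) = m a b - m a c.
Proof. by rewrite (bilDr mP) -[- c]scaleN1r -toCN1 (bilZr mP) toCN1 scaleN1r. Qed.

Let aux (V : zmodType) (p q r s a b : V) :
  p - s - (a + b) = (q - s - a) + (r - s - b) + (p - q - (r - s)).
Proof.
rewrite -subD_sub [RHS]addrAC; congr (_ - _).
by rewrite addrACA subrr addr0 addrC -sub_tele.
Qed.

(** The error is m of each linear error with the other function, plus m of the
    two increments, which is quadratic in h. *)
Lemma is_part_bilin S (f : 'rV[R]_n -> E1) (g : 'rV[R]_n -> E2) i x d d' :
  is_part S f i x d -> is_part S g i x d' ->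
  is_part S (fun y => m (f y) (g y)) i x (m d (g x) + m (f x) d').
Proof.
move=> hf hg; have [K K0 hK] := bil_bdd mP.
have a0 := nm_ge0 (f x); have b0 := nm_ge0 (g x).
have c0 := nm_ge0 d; have d0 := nm_ge0 d'.
pose C := K * (nm (g x) + nm (f x) + (nm d + 1) * (nm d' + 1)).
apply: (@is_part_weak _ _ _ _ _ _ _ _ C).
  by rewrite mulr_ge0// !addr_ge0// mulr_ge0// addr_ge0.
move=> e e0 _.
have [r r0 hr] := hf e e0; have [r' r'0 hr'] := hg e e0.
have [s s0 hs] := is_part_lip hf; have [s' s'0 hs'] := is_part_lip hg.
exists (Num.min (Num.min r r') (Num.min (Num.min s s') e)).
  by rewrite !lt_min r0 r'0 s0 s'0.
move=> k; rewrite !lt_min => /andP[/andP[kr kr'] /andP[/andP[ks ks'] ke]] Sk.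
rewrite scalerDr (aux _ (m (f (stp i x k)) (g x)) (m (f x) (g (stp i x k)))).
rewrite -(bilZl mP) -(bilZr mP) -!(bilBl, bilBr).
apply: le_trans (nmD _ _) _.
apply: le_trans (lerD (nmD _ _) (lexx _)) _.
have k0 := normr_ge0 k.
have h1 := hr k kr Sk; have h2 := hr' k kr' Sk.
have h3 := hs k ks Sk; have h4 := hs' k ks' Sk.
have g1 : nm (m (f (stp i x k) - f x - toC k *: d) (g x)) <= K * (e * `|k|) * nm (g x).
  by apply: le_trans (hK _ _) _; rewrite ler_wpM2r// ler_wpM2l.
have g2 : nm (m (f x) (g (stp i x k) - g x - toC k *: d')) <= K * nm (f x) * (e * `|k|).
  by apply: le_trans (hK _ _) _; rewrite ler_wpM2l// mulr_ge0.
have g3 : nm (m (f (stp i x k) - f x) (g (stp i x k) - g x)) <=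
   K * ((nm d + 1) * `|k|) * ((nm d' + 1) * e).
  apply: le_trans (hK _ _) _; rewrite ler_pM ?mulr_ge0 ?nm_ge0//.
    by rewrite ler_wpM2l.
  by apply: le_trans h4 _; rewrite ler_wpM2l ?addr_ge0// ltW.
apply: le_trans (lerD (lerD g1 g2) g3) _.
by rewrite le_eqVlt; apply/orP; left; apply/eqP; rewrite /C; ring.
Qed.

Lemma contS_bilin S (f : 'rV[R]_n -> E1) (g : 'rV[R]_n -> E2) :
  contS S f -> contS S g -> contS S (fun y => m (f y) (g y)).
Proof.
move=> hf hg; have [K K0 hK] := bil_bdd mP.
apply: contS_weak => x Sx.
have a0 := nm_ge0 (f x); have b0 := nm_ge0 (g x).
exists (K * (nm (f x) + 1 + nm (g x))).
  by rewrite mulr_ge0// !addr_ge0.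
move=> e e0 e1; have [r r0 hr] := hf x Sx e e0; have [s s0 hs] := hg x Sx e e0.
exists (Num.min r s); first by rewrite lt_min r0.
move=> y Sy xy.
have h1 : nm (f y - f x) <= e.
  by apply: hr => //; apply: near_pt_le xy; rewrite ge_min lexx.
have h2 : nm (g y - g x) <= e.
  by apply: hs => //; apply: near_pt_le xy; rewrite ge_min lexx orbT.
rewrite (sub_tele _ _ (m (f y) (g x))) -bilBl -bilBr.
apply: le_trans (nmD _ _) _.
have h3 : nm (f y) <= nm (f x) + 1.
  by rewrite -(subrK (f x) (f y)) addrC (le_trans (nmD _ _))// lerD2l; lra.
apply: le_trans (lerD (hK _ _) (hK _ _)) _.
have k1 : K * nm (f y) * nm (g y - g x) <= K * (nm (f x) + 1) * e.
  by rewrite ler_pM ?mulr_ge0 ?nm_ge0// ler_wpM2l.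
have k2 : K * nm (f y - f x) * nm (g x) <= K * e * nm (g x).
  by rewrite ler_wpM2r// ler_wpM2l.
by lra.
Qed.

End One.

(** Apply mvt_ineq to s |-> f (z + s h e_i) - s h c. *)
Lemma seg_mvt E S (f : 'rV[R]_n -> E) i (z : 'rV[R]_n) h (c : E) (e : R) :
  0 <= e ->
  (forall s, 0 <= s <= 1 -> S (stp i z (s * h))) ->
  (forall s, 0 <= s <= 1 -> exists2 d,
     is_part S f i (stp i z (s * h)) d & nm (d - c) <= e) ->
  nm (f (stp i z h) - f z - toC h *: c) <= e * `|h|.
Proof.
move=> e0 hS hf.
pose phi s := f (stp i z (s * h)) - toC (s * h) *: c.
have -> : f (stp i z h) - f z - toC h *: c = phi 1 - phi 0.
  by rewrite /phi mul1r mul0r stp0 /toC rmorph0 scale0r subr0 addrAC.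
apply: mvt_ineq => s s01 e' e'0.
have [d hd dc] := hf s s01.
have h1 : 0 < `|h| + 1 by have := normr_ge0 h; lra.
have [r r0 hr] := hd _ (divr_gt0 e'0 h1).
exists (r / (`|h| + 1)); first by rewrite divr_gt0.
move=> s' s'01 ss.
pose k := (s' - s) * h.
have kE : s' * h = s * h + k by rewrite /k; ring.
have kr : `|k| < r.
  rewrite /k normrM; move: ss; rewrite ltr_pdivlMr// => ss.
  apply: le_lt_trans ss; rewrite ler_wpM2l//; lra.
have Sk : S (stp i (stp i z (s * h)) k) by rewrite stpD -kE; exact: hS.
have := hr k kr Sk; rewrite stpD -kE => hk.
have -> : phi s' - phi s =
  (f (stp i z (s' * h)) - f (stp i z (s * h)) - toC k *: d) + toC k *: (d - c).
  have sE : toC (s' * h) *: c = toC (s * h) *: c + toC k *: c.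
    by rewrite kE /toC rmorphD scalerDl.
  rewrite /phi sE scalerBr -sub_tele subD_sub; congr (_ + _).
  by rewrite opprK opprD addrAC addNr add0r.
apply: le_trans (nmD _ _) _; rewrite nmZr.
have a1 : e' / (`|h| + 1) * `|k| <= e' * `|s' - s|.
  rewrite /k normrM mulrAC ler_pdivrMr// -[leRHS]mulrA ler_wpM2l ?(ltW e'0)//.
  by rewrite ler_wpM2l//; lra.
have a2 : `|k| * nm (d - c) <= e * `|h| * `|s' - s|.
  rewrite /k normrM mulrC [_ * `|h|]mulrC mulrA ler_wpM2r// ler_wpM2r//.
by apply: le_trans (lerD hk a2) _; lra.
Qed.

End Bilinear.

(** * Chain rule and symmetry of the second derivatives *)
Section Chain.
Variables (R : realType).
Implicit Types (E : normedModType R[i]).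

Lemma conv_itv (l u a b s : R) : 0 <= s <= 1 -> l <= a <= u -> l <= b <= u ->
  l <= a + s * (b - a) <= u.
Proof.
move=> /andP[s0 s1] /andP[a1 a2] /andP[b1 b2].
have -> : a + s * (b - a) = (1 - s) * a + s * b by ring.
have s2 : 0 <= 1 - s by lra.
have h1 := ler_wpM2l s0 b1; have h2 := ler_wpM2l s0 b2.
have h3 := ler_wpM2l s2 a1; have h4 := ler_wpM2l s2 a2.
by apply/andP; split; lra.
Qed.

(** Go from x to y one coordinate at a time, staying inside of the box around
    x, and apply the mean value inequality to each move. *)
Lemma total_diff n E S (f : 'rV[R]_n -> E) (f' : 'I_n -> 'rV[R]_n -> E) :
  locbox S -> (forall i y, S y -> is_part S f i y (f' i y)) ->
  (forall i, contS S (f' i)) -> forall x, S x -> forall e : R, 0 < e ->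
  exists2 de : R, 0 < de & forall y, S y -> near_pt x de y ->
    nm (f y - f x - \sum_i toC (y 0 i - x 0 i) *: f' i x)
      <= e * \sum_i `|y 0 i - x 0 i|.
Proof.
move=> Sb hf cf x Sx e e0.
have [l [u [lu xlu luS [d d0 hd]]]] := Sb x Sx.
have [d' d'0 hd'] : exists2 d' : R, 0 < d' & forall i, forall y, S y ->
    near_pt x d' y -> nm (f' i y - f' i x) <= e.
  apply: (@fin_delta R n (fun i d => forall y, S y ->
    near_pt x d y -> nm (f' i y - f' i x) <= e)) => [i r r' rr h y Sy xy|i].
    by apply: h => //; exact: near_pt_le xy.
  by have [r r0 hr] := cf i x Sx e e0; exists r.
exists (Num.min d d'); first by rewrite lt_min d0.
move=> y Sy xy.
have ylu : box l u y by apply: hd => //; apply: near_pt_le xy; rewrite ge_min lexx.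
pose z k : 'rV[R]_n := \row_i (if (i < k)%N then y 0 i else x 0 i).
have z0 : z 0%N = x by apply/rowP => i; rewrite mxE.
have zn : z n = y by apply/rowP => i; rewrite mxE ltn_ord.
have zS (i : 'I_n) : z i.+1 = stp i (z i) (y 0 i - x 0 i).
  apply/rowP => j; rewrite stpE !mxE.
  case: (eqVneq i j) => [<-|ij]; first by rewrite ltnSn ltnn mulr1n addrC subrK.
  have /negbTE ji : (j != i :> nat) by rewrite eq_sym.
  by rewrite mulr0n addr0 ltnS leq_eqVlt ji.
have -> : f y - f x = \sum_(i < n) (f (z i.+1) - f (z i)).
  by rewrite -[in LHS]zn -[in LHS]z0 -(@telescope_sumr _ 0 n (fun k => f (z k)))// big_mkord.
rewrite -sumrB; apply: le_trans (nm_sum _ _ _) _.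
rewrite mulr_sumr; apply: ler_sum => i _; rewrite zS.
have zin s : 0 <= s <= 1 -> S (stp i (z i) (s * (y 0 i - x 0 i))) /\
     near_pt x d' (stp i (z i) (s * (y 0 i - x 0 i))).
  move=> /andP[s0 s1]; split.
    apply: luS => j; rewrite stpE mxE.
    have /andP[? ?] := xlu j; have /andP[? ?] := ylu j.
    case: (eqVneq i j) => [<-|ij]; last by rewrite mulr0n addr0; case: ifP => _; apply/andP.
    by rewrite ltnn mulr1n; apply: conv_itv; rewrite ?s0//; apply/andP.
  move=> j; rewrite stpE mxE.
  have yj k : `|y 0 k - x 0 k| < d'.
    by apply: lt_le_trans (xy k) _; rewrite ge_min lexx orbT.
  case: (eqVneq i j) => [<-|ij]; last first.
    rewrite mulr0n addr0; case: ifP => // _.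
    by rewrite subrr normr0; exact: le_lt_trans (yj j).
  rewrite ltnn mulr1n addrC addKr normrM ger0_norm//.
  apply: le_lt_trans (yj i).
  by rewrite -[leRHS]mul1r ler_wpM2r.
apply: (@seg_mvt _ _ _ S _ _ _ _ _ _ (ltW e0)) => [s /zin[]//|s /zin[zS' zn']].
by exists (f' i (stp i (z i) (s * (y 0 i - x 0 i)))); [exact: hf|exact: hd'].
Qed.

(** Insert the expansion total_diff of f at tau x; the increments of tau are
    O(h) by is_part_lip, and their linear errors o(h). *)
Lemma is_part_comp n m E S S' (f : 'rV[R]_m -> E) (f' : 'I_m -> 'rV[R]_m -> E)
    (tau : 'rV[R]_n -> 'rV[R]_m) i x (J : 'I_m -> R[i]^o) :
  locbox S' -> (forall i y, S' y -> is_part S' f i y (f' i y)) ->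
  (forall i, contS S' (f' i)) ->
  (forall y, S y -> S' (tau y)) -> S x ->
  (forall j, is_part S (fun y => toC (tau y 0 j)) i x (J j)) ->
  is_part S (fun y => f (tau y)) i x (\sum_j J j *: f' j (tau x)).
Proof.
move=> Sb hf cf SS Sx hJ.
pose C := \sum_j (nm (J j) + 1) + \sum_j nm (f' j (tau x)).
have C0 : 0 <= C.
  by rewrite addr_ge0// sumr_ge0// => j _; rewrite ?addr_ge0// nm_ge0.
apply: (is_part_weak C0) => e e0 _.
have [d d0 hd] := total_diff Sb hf cf (SS _ Sx) e0.
pose P j r := forall h, `|h| < r -> S (stp i x h) ->
  [/\ `|tau (stp i x h) 0 j - tau x 0 j| < d,
      `|tau (stp i x h) 0 j - tau x 0 j| <= (nm (J j) + 1) * `|h| &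
      nm (toC (tau (stp i x h) 0 j - tau x 0 j) - toC h * J j : R[i]^o) <= e * `|h|].
have [r r0 hr] : exists2 r : R, 0 < r & forall j, P j r.
  apply: fin_delta => [j r r' rr h k kr|j]; first by apply: h; exact: lt_le_trans kr rr.
  have [r r0 hr] := hJ j e e0; have [s s0 hs] := is_part_lip (hJ j).
  have J0 : 0 < nm (J j) + 1 by have := nm_ge0 (J j); lra.
  exists (Num.min (Num.min r s) (d / (nm (J j) + 1))).
    by rewrite !lt_min r0 s0 divr_gt0.
  move=> k; rewrite !lt_min => /andP[/andP[kr ks] kd] Sk.
  have h1 : `|tau (stp i x k) 0 j - tau x 0 j| <= (nm (J j) + 1) * `|k|.
    by rewrite -nm_toC /toC rmorphB; exact: hs.
  split => //.
    by apply: le_lt_trans h1 _; rewrite mulrC -ltr_pdivlMr.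
  by rewrite /toC rmorphB; exact: hr.
exists r => // h hh Sh.
have := hd (tau (stp i x h)) (SS _ Sh) (fun j => let: And3 a _ _ := hr j h hh Sh in a).
move=> hA.
set A := \sum_i0 _ *: _ in hA.
rewrite (sub_tele _ _ A).
apply: le_trans (nmD _ _) _.
have -> : C * e * `|h| = e * (\sum_j (nm (J j) + 1) * `|h|) +
   \sum_j (e * `|h|) * nm (f' j (tau x)).
  by rewrite -mulr_suml -mulr_sumr /C; ring.
apply: lerD.
  apply: le_trans hA _; rewrite ler_wpM2l ?(ltW e0)//.
  by apply: ler_sum => j _; case: (hr j h hh Sh).
rewrite /A scaler_sumr -sumrB; apply: le_trans (nm_sum _ _ _) _.
apply: ler_sum => j _; rewrite scalerA -scalerBl nmZ ler_wpM2r ?nm_ge0//.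
by case: (hr j h hh Sh).
Qed.

Lemma is_part_sub n E S (f g : 'rV[R]_n -> E) i x d d' :
  is_part S f i x d -> is_part S g i x d' ->
  is_part S (fun y => f y - g y) i x (d - d').
Proof.
move=> hf hg; apply: is_partD hf _ => e e0.
have [r r0 hr] := hg e e0; exists r => // h hh Sh.
have -> : - g (stp i x h) - - g x - toC h *: - d' =
  - (g (stp i x h) - g x - toC h *: d') by rewrite scalerN !opprD !opprK.
by rewrite nmN; exact: hr.
Qed.

Lemma is_part_shift n E S S1 (f : 'rV[R]_n -> E) i j x k d :
  (forall y, S1 y -> S (stp j y k)) -> is_part S f i (stp j x k) d ->
  is_part S1 (fun y => f (stp j y k)) i x d.
Proof.
move=> SS hf e e0; have [r r0 hr] := hf e e0; exists r => // h hh Sh.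
by rewrite stpC; apply: hr => //; rewrite stpC; exact: SS.
Qed.

(** The mean value inequality in direction i for z |-> f (z + k e_j) - f z,
    then in direction j for its derivative. *)
Lemma mixed_diff n E S (f fi fij : 'rV[R]_n -> E) i j x :
  (forall y, S y -> is_part S f i y (fi y)) ->
  (forall y, S y -> is_part S fi j y (fij y)) -> contS S fij -> S x ->
  forall e : R, 0 < e -> exists2 de : R, 0 < de & forall h k,
    `|h| < de -> `|k| < de ->
    (forall s t, 0 <= s <= 1 -> 0 <= t <= 1 ->
       S (stp j (stp i x (s * h)) (t * k))) ->
    nm (f (stp j (stp i x h) k) - f (stp i x h) - (f (stp j x k) - f x)
        - toC h *: (toC k *: fij x)) <= e * `|k| * `|h|.
Proof.
move=> hf hfi cf Sx e e0; have [r r0 hr] := cf x Sx e e0.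
exists (r / 2); first by rewrite divr_gt0.
move=> h k hh hk hS.
pose S1 z := S z /\ S (stp j z k).
have s1 (s t : R) : 0 <= s <= 1 -> `|t| < r / 2 -> `|s * t| < r / 2.
  move=> /andP[s0 s1] tr; rewrite normrM ger0_norm//; apply: le_lt_trans tr.
  by rewrite -[leRHS]mul1r ler_wpM2r.
have hS0 s : 0 <= s <= 1 -> S (stp i x (s * h)).
  move=> s01; have := hS s 0 s01; rewrite mul0r stp0; apply.
  by rewrite lexx ler01.
have hS1 s : 0 <= s <= 1 -> S1 (stp i x (s * h)).
  move=> s01; split; first exact: hS0.
  by have := hS s 1 s01; rewrite mul1r; apply; rewrite lexx ler01.
apply: (@seg_mvt _ _ _ S1 (fun z => f (stp j z k) - f z)) => // [|s s01].
  by rewrite mulr_ge0// ltW.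
have [Sz Szk] := hS1 s s01.
exists (fi (stp j (stp i x (s * h)) k) - fi (stp i x (s * h))).
  apply: is_part_sub.
    by apply: is_part_shift (hf _ Szk) => y [].
  by apply: is_partS (hf _ Sz) => y [].
apply: (@seg_mvt _ _ _ S) => [|t t01|t t01]; [exact: ltW|exact: hS|].
exists (fij (stp j (stp i x (s * h)) (t * k))); first exact/hfi/hS.
apply: hr; first exact: hS.
rewrite [r]splitr; apply: near_pt_trans; apply: near_stp; exact: s1.
Qed.

(** Both mixed derivatives are limits of the same second difference divided by
    h k. *)
Lemma schwarz n E S (f fi fj fij fji : 'rV[R]_n -> E) i j :
  locbox S ->
  (forall y, S y -> is_part S f i y (fi y)) ->
  (forall y, S y -> is_part S f j y (fj y)) ->
  (forall y, S y -> is_part S fi j y (fij y)) ->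
  (forall y, S y -> is_part S fj i y (fji y)) ->
  contS S fij -> contS S fji -> forall x, S x -> fij x = fji x.
Proof.
move=> Sb hi hj hij hji cij cji x Sx.
have [E1|ij] := eqVneq i j.
  subst j; have fE y : S y -> fi y = fj y.
    by move=> Sy; apply: (is_part_uniq Sb Sy); [exact: hi|exact: hj].
  apply: (is_part_uniq Sb Sx); first exact: hij.
  by apply: is_part_eq (hji x Sx) => // y Sy; rewrite fE.
apply/eqP; rewrite -subr_eq0; apply/eqP/nm_small => e e0.
have e2 : 0 < e / 2 by rewrite divr_gt0.
have [r r0 hr] := mixed_diff hi hij cij Sx e2.
have [r' r'0 hr'] := mixed_diff hj hji cji Sx e2.
have rr0 : 0 < Num.min r r' by rewrite lt_min r0.
have [l [u [lu xlu luS _]]] := Sb x Sx.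
have [w [hw wS]] := box_dir lu xlu rr0.
pose h := w 0 i; pose k := w 0 j.
have [h0] := hw i; rewrite lt_min -/h => /andP[hh hh'].
have [k0] := hw j; rewrite lt_min -/k => /andP[kk kk'].
have hS s t : 0 <= s <= 1 -> 0 <= t <= 1 -> S (stp j (stp i x (s * h)) (t * k)).
  move=> s01 t01; apply: luS.
  have -> : stp j (stp i x (s * h)) (t * k) =
    \row_m (x 0 m + (if m == i then s else if m == j then t else 0) * w 0 m).
    apply/rowP => m; rewrite !stpE mxE !(eq_sym _ m).
    case: (eqVneq m i) => [->|mi]; first by rewrite (negbTE ij) mulr1n mulr0n addr0.
    by case: (eqVneq m j) => [->|mj]; rewrite ?mulr1n ?mulr0n ?mul0r !addr0.
  by apply: wS => m; case: ifP => // _; case: ifP => // _; rewrite lexx ler01.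
have {hr}a := hr h k hh kk hS.
have {hr'}b := hr' k h kk' hh'.
have {}b := b (fun s t a b => eq_ind _ S (hS t s b a) _ (stpC _ _ _ _ _)).
have hk0 : 0 < `|h| * `|k| by rewrite mulr_gt0// normr_gt0.
rewrite -(ler_pM2l hk0) -mulrA -!nmZr !scalerBr.
rewrite [toC h *: (toC k *: fji x)]scalerA [toC h * _]mulrC -scalerA.
set D := f (stp j (stp i x h) k) - f (stp i x h) - (f (stp j x k) - f x) in a.
rewrite (sub_sub _ _ D); apply: le_trans (nmD _ _) _; rewrite nmN.
move: b; rewrite stpC.
have -> : f (stp j (stp i x h) k) - f (stp j x k) - (f (stp i x h) - f x) = D.
  by rewrite /D !opprB addrACA [RHS]addrACA; congr (_ + _); rewrite addrC.
by lra.
Qed.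

End Chain.

(** * Convergent families of C^k functions *)
Section Families.
Variables (R : realType) (T : Type) (t0 : T) (FT : set_system T).
Context {FF : Filter FT}.
Implicit Types (E : normedModType R[i]).

(** Local uniform convergence of H t to H t0 along FT. *)
Definition loc_unif n E (S : set 'rV[R]_n) (H : T -> 'rV[R]_n -> E) :=
  forall x, S x -> forall e : R, 0 < e -> exists2 de : R, 0 < de &
    \forall t \near FT, forall y, S y -> near_pt x de y ->
      nm (H t y - H t0 y) <= e.

(** H t is C^k on S for every t, and converges to H t0 locally uniformly along
    FT with its partial derivatives up to order k. Constant families are C^k
    functions, so that each rule below proves both that an operation preserves
    smoothness and that it is continuous. Quantifying over the derivatives H'
    spares uniqueness arguments in the rules. *)
Fixpoint ccfam n E k (S : set 'rV[R]_n) (H : T -> 'rV[R]_n -> E) : Prop :=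
  [/\ forall t, contS S (H t), loc_unif S H &
   if k is k'.+1 then forall i, exists2 H' : T -> 'rV[R]_n -> E,
     forall t x, S x -> is_part S (H t) i x (H' t x) & ccfam k' S H'
   else True].

Definition relopen n (S U : set 'rV[R]_n) := forall x, S x -> U x ->
  exists2 d : R, 0 < d & forall y, S y -> near_pt x d y -> U y.

Section Basic.
Variables (n : nat).
Implicit Types (S U : set 'rV[R]_n).

Lemma cc_cont E k S (H : T -> 'rV[R]_n -> E) t : ccfam k S H -> contS S (H t).
Proof. by case: k => [|k] []. Qed.

Lemma cc_loc_unif E k S (H : T -> 'rV[R]_n -> E) : ccfam k S H -> loc_unif S H.
Proof. by case: k => [|k] []. Qed.

Lemma loc_unif_weak E S (H : T -> 'rV[R]_n -> E) :
  (forall x, S x -> exists2 C : R, 0 <= C &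
    forall e : R, 0 < e -> e <= 1 -> exists2 de : R, 0 < de &
    \forall t \near FT, forall y, S y -> near_pt x de y ->
      nm (H t y - H t0 y) <= C * e) -> loc_unif S H.
Proof.
move=> h x Sx; have [C C0 hC] := h x Sx.
apply: (eps_weak _ C0) => // e e' ee [de d0 hd].
exists de => //; apply: filterS hd => t ht y Sy xy.
exact: le_trans (ht y Sy xy) _.
Qed.

Lemma loc_unifS E S S' (H : T -> 'rV[R]_n -> E) : S' `<=` S -> loc_unif S H -> loc_unif S' H.
Proof.
move=> sS h x Sx e e0; have [d d0 hd] := h x (sS _ Sx) e e0.
by exists d => //; apply: filterS hd => t ht y Sy; apply: ht; exact: sS.
Qed.

Lemma loc_unif_eq E S (H G : T -> 'rV[R]_n -> E) :
  (forall t x, S x -> H t x = G t x) -> loc_unif S H -> loc_unif S G.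
Proof.
move=> HG h x Sx e e0; have [d d0 hd] := h x Sx e e0.
by exists d => //; apply: filterS hd => t ht y Sy; rewrite -!HG//; apply: ht.
Qed.

Lemma loc_unif_cst E S (f : 'rV[R]_n -> E) : loc_unif S (fun=> f).
Proof.
move=> x Sx e e0; exists 1 => //; apply: filterE => t y _ _.
by rewrite subrr nm0 ltW.
Qed.

Lemma cc_eq E k S (H G : T -> 'rV[R]_n -> E) :
  (forall t x, S x -> H t x = G t x) -> ccfam k S H -> ccfam k S G.
Proof.
case: k => [|k] HG [cH lH dH]; split => //.
- by move=> t; exact: contS_eq (HG t) (cH t).
- exact: loc_unif_eq lH.
- by move=> t; exact: contS_eq (HG t) (cH t).
- exact: loc_unif_eq lH.
- move=> i; have [H' h1 h2] := dH i; exists H' => // t x Sx.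
  exact: is_part_eq (HG t) (h1 t x Sx).
Qed.

Lemma cc_pred E k S (H : T -> 'rV[R]_n -> E) : ccfam k.+1 S H -> ccfam k S H.
Proof.
elim: k H => [|k IH] H [cH lH dH]; split => // i.
by have [H' h1 h2] := dH i; exists H' => //; exact: IH.
Qed.

Lemma cc_le E k k' S (H : T -> 'rV[R]_n -> E) : (k' <= k)%N ->
  ccfam k S H -> ccfam k' S H.
Proof.
move=> /subnK <-; elim: (k - k')%N => // m IH.
by rewrite addSn => /cc_pred.
Qed.

Lemma ccS E k S S' (H : T -> 'rV[R]_n -> E) : S' `<=` S ->
  ccfam k S H -> ccfam k S' H.
Proof.
move=> sS; elim: k H => [|k IH] H [cH lH dH]; split => //.
- by move=> t; exact: contSS (cH t).
- exact: loc_unifS lH.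
- by move=> t; exact: contSS (cH t).
- exact: loc_unifS lH.
- move=> i; have [H' h1 h2] := dH i; exists H'; last exact: IH.
  by move=> t x Sx; apply: is_partS (h1 t x (sS _ Sx)).
Qed.

Lemma loc_unif_bilin (E1 E2 E3 : normedModType R[i]) (m : E1 -> E2 -> E3) S
    (H : T -> 'rV[R]_n -> E1) (G : T -> 'rV[R]_n -> E2) :
  bdd_bilin m -> contS S (H t0) -> contS S (G t0) -> loc_unif S H -> loc_unif S G ->
  loc_unif S (fun t y => m (H t y) (G t y)).
Proof.
move=> mP cH cG lH lG; have [K K0 hK] := bil_bdd mP.
apply: loc_unif_weak => x Sx.
have a0 := nm_ge0 (H t0 x); have b0 := nm_ge0 (G t0 x).
exists (K * (nm (H t0 x) + 2 + (nm (G t0 x) + 1))).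
  by rewrite mulr_ge0// !addr_ge0.
move=> e e0 e1.
have [r r0 hr] := lH x Sx e e0; have [s s0 hs] := lG x Sx e e0.
have [r' r'0 hr'] := cH x Sx e e0; have [s' s'0 hs'] := cG x Sx e e0.
exists (Num.min (Num.min r s) (Num.min r' s')).
  by rewrite !lt_min r0 s0 r'0.
apply: filterS2 hr hs => t hr hs y Sy xy.
have h1 : nm (H t y - H t0 y) <= e.
  by apply: hr => //; apply: near_pt_le xy; rewrite !ge_min lexx.
have h2 : nm (G t y - G t0 y) <= e.
  by apply: hs => //; apply: near_pt_le xy; rewrite !ge_min lexx !orbT.
have h3 : nm (H t0 y - H t0 x) <= e.
  by apply: hr' => //; apply: near_pt_le xy; rewrite !ge_min lexx !orbT.
have h4 : nm (G t0 y - G t0 x) <= e.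
  by apply: hs' => //; apply: near_pt_le xy; rewrite !ge_min lexx !orbT.
have h5 : nm (H t y) <= nm (H t0 x) + 2.
  have -> : H t y = (H t y - H t0 y) + ((H t0 y - H t0 x) + H t0 x) by rewrite !subrK.
  apply: le_trans (nmD _ _) _; apply: le_trans (lerD (lexx _) (nmD _ _)) _; lra.
have h6 : nm (G t0 y) <= nm (G t0 x) + 1.
  by rewrite -(subrK (G t0 x) (G t0 y)); apply: le_trans (nmD _ _) _; lra.
rewrite (sub_tele _ _ (m (H t y) (G t0 y))) -(bilBl mP) -(bilBr mP).
apply: le_trans (nmD _ _) _.
apply: le_trans (lerD (hK _ _) (hK _ _)) _.
have k1 : K * nm (H t y) * nm (G t y - G t0 y) <= K * (nm (H t0 x) + 2) * e.
  by rewrite ler_pM ?mulr_ge0 ?nm_ge0// ler_wpM2l.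
have k2 : K * nm (H t y - H t0 y) * nm (G t0 y) <= K * e * (nm (G t0 x) + 1).
  by rewrite ler_pM ?mulr_ge0 ?nm_ge0// ler_wpM2l.
by lra.
Qed.

Lemma loc_unifD E S (H G : T -> 'rV[R]_n -> E) : loc_unif S H -> loc_unif S G ->
  loc_unif S (fun t y => H t y + G t y).
Proof.
move=> lH lG; apply: loc_unif_weak => x Sx; exists 2 => // e e0 e1.
have [r r0 hr] := lH x Sx e e0; have [s s0 hs] := lG x Sx e e0.
exists (Num.min r s); first by rewrite !lt_min r0 s0.
apply: filterS2 hr hs => t hr hs y Sy xy.
have h1 : nm (H t y - H t0 y) <= e.
  by apply: hr => //; apply: near_pt_le xy; rewrite !ge_min lexx.
have h2 : nm (G t y - G t0 y) <= e.
  by apply: hs => //; apply: near_pt_le xy; rewrite !ge_min lexx !orbT.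
by rewrite subD_sub; apply: le_trans (nmD _ _) _; lra.
Qed.

Lemma contSD E S (f g : 'rV[R]_n -> E) : contS S f -> contS S g ->
  contS S (fun y => f y + g y).
Proof.
move=> cf cg; apply: contS_weak => x Sx; exists 2 => // e e0 e1.
have [r r0 hr] := cf x Sx e e0; have [s s0 hs] := cg x Sx e e0.
exists (Num.min r s); first by rewrite !lt_min r0 s0.
move=> y Sy xy.
have h1 : nm (f y - f x) <= e.
  by apply: hr => //; apply: near_pt_le xy; rewrite !ge_min lexx.
have h2 : nm (g y - g x) <= e.
  by apply: hs => //; apply: near_pt_le xy; rewrite !ge_min lexx !orbT.
by rewrite subD_sub; apply: le_trans (nmD _ _) _; lra.
Qed.

Lemma ccD E k S (H G : T -> 'rV[R]_n -> E) : ccfam k S H -> ccfam k S G ->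
  ccfam k S (fun t y => H t y + G t y).
Proof.
elim: k H G => [|k IH] H G [cH lH dH] [cG lG dG]; split => //.
- by move=> t; exact: contSD.
- exact: loc_unifD.
- by move=> t; exact: contSD.
- exact: loc_unifD.
move=> i; have [H' h1 h2] := dH i; have [G' g1 g2] := dG i.
exists (fun t y => H' t y + G' t y); last exact: IH.
by move=> t x Sx; apply: is_partD; [exact: h1|exact: g1].
Qed.

(** By the Leibniz rule the derivatives are sums of products of families of
    lower order. *)
Lemma cc_bilin (E1 E2 E3 : normedModType R[i]) (m : E1 -> E2 -> E3) k S
    (H : T -> 'rV[R]_n -> E1) (G : T -> 'rV[R]_n -> E2) :
  bdd_bilin m -> ccfam k S H -> ccfam k S G ->
  ccfam k S (fun t y => m (H t y) (G t y)).
Proof.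
move=> mP; elim: k H G => [|k IH] H G HH HG.
  by have [cH lH _] := HH; have [cG lG _] := HG; split => // [t|];
    [exact: contS_bilin|exact: loc_unif_bilin].
have [cH lH dH] := HH; have [cG lG dG] := HG; split => // [t||i].
- exact: contS_bilin.
- exact: loc_unif_bilin.
have [H' h1 h2] := dH i; have [G' g1 g2] := dG i.
exists (fun t y => m (H' t y) (G t y) + m (H t y) (G' t y)).
  by move=> t x Sx; apply: is_part_bilin; [exact: mP|exact: h1|exact: g1].
by apply: ccD; apply: IH => //; exact: cc_pred.
Qed.

Lemma cc_cst E k S (c : E) : ccfam k S (fun _ _ => c).
Proof.
elim: k c => [|k IH] c;
  (split => [t||]; [exact: contS_cst|exact: loc_unif_cst|]) => // i.
exists (fun _ _ => 0); last exact: IH.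
by move=> t x Sx; exact: is_part_cst.
Qed.

Lemma cc_sum E k S (I : Type) (r : seq I) (P : pred I)
    (H : I -> T -> 'rV[R]_n -> E) :
  (forall i, P i -> ccfam k S (H i)) ->
  ccfam k S (fun t y => \sum_(i <- r | P i) H i t y).
Proof.
move=> h; elim: r => [|a r IH].
  by apply: cc_eq (cc_cst k S 0) => t y _; rewrite big_nil.
case Pa : (P a).
  by apply: cc_eq (ccD (h a Pa) IH) => t y _; rewrite big_cons Pa.
by apply: cc_eq IH => t y _; rewrite big_cons Pa.
Qed.

(** By uniqueness of partial derivatives, those provided by ccfam are the ones
    named partial. *)
Lemma cc_canon E k S (H : T -> 'rV[R]_n -> E) : locbox S ->
  ccfam k.+1 S H -> forall i,
  (forall t x, S x -> is_part S (H t) i x (partial S (H t) i x)) /\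
  ccfam k S (fun t => partial S (H t) i).
Proof.
move=> Sb [_ _ dH] i; have [H' h1 h2] := dH i.
have HE t x : S x -> H' t x = partial S (H t) i x.
  by move=> Sx; rewrite (is_part_partial Sb Sx (h1 t x Sx)).
split; last by apply: cc_eq h2.
by move=> t x Sx; rewrite -HE//; exact: h1.
Qed.

Lemma cc_partials E k (s : seq 'I_n) S (H : T -> 'rV[R]_n -> E) : locbox S ->
  ccfam (size s + k) S H -> ccfam k S (fun t => partials S (H t) s).
Proof.
move=> Sb; elim: s k => //= i s IH k h.
have : ccfam k.+1 S (fun t => partials S (H t) s) by apply: IH; rewrite addnS.
by move=> /(cc_canon Sb)/(_ i)[].
Qed.

(** The partial derivatives along the pieces S `&` U are those along S, hence
    fit together. *)
Lemma cc_local E k S (H : T -> 'rV[R]_n -> E) : locbox S ->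
  (forall x, S x -> exists U : set 'rV[R]_n,
     [/\ U x, relopen S U & ccfam k (S `&` U) H]) ->
  ccfam k S H.
Proof.
move=> Sb; have base k' (G : T -> 'rV[R]_n -> E) :
    (forall x, S x -> exists U : set 'rV[R]_n,
     [/\ U x, relopen S U & ccfam k' (S `&` U) G]) ->
    (forall t, contS S (G t)) /\ loc_unif S G.
  move=> h; split => [t|] x Sx e e0; have [U [Ux Uo hU]] := h x Sx;
    have [d d0 hd] := Uo x Sx Ux.
    have [r r0 hr] := cc_cont t hU (conj Sx Ux) e0.
    exists (Num.min d r); first by rewrite lt_min d0.
    move=> y Sy xy; apply: hr; last by apply: near_pt_le xy; rewrite !ge_min lexx orbT.
    by split => //; apply: hd => //; apply: near_pt_le xy; rewrite !ge_min lexx.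
  have [r r0 hr] := cc_loc_unif hU (conj Sx Ux) e0.
  exists (Num.min d r); first by rewrite lt_min d0.
  apply: filterS hr => t hr y Sy xy.
  apply: hr; last by apply: near_pt_le xy; rewrite !ge_min lexx orbT.
  by split => //; apply: hd => //; apply: near_pt_le xy; rewrite !ge_min lexx.
elim: k H => [|k IH] H h; first by have [? ?] := base _ _ h.
have [? ?] := base _ _ h; split => // i.
have is_p t x U : S x -> U x -> relopen S U -> ccfam k.+1 (S `&` U) H ->
    is_part S (H t) i x (partial (S `&` U) (H t) i x).
  move=> Sx Ux Uo hU.
  have [h1 _] := cc_canon (locbox_open Sb Uo) hU i.
  apply: is_part_local (h1 t x (conj Sx Ux)).
  by have [d d0 hd] := Uo x Sx Ux; exists d => // y Sy xy; split => //; exact: hd.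
have partE t x U : S x -> U x -> relopen S U -> ccfam k.+1 (S `&` U) H ->
    partial (S `&` U) (H t) i x = partial S (H t) i x.
  by move=> Sx Ux Uo hU; rewrite (is_part_partial Sb Sx (is_p t x U Sx Ux Uo hU)).
exists (fun t => partial S (H t) i).
  move=> t x Sx; have [U [Ux Uo hU]] := h x Sx.
  by rewrite -(partE t x U)//; exact: is_p.
apply: IH => x Sx; have [U [Ux Uo hU]] := h x Sx; exists U; split => //.
have [_ h2] := cc_canon (locbox_open Sb Uo) hU i.
by apply: cc_eq h2 => t y [Sy Uy]; exact: partE.
Qed.

(** Through this lemma the rules for families apply to smoothness. *)
Lemma smooth_onP E S (f : 'rV[R]_n -> E) : locbox S ->
  smooth_on S f <-> forall k, ccfam k S (fun=> f).
Proof.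
move=> Sb; split=> [h k|h s].
  suff : forall s, ccfam k S (fun=> partials S f s) by move=> /(_ [::]).
  elim: k => [|k IH] s; have [h1 h2] := h s; split => //.
  - by move=> _; apply/contSP.
  - exact: loc_unif_cst.
  - by move=> _; apply/contSP.
  - exact: loc_unif_cst.
  move=> i; exists (fun=> partials S f (i :: s)); last exact: IH.
  by move=> _ x Sx; apply: cvg_is_part; exact: h2.
have hs k : ccfam k S (fun=> partials S f s) by exact: cc_partials.
split; first by apply/contSP; exact: (cc_cont t0 (hs 0%N)).
move=> i x Sx; have [h1 _] := cc_canon Sb (hs 1%N) i.
by apply/cvg_ex; exists (partial S (partials S f s) i x); exact: is_part_cvg (h1 t0 x Sx).
Qed.

End Basic.
End Families.

(** * Rules for bounded maps and for composition *)
Section Bilinears.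
Variables (R : realType).
Implicit Types (E : normedModType R[i]).

Lemma scale_bilin E : bdd_bilin (fun (c : R[i]^o) (x : E) => c *: x).
Proof.
split => [a b c|a b c|r a b|r a b|].
- exact: scalerDl.
- exact: scalerDr.
- by rewrite scalerA.
- by rewrite scalerA mulrC -scalerA.
- by exists 1 => // a b; rewrite mul1r nmZ.
Qed.

Lemma amulDl (A : preCStarType R[i]) (a b c : A) : (a + b) ** c = a ** c + b ** c.
Proof. by have := amul_linl 1 a b c; rewrite !scale1r. Qed.

Lemma amulDr (A : preCStarType R[i]) (a b c : A) : a ** (b + c) = a ** b + a ** c.
Proof. by have := amul_linr 1 b c a; rewrite !scale1r. Qed.

Lemma amul0l (A : preCStarType R[i]) (a : A) : 0 ** a = 0.
Proof. by apply: (addrI (0 ** a)); rewrite -amulDl !addr0. Qed.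

Lemma amul0r (A : preCStarType R[i]) (a : A) : a ** 0 = 0.
Proof. by apply: (addrI (a ** 0)); rewrite -amulDr !addr0. Qed.

Lemma amulZl (A : preCStarType R[i]) c (a b : A) : (c *: a) ** b = c *: (a ** b).
Proof. by have := amul_linl c a 0 b; rewrite amul0l !addr0. Qed.

Lemma amulZr (A : preCStarType R[i]) c (a b : A) : a ** (c *: b) = c *: (a ** b).
Proof. by have := amul_linr c b 0 a; rewrite amul0r !addr0. Qed.

Lemma nm_amul (A : preCStarType R[i]) (a b : A) : nm (a ** b) <= nm a * nm b.
Proof.
by rewrite -nm_le; apply: le_trans (amul_norm a b) _; rewrite !nmE /toC rmorphM.
Qed.

Lemma amul_bilin (A : preCStarType R[i]) : bdd_bilin (@amul _ A).
Proof.
split => [a b c|a b c|r a b|r a b|].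
- exact: amulDl.
- exact: amulDr.
- exact: amulZl.
- exact: amulZr.
- by exists 1 => // a b; rewrite mul1r nm_amul.
Qed.

Record bdd_linear E1 E2 (L : E1 -> E2) : Prop := BddLinear {
  blinD : forall a b, L (a + b) = L a + L b;
  blinZ : forall (r : R) a, L (toC r *: a) = toC r *: L a;
  blin_bdd : exists2 K : R, 0 <= K & forall a, nm (L a) <= K * nm a }.

(** With the constant scalar 1, the rules for bilinear maps become rules for
    linear maps. *)
Lemma blin_bilin E1 E2 (L : E1 -> E2) : bdd_linear L ->
  bdd_bilin (fun (c : R[i]^o) (x : E1) => c *: L x).
Proof.
move=> [LD LZ [K K0 hK]]; split => [a b c|a b c|r a b|r a b|].
- exact: scalerDl.
- by rewrite LD scalerDr.
- by rewrite scalerA.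
- by rewrite LZ !scalerA mulrC.
- exists K => // a b; rewrite nmZ -mulrA mulrCA ler_wpM2l ?nm_ge0//.
Qed.

End Bilinears.

Section FamRules.
Variables (R : realType) (T : Type) (t0 : T) (FT : set_system T).
Context {FF : Filter FT}.
Implicit Types (E : normedModType R[i]).

Lemma ccZ E n k (S : set 'rV[R]_n) (c : T -> 'rV[R]_n -> R[i]^o)
    (H : T -> 'rV[R]_n -> E) : ccfam t0 FT k S c -> ccfam t0 FT k S H ->
  ccfam t0 FT k S (fun t y => c t y *: H t y).
Proof. exact: (cc_bilin (scale_bilin E)). Qed.

Lemma cc_amul (A : preCStarType R[i]) n k (S : set 'rV[R]_n)
  (G H : T -> 'rV[R]_n -> A) : ccfam t0 FT k S G -> ccfam t0 FT k S H ->
  ccfam t0 FT k S (fun t y => G t y ** H t y).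
Proof. exact: (cc_bilin (amul_bilin A)). Qed.

Lemma cc_lin E1 E2 (L : E1 -> E2) n k (S : set 'rV[R]_n)
    (H : T -> 'rV[R]_n -> E1) : bdd_linear L ->
  ccfam t0 FT k S H -> ccfam t0 FT k S (fun t y => L (H t y)).
Proof.
move=> hL hH.
apply: cc_eq (cc_bilin (blin_bilin hL) (cc_cst t0 k S (1 : R[i]^o)) hH).
by move=> t y _; rewrite scale1r.
Qed.

Lemma is_part_lin E1 E2 (L : E1 -> E2) n (S : set 'rV[R]_n) f i x d :
  bdd_linear L -> is_part S f i x d ->
  is_part S (fun y => L (f y)) i x (L d).
Proof.
move=> hL hf.
have := is_part_bilin (blin_bilin hL) (is_part_cst S (1 : R[i]^o) i x) hf.
rewrite scale0r add0r scale1r => h e e0; have [r r0 hr] := h e e0.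
by exists r => // k kr Sk; have := hr k kr Sk; rewrite !scale1r.
Qed.

Lemma ccB E n k (S : set 'rV[R]_n) (G H : T -> 'rV[R]_n -> E) :
  ccfam t0 FT k S G -> ccfam t0 FT k S H ->
  ccfam t0 FT k S (fun t y => G t y - H t y).
Proof.
move=> hG hH; apply: cc_eq (ccD hG (ccZ (cc_cst t0 k S (-1 : R[i]^o)) hH)).
by move=> t y _; rewrite scaleN1r.
Qed.

Lemma coord_part n (S : set 'rV[R]_n) i j x :
  is_part S (fun y => toC (y 0 j)) i x ((i == j)%:R : R[i]^o).
Proof.
move=> e e0; exists 1 => // h _ _; rewrite stpE /toC rmorphD rmorphMn /=.
by rewrite [_ + _ *+ _]addrC addrK -[X in nm (X - _)]mulr_natr subrr nm0 mulr_ge0// ltW.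
Qed.

Lemma cc_coord n k (S : set 'rV[R]_n) (j : 'I_n) :
  ccfam t0 FT k S (fun _ y => toC (y 0 j)).
Proof.
have c (t : T) : contS S (fun y : 'rV[R]_n => toC (y 0 j)).
  move=> x Sx e e0; exists e => // y Sy xy.
  by rewrite /toC -rmorphB -/(toC _) nm_toC ltW.
case: k => [|k]; split => //; try exact: loc_unif_cst.
move=> i; exists (fun _ _ => (i == j)%:R : R[i]^o); last exact: cc_cst.
by move=> t x Sx; exact: coord_part.
Qed.

Lemma tau_near n m (S : set 'rV[R]_n) (tau : 'rV[R]_n -> 'rV[R]_m) x :
  (forall j, contS S (fun y => toC (tau y 0 j))) -> S x ->
  forall e : R, 0 < e -> exists2 d : R, 0 < d &
    forall y, S y -> near_pt x d y -> near_pt (tau x) e (tau y).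
Proof.
move=> ct Sx e e0.
have [d d0 hd] : exists2 d : R, 0 < d & forall j, forall y, S y ->
    near_pt x d y -> `|tau y 0 j - tau x 0 j| < e.
  apply: (@fin_delta R m (fun j d => forall y, S y ->
    near_pt x d y -> `|tau y 0 j - tau x 0 j| < e)) => [j r r' rr h y Sy xy|j].
    by apply: h => //; exact: near_pt_le xy.
  have e2 : 0 < e / 2 by rewrite divr_gt0.
  have [r r0 hr] := ct j x Sx _ e2; exists r => // y Sy xy.
  have := hr y Sy xy; rewrite /toC -rmorphB -/(toC _) nm_toC => h; lra.
by exists d => // y Sy xy j; exact: hd.
Qed.

(** By the chain rule the derivatives are sums of products of derivatives of
    tau with derivatives of H t composed with tau, families of lower order. *)
Lemma cc_comp E n m k (S : set 'rV[R]_n) (S' : set 'rV[R]_m)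
    (H : T -> 'rV[R]_m -> E) (tau : 'rV[R]_n -> 'rV[R]_m) :
  locbox S' -> (forall y, S y -> S' (tau y)) ->
  (forall j, ccfam t0 FT k S (fun _ y => toC (tau y 0 j))) ->
  ccfam t0 FT k S' H -> ccfam t0 FT k S (fun t y => H t (tau y)).
Proof.
move=> Sb SS ht hH.
have ct j : contS S (fun y => toC (tau y 0 j)) := cc_cont t0 (ht j).
have hc t : contS S (fun y => H t (tau y)).
  move=> x Sx e e0; have [d d0 hd] := cc_cont t hH (SS _ Sx) e0.
  have [r r0 hr] := tau_near ct Sx d0.
  by exists r => // y Sy xy; apply: hd; [exact: SS|exact: hr].
have hl : loc_unif t0 FT S (fun t y => H t (tau y)).
  move=> x Sx e e0; have [d d0 hd] := cc_loc_unif hH (SS _ Sx) e0.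
  have [r r0 hr] := tau_near ct Sx d0; exists r => //.
  by apply: filterS hd => t ht' y Sy xy; apply: ht'; [exact: SS|exact: hr].
elim: k H hH ht hc hl => [|k IH] H hH ht hc hl; first by split.
split => // i; have [_ _ dH] := hH.
have [J hJ1 hJ2] : exists2 J : 'I_m -> T -> 'rV[R]_n -> R[i]^o,
    forall j t x, S x -> is_part S (fun y => toC (tau y 0 j)) i x (J j t x) &
    forall j, ccfam t0 FT k S (J j).
  have /choice[J hJ] : forall j, exists J : T -> 'rV[R]_n -> R[i]^o,
      (forall t x, S x -> is_part S (fun y => toC (tau y 0 j)) i x (J t x)) /\
      ccfam t0 FT k S J.
    by move=> j; have [_ _ /(_ i)[J h1 h2]] := ht j; exists J.
  by exists J => j; have [] := hJ j.
have [H' hH1 hH2] : exists2 H' : 'I_m -> T -> 'rV[R]_m -> E,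
    forall j t x, S' x -> is_part S' (H t) j x (H' j t x) &
    forall j, ccfam t0 FT k S' (H' j).
  have /choice[H' hH'] : forall j, exists H' : T -> 'rV[R]_m -> E,
      (forall t x, S' x -> is_part S' (H t) j x (H' t x)) /\
      ccfam t0 FT k S' H'.
    by move=> j; have [H' h1 h2] := dH j; exists H'.
  by exists H' => j; have [] := hH' j.
exists (fun t y => \sum_j J j t y *: H' j t (tau y)).
  move=> t x Sx; apply: (@is_part_comp R n m E S S' (H t) (fun j => H' j t)) => //.
  - by move=> j; exact: hH1.
  - by move=> j; exact: cc_cont t (hH2 j).
  - by move=> j; exact: hJ1.
apply: cc_sum => j _; apply: ccZ => //.
have ht' j' := cc_pred (ht j').
apply: IH => // [t|].
  move=> x Sx e e0; have [d d0 hd] := cc_cont t (hH2 j) (SS _ Sx) e0.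
  have [r r0 hr] := tau_near ct Sx d0.
  by exists r => // y Sy xy; apply: hd; [exact: SS|exact: hr].
move=> x Sx e e0; have [d d0 hd] := cc_loc_unif (hH2 j) (SS _ Sx) e0.
have [r r0 hr] := tau_near ct Sx d0; exists r => //.
by apply: filterS hd => t hht y Sy xy; apply: hht; [exact: SS|exact: hr].
Qed.

Lemma nmM (a b : R[i]) : nm (a * b : R[i]^o) = nm (a : R[i]^o) * nm (b : R[i]^o).
Proof. exact: (@nmZ R (R[i]^o) a b). Qed.

Lemma nm_inv (a : R[i]) : nm (a^-1 : R[i]^o) = (nm (a : R[i]^o))^-1.
Proof.
have [->|a0] := eqVneq a 0; first by rewrite invr0 nm0 invr0.
have h : nm (a : R[i]^o) * nm (a^-1 : R[i]^o) = 1.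
  by rewrite -nmM divff// -[1]/(toC 1 : R[i]) nm_toC normr1.
apply: (mulfI (x := nm (a : R[i]^o))); last first.
  rewrite h divff//; apply/eqP => h0; move: h; rewrite h0 mul0r => /eqP.
  by rewrite eq_sym oner_eq0.
by apply/eqP => h0; move: h; rewrite h0 mul0r => /eqP; rewrite eq_sym oner_eq0.
Qed.

Lemma nm_gt0 E (a : E) : a != 0 -> 0 < nm a.
Proof.
move=> a0; rewrite lt_neqAle nm_ge0 andbT eq_sym; apply: contra a0 => /eqP h.
by apply/eqP; exact: nm0_eq.
Qed.

End FamRules.

(** * Inverses and bump functions *)
Section Inverse.
Variables (R : realType).

Lemma contS_inv n (S : set 'rV[R]_n) (f : 'rV[R]_n -> R[i]^o) :
  (forall x, S x -> f x != 0) -> contS S f ->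
  contS S (fun y => (f y : R[i])^-1 : R[i]^o).
Proof.
move=> f0 cf; apply: contS_weak => x Sx.
have a0 : 0 < nm (f x) by exact: nm_gt0 (f0 x Sx).
set A := nm (f x) in a0.
exists (2 / (A * A)); first by rewrite divr_ge0// ltW// mulr_gt0.
move=> e e0 e1.
have m0 : 0 < Num.min e (A / 2) by rewrite lt_min e0 divr_gt0.
have [r r0 hr] := cf x Sx _ m0; exists r => // y Sy xy.
have := hr y Sy xy; rewrite le_min => /andP[h1 h2].
have b0 : A / 2 <= nm (f y).
  have : A <= nm (f y) + nm (f y - f x).
    rewrite nmB /A -[X in nm X <= _](subrK (f y)) addrC; exact: nmD.
  by lra.
have -> : (f y : R[i])^-1 - (f x)^-1 =
    - ((f y - f x : R[i]) * (f x)^-1 * (f y)^-1) :> R[i].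
  by field; rewrite !f0.
rewrite (@nmN _ R[i]^o) !nmM !nm_inv -/A.
have b1 : 0 < nm (f y) by lra.
have -> : 2 / (A * A) * e = e / A * (A / 2)^-1.
  by field; rewrite gt_eqF.
apply: ler_pM; rewrite ?invr_ge0 ?(ltW b1)//.
- by rewrite mulr_ge0 ?nm_ge0 ?invr_ge0 ?(ltW a0).
- by rewrite ler_wpM2r// invr_ge0 (ltW a0).
- by rewrite lef_pV2// posrE; lra.
Qed.

(** 1 / f y - 1 / f x + d h / (f x)^2 is minus the linear error of f divided
    by (f x)^2, plus (f y - f x)^2 / ((f x)^2 f y). *)
Lemma is_part_inv n (S : set 'rV[R]_n) (f : 'rV[R]_n -> R[i]^o) i x
    (d : R[i]^o) : (forall x, S x -> f x != 0) -> contS S f -> S x ->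
  is_part S f i x d ->
  is_part S (fun y => (f y : R[i])^-1 : R[i]^o) i x
    (- ((d : R[i]) * (f x)^-1 * (f x)^-1) : R[i]^o).
Proof.
move=> f0 cf Sx hf.
have a0 : 0 < nm (f x) by exact: nm_gt0 (f0 x Sx).
set A := nm (f x) in a0.
have d0 := nm_ge0 d.
apply: (@is_part_weak R n _ S _ i x _
  (A^-1 * A^-1 + (nm d + 1) * (nm d + 1) * A^-1 * A^-1 * (A / 2)^-1)).
  by rewrite addr_ge0// !mulr_ge0// ?invr_ge0 ?addr_ge0 ?divr_ge0 ?(ltW a0).
move=> e e0 e1.
have A2 : 0 < A / 2 by rewrite divr_gt0.
have [r r0 hr] := cf x Sx _ A2; have [s s0 hs] := is_part_lip hf.
have [q q0 hq] := hf e e0.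
exists (Num.min (Num.min r s) (Num.min q e)).
  by rewrite !lt_min r0 s0 q0.
move=> h; rewrite !lt_min => /andP[/andP[kr ks] /andP[kq ke]] Sk.
have h1 := hr _ Sk (near_stp i x kr).
have h2 := hs h ks Sk; have h3 := hq h kq Sk.
set y := stp i x h in Sk h1 h2 h3 *.
have b0 : A / 2 <= nm (f y).
  have : A <= nm (f y) + nm (f y - f x).
    rewrite nmB /A -[X in nm X <= _](subrK (f y)) addrC; exact: nmD.
  by lra.
have b1 : 0 < nm (f y) by lra.
have -> : (f y : R[i])^-1 - (f x)^-1 - toC h *: (- ((d : R[i]) * (f x)^-1 * (f x)^-1) : R[i]^o) =
   (- ((f y - f x - toC h * d : R[i]) * (f x)^-1 * (f x)^-1)) +
   ((f y - f x : R[i]) * (f y - f x) * (f x)^-1 * (f x)^-1 * (f y)^-1) :> R[i].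
  rewrite -[toC h *: _]/(toC h * _ : R[i]).
  by field; rewrite !f0.
apply: le_trans (@nmD _ R[i]^o _ _) _.
rewrite (@nmN _ R[i]^o) !nmM !nm_inv -/A 2!mulrDl.
have i0 : 0 <= A^-1 by rewrite invr_ge0 ltW.
apply: lerD.
  have -> : A^-1 * A^-1 * e * `|h| = e * `|h| * A^-1 * A^-1 by ring.
  by rewrite !ler_wpM2r.
have -> : (nm d + 1) * (nm d + 1) * A^-1 * A^-1 * (A / 2)^-1 * e * `|h| =
  ((nm d + 1) * e) * ((nm d + 1) * `|h|) * A^-1 * A^-1 * (A / 2)^-1 by ring.
apply: ler_pM; rewrite ?mulr_ge0 ?nm_ge0 ?invr_ge0 ?nm_ge0//; last first.
  by rewrite lef_pV2// posrE.
rewrite !ler_wpM2r// ler_pM ?nm_ge0//.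
by apply: le_trans h2 _; rewrite ler_wpM2l ?addr_ge0// ltW.
Qed.

Variables (T : Type) (t0 : T) (FT : set_system T).
Context {FF : Filter FT}.

Lemma cc_inv n k (S : set 'rV[R]_n) (f : 'rV[R]_n -> R[i]^o) :
  (forall x, S x -> f x != 0) -> ccfam t0 FT k S (fun _ => f) ->
  ccfam t0 FT k S (fun _ y => (f y : R[i])^-1 : R[i]^o).
Proof.
move=> f0; elim: k => [|k IH] hf.
  by split => // [t|]; [apply: contS_inv => //; exact: cc_cont t hf|exact: loc_unif_cst].
split => [t||i]; first by apply: contS_inv => //; exact: cc_cont t hf.
  exact: loc_unif_cst.
have [_ _ /(_ i)[H' h1 h2]] := hf.
exists (fun t y => - ((H' t y : R[i]) * (f y)^-1 * (f y)^-1) : R[i]^o).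
  move=> t x Sx; apply: is_part_inv => //; first exact: cc_cont t hf.
  exact: h1.
have h := IH (cc_pred hf).
apply: cc_eq (ccZ (cc_cst t0 k S (-1 : R[i]^o)) (ccZ (ccZ h2 h) h)) => t y _.
by rewrite scaleN1r.
Qed.

Lemma cc_prod n k (S : set 'rV[R]_n) (I : Type) (r : seq I)
    (H : I -> T -> 'rV[R]_n -> R[i]^o) :
  (forall i, ccfam t0 FT k S (H i)) ->
  ccfam t0 FT k S (fun t y => \prod_(i <- r) (H i t y : R[i]) : R[i]^o).
Proof.
move=> h; elim: r => [|a r IH].
  by apply: cc_eq (cc_cst t0 k S (1 : R[i]^o)) => t y _; rewrite big_nil.
by apply: cc_eq (ccZ (h a) IH) => t y _; rewrite big_cons.
Qed.

End Inverse.

Section Bump.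
Variables (R : realType).

(** For k = 0 the standard smooth function that vanishes exactly on the
    nonpositive numbers. The factors t^-k make the family closed under
    derivation (flat_rd). *)
Definition flat (k : nat) (t : R) : R := if 0 < t then t ^- k * expR (- t^-1) else 0.

(** The derivative of a real function, with the error in the same form as in
    is_part. *)
Definition rderiv (f : R -> R) (t d : R) := forall e : R, 0 < e ->
  exists2 de : R, 0 < de & forall h, `|h| < de ->
    `|f (t + h) - f t - h * d| <= e * `|h|.

Lemma is_derive_rd (f : R -> R) (t d : R) : is_derive t 1 f d -> rderiv f t d.
Proof.
move=> [df dE] e e0.
have /cvgrPdist_lt/(_ e e0) : h^-1 *: (f (h *: 1 + t) - f t) @[h --> 0^'] --> d.
  by rewrite -dE; exact: df.
rewrite /prop_near1 => /nbhs_ballP[r /= r0 hr]; exists r => // h hh.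
have [->|h0] := eqVneq h 0.
  by rewrite addr0 subrr mul0r subrr !normr0 mulr0.
have h1 : 0 < `|h| by rewrite normr_gt0.
have := hr h; rewrite /= -ball_normE /= sub0r normrN => /(_ hh h0)/ltW.
rewrite -(ler_pM2l h1) -normrM mulrBr [h *: 1]mulr1 [h^-1 *: _]/(_ * _) mulrA.
by rewrite divff// mul1r distrC (addrC h) mulrC [_ * e]mulrC.
Qed.

(** The m-th power of 1 + u / m <= exp (u / m). *)
Lemma pow_le_exp (m : nat) (u : R) : 0 <= u ->
  u ^+ m <= m%:R ^+ m * expR u.
Proof.
move=> u0; case: m => [|m]; first by rewrite !expr0 mul1r -expR0 ler_expR.
have m0 : (0 : R) < m.+1%:R by rewrite ltr0n.
have {2}-> : u = m.+1%:R * (u / m.+1%:R) by rewrite mulrC divfK// gt_eqF.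
rewrite expRM_natl -exprMn; apply: lerXn2r; rewrite ?nnegrE//.
by rewrite -ler_pdivrMl// mulrC; apply: le_trans (expR_ge1Dx _); rewrite lerDr.
Qed.

(** From pow_le_exp at 1 / t; the exponent 2 makes the derivative at 0 vanish. *)
Lemma flat_le (k : nat) (t : R) : 0 < t ->
  flat k t <= (k + 2)%:R ^+ (k + 2) * t ^+ 2.
Proof.
move=> t0; rewrite /flat t0 expRN.
rewrite ler_pdivrMr ?expR_gt0// mulrAC -ler_pdivrMr ?exprn_gt0//.
rewrite -!exprVn -exprD; apply: pow_le_exp.
by rewrite invr_ge0 ltW.
Qed.

Lemma flat_ge0 k t : 0 <= flat k t.
Proof. by rewrite /flat; case: ifP => // t0; rewrite mulr_ge0 ?expR_ge0// invr_ge0 exprn_ge0// ltW. Qed.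

(** For t > 0 this is the product rule, at 0 the quadratic bound flat_le. *)
Lemma flat_rd k t : rderiv (flat k) t (- k%:R * flat k.+1 t + flat k.+2 t).
Proof.
have [t0|] := ltP 0 t; last first.
  rewrite le_eqVlt => /orP[/eqP ->|t0]; last first.
    move=> e e0; exists (- t); first by rewrite oppr_gt0.
    move=> h ht; have th : t + h <= 0 by move: ht; rewrite ltr_norml => /andP[]; lra.
    rewrite /flat !ltNge th (ltW t0) /= mulr0 addr0 mulr0 !subr0 normr0.
    by rewrite mulr_ge0// ltW.
  have f00 m : flat m 0 = 0 by rewrite /flat ltxx.
  move=> e e0; pose C : R := (k + 2)%:R ^+ (k + 2).
  have C0 : 0 < C + 1 by rewrite ltr_wpDl// exprn_ge0.
  exists (e / (C + 1)); first by rewrite divr_gt0.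
  move=> h hh; rewrite add0r !f00 mulr0 addr0 mulr0 !subr0.
  rewrite ger0_norm ?flat_ge0//.
  have [h0|h0] := ltP 0 h; last first.
    by rewrite /flat ltNge h0 mulr_ge0// ltW.
  apply: le_trans (flat_le k h0) _; rewrite -/C.
  rewrite (gtr0_norm h0) expr2 mulrA ler_wpM2r ?(ltW h0)//.
  move: hh; rewrite (gtr0_norm h0) ltr_pdivlMr// => hh.
  by rewrite mulrC; apply: le_trans (ltW hh); rewrite ler_wpM2l ?(ltW h0)//; lra.
have tn : t != 0 by rewrite gt_eqF.
pose g (s : R) : R := s ^- k * expR (- s^-1).
have hg : is_derive t 1 g (- k%:R * flat k.+1 t + flat k.+2 t).
  have hV : is_derive t 1 (fun s : R => s^-1) (- t ^- 2).
    by apply: DeriveDef; [exact: derivableV|rewrite deriveV// derive_id scaler1].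
  have -> : g = ((fun s : R => s^-1) ^+ k) * (expR \o (- (fun s : R => s^-1))).
    by apply/funext => s; rewrite /g /= fctE /= exprfctE exprVn.
  apply: is_derive_eq.
  rewrite /flat t0 /= exprfctE fctE -!exprVn -![_ *: _]/(_ * _).
  by case: k {g} => [|k]; rewrite ?expr0 ?exprS ?expr0 -?[k.+1.-1]/k; ring.
move=> e e0; have [r r0 hr] := is_derive_rd hg e0.
exists (Num.min r t); first by rewrite lt_min r0.
move=> h; rewrite lt_min => /andP[kr kt].
have th : 0 < t + h by move: kt; rewrite ltr_norml => /andP[]; lra.
have fe s : 0 < s -> flat k s = g s by rewrite /flat => ->.
by rewrite !fe//; exact: hr.
Qed.

Lemma flat_gt0 k t : (0 < flat k t) = (0 < t).
Proof.
rewrite /flat; case: ifP => t0; last by rewrite ltxx.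
by rewrite mulr_gt0 ?expR_gt0// invr_gt0 exprn_gt0.
Qed.

Lemma toC0 : toC 0 = 0 :> R[i]^o.
Proof. by rewrite /toC rmorph0. Qed.

Lemma flat_part n (S : set 'rV[R]_n) k i j (c b : R) x :
  is_part S (fun y => toC (flat k (c * y 0 j + b)) : R[i]^o) i x
   (toC (c *+ (i == j)) *:
     (toC (- k%:R * flat k.+1 (c * x 0 j + b) + flat k.+2 (c * x 0 j + b)) : R[i]^o)).
Proof.
apply: (@is_part_weak R n _ S _ i x _ `|c|) => // e e0 _.
have [r r0 hr] := flat_rd k (c * x 0 j + b) e0.
have c0 : 0 < `|c| + 1 by rewrite ltr_wpDl.
exists (r / (`|c| + 1)); first by rewrite divr_gt0.
move=> h; rewrite ltr_pdivlMr// => hh _; rewrite stpE.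
case: eqP => _; last first.
  by rewrite !mulr0n addr0 subrr toC0 scale0r scaler0 subrr nm0 !mulr_ge0// ltW.
rewrite !mulr1n; have -> : c * (x 0 j + h) + b = c * x 0 j + b + c * h by ring.
have ch : `|c * h| < r.
  by apply: le_lt_trans hh; rewrite normrM mulrC ler_wpM2l//; lra.
have := hr _ ch; rewrite -[X in X <= _ -> _]nm_toC.
rewrite scalerA /toC !rmorphB [in X in X -> _]rmorphM (mulrC c h) rmorphM.
by rewrite normrM => /le_trans; apply; rewrite le_eqVlt; apply/orP; left; apply/eqP; ring.
Qed.

Variables (T : Type) (t0 : T) (FT : set_system T).
Context {FF : Filter FT}.

(** The derivatives of flat k are combinations of flat k.+1 and flat k.+2,
    whence an induction on the order r for all k at once. *)
Lemma cc_flat n (S : set 'rV[R]_n) r k j (c b : R) :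
  ccfam t0 FT r S (fun _ y => toC (flat k (c * y 0 j + b)) : R[i]^o).
Proof.
have cont k' : contS S (fun y => toC (flat k' (c * y 0 j + b)) : R[i]^o).
  move=> x Sx e e0; have [r0 r00 hr] := flat_rd k' (c * x 0 j + b) ltr01.
  set d := - k'%:R * _ + _ in hr.
  have d0 : 0 < `|d| + 1 by rewrite ltr_wpDl.
  have c0 : 0 < `|c| + 1 by rewrite ltr_wpDl.
  exists (Num.min r0 (e / (`|d| + 1)) / (`|c| + 1)).
    by rewrite divr_gt0// lt_min r00 divr_gt0.
  move=> y Sy /(_ j); rewrite ltr_pdivlMr// => hh.
  have ch : `|c * (y 0 j - x 0 j)| < Num.min r0 (e / (`|d| + 1)).
    by apply: le_lt_trans hh; rewrite normrM mulrC ler_wpM2l//; lra.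
  move: ch; rewrite lt_min => /andP[ch1 ch2].
  have := hr _ ch1; rewrite mul1r.
  have -> : c * x 0 j + b + c * (y 0 j - x 0 j) = c * y 0 j + b by ring.
  move=> h1; rewrite /toC -rmorphB -/(toC _) nm_toC.
  move: ch2; rewrite ltr_pdivlMr// => /ltW; apply: le_trans.
  rewrite -(subrK (c * (y 0 j - x 0 j) * d) (flat k' _ - _)).
  apply: le_trans (ler_normD _ _) _; rewrite [X in _ + X]normrM.
  by rewrite [leRHS]mulrDr mulr1 addrC lerD.
elim: r k => [|r IH] k;
  (split => [t||]; [exact: cont|exact: loc_unif_cst|]) => // i.
exists (fun _ x => (toC (c *+ (i == j)) *:
     (toC (- k%:R * flat k.+1 (c * x 0 j + b) + flat k.+2 (c * x 0 j + b)) : R[i]^o))).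
  by move=> t x Sx; exact: flat_part.
apply: ccZ; first exact: cc_cst.
apply: cc_eq (ccD (ccZ (cc_cst t0 r S (toC (- k%:R) : R[i]^o)) (IH k.+1)) (IH k.+2)) => t y _.
by rewrite [in RHS]/toC rmorphD rmorphM.
Qed.

End Bump.

(** * Smooth functions and bounds on their derivatives *)
Section Ck.
Variables (R : realType) (n : nat).
Implicit Types (E : normedModType R[i]) (S : set 'rV[R]_n).

(** The derivatives found for one parameter t0 serve for every other parameter
    set. *)
Lemma cc_const E k S (f : 'rV[R]_n -> E) (T T' : Type) (t0 : T) (t0' : T')
    (FT : set_system T) (FT' : set_system T') {FF : Filter FT} {FF' : Filter FT'} :
  locbox S -> ccfam t0 FT k S (fun=> f) -> ccfam t0' FT' k S (fun=> f).
Proof.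
move=> Sb; elim: k f => [|k IH] f [cH lH dH].
  by split => [_||//]; [exact: cH t0|exact: loc_unif_cst].
split => [_||i]; [exact: cH t0|exact: loc_unif_cst|].
have [H' h1 h2] := dH i.
exists (fun=> H' t0); first by move=> _; exact: h1.
apply: IH; apply: cc_eq h2 => t x Sx.
by apply: (is_part_uniq Sb Sx); [exact: h1|exact: h1].
Qed.

(** Smoothness as a constant family over a one-point parameter set. *)
Definition sm E S (f : 'rV[R]_n -> E) := forall k,
  ccfam tt (globally [set: unit]) k S (fun=> f).

Lemma sm_cc E S (f : 'rV[R]_n -> E) k (T : Type) (t0 : T) (FT : set_system T)
    {FF : Filter FT} : locbox S -> sm S f -> ccfam t0 FT k S (fun=> f).
Proof. by move=> Sb /(_ k); exact: cc_const. Qed.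

Lemma sm_smooth_on E S (f : 'rV[R]_n -> E) : locbox S -> smooth_on S f <-> sm S f.
Proof. by move=> Sb; exact: smooth_onP. Qed.

Section Fixed.
Variables (E : normedModType R[i]) (S : set 'rV[R]_n).
Hypothesis Sb : locbox S.
Implicit Types (f g : 'rV[R]_n -> E).

Notation dS i f := (partial S f i).

Lemma sm_part f i x : sm S f -> S x -> is_part S f i x (dS i f x).
Proof. by move=> /(_ 1%N) h Sx; have [h1 _] := cc_canon Sb h i; exact: (h1 tt). Qed.

Lemma sm_d f i : sm S f -> sm S (dS i f).
Proof. by move=> h k; have [_ ] := cc_canon Sb (h k.+1) i. Qed.

Lemma sm_cont f : sm S f -> contS S f.
Proof. by move=> /(_ 0%N) h; exact: cc_cont tt h. Qed.

Lemma sm_eq f g : (forall x, S x -> f x = g x) -> sm S f -> sm S g.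
Proof. by move=> fg h k; apply: cc_eq (h k) => _. Qed.

Lemma dS_eq f g i : (forall x, S x -> f x = g x) -> sm S f ->
  forall x, S x -> dS i f x = dS i g x.
Proof.
move=> fg hf x Sx; rewrite (@is_part_partial _ _ _ _ g i x (dS i f x))//.
by apply: is_part_eq (sm_part i hf Sx).
Qed.

Lemma smB f g : sm S f -> sm S g -> sm S (fun x => f x - g x).
Proof. by move=> hf hg k; exact: ccB (hf k) (hg k). Qed.

Lemma smD f g : sm S f -> sm S g -> sm S (fun x => f x + g x).
Proof. by move=> hf hg k; exact: ccD (hf k) (hg k). Qed.

Lemma smZ (c : 'rV[R]_n -> R[i]^o) f : sm S c -> sm S f -> sm S (fun x => c x *: f x).
Proof. by move=> hf hg k; exact: ccZ (hf k) (hg k). Qed.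

Lemma sm_sum (I : Type) (r : seq I) (f : I -> 'rV[R]_n -> E) :
  (forall i, sm S (f i)) -> sm S (fun x => \sum_(i <- r) f i x).
Proof. by move=> h k; apply: (@cc_sum R unit tt _ _ n E k S I r xpredT (fun i _ => f i)) => i _; exact: h. Qed.

Lemma dSB f g i : sm S f -> sm S g ->
  forall x, S x -> dS i (fun x => f x - g x) x = dS i f x - dS i g x.
Proof.
move=> hf hg x Sx; apply: is_part_partial => //.
by apply: is_part_sub; exact: sm_part.
Qed.

Lemma dSD f g i : sm S f -> sm S g ->
  forall x, S x -> dS i (fun x => f x + g x) x = dS i f x + dS i g x.
Proof.
move=> hf hg x Sx; apply: is_part_partial => //.
by apply: is_partD; exact: sm_part.
Qed.

Lemma dSZ (c : 'rV[R]_n -> R[i]^o) f i : sm S c -> sm S f ->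
  forall x, S x -> dS i (fun x => c x *: f x) x =
    (partial S c i x : R[i]) *: f x + (c x : R[i]) *: dS i f x.
Proof.
move=> hf hg x Sx; apply: is_part_partial => //.
apply: (is_part_bilin (scale_bilin E)); last exact: sm_part.
have [h1 _] := cc_canon Sb (hf 1%N) i; exact: (h1 tt).
Qed.

Lemma dS_sum (I : Type) (r : seq I) (f : I -> 'rV[R]_n -> E) i :
  (forall a, sm S (f a)) ->
  forall x, S x -> dS i (fun x => \sum_(a <- r) f a x) x = \sum_(a <- r) dS i (f a) x.
Proof.
move=> h x Sx; elim: r => [|a r IH].
  rewrite big_nil (@is_part_partial _ _ _ _ _ i x 0)//.
  apply: (is_part_eq Sx _ (is_part_cst S (0 : E) i x)) => y _.
  by rewrite big_nil.
rewrite big_cons -IH -dSD//; last exact: sm_sum.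
apply: dS_eq => // [y _|]; first by rewrite big_cons.
by apply: sm_sum.
Qed.

Lemma dS_comm f i j : sm S f ->
  forall x, S x -> dS i (dS j f) x = dS j (dS i f) x.
Proof.
move=> h; apply: (@schwarz R n E S f (dS j f) (dS i f) _ _ j i) => //.
- by move=> y; exact: sm_part.
- by move=> y; exact: sm_part.
- by move=> y Sy; apply: sm_part => //; exact: sm_d.
- by move=> y Sy; apply: sm_part => //; exact: sm_d.
- by apply: sm_cont; do 2 apply: sm_d.
- by apply: sm_cont; do 2 apply: sm_d.
Qed.

(** Bounds on the partial derivatives up to order r in the directions of P. On
    a box the variables are approximated one after the other, and the
    derivatives in the remaining directions have to be controlled apart. *)
Fixpoint bdP (P : pred 'I_n) (r : nat) (e : R) f : Prop :=
  (forall x, S x -> nm (f x) <= e) /\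
  if r is r'.+1 then forall i, P i -> bdP P r' e (dS i f) else True.

Lemma bdP_eq P r e f g : (forall x, S x -> f x = g x) -> sm S f ->
  bdP P r e f -> bdP P r e g.
Proof.
elim: r f g => [|r IH] f g fg hf [h1 h2]; split => //.
- by move=> x Sx; rewrite -fg//; exact: h1.
- by move=> x Sx; rewrite -fg//; exact: h1.
move=> i Pi; apply: IH (h2 i Pi); last exact: sm_d.
exact: dS_eq.
Qed.

Lemma bdP_pred P r e f : bdP P r.+1 e f -> bdP P r e f.
Proof.
elim: r f => [|r IH] f [h1 h2]; split => // i Pi.
by apply: IH; exact: h2.
Qed.

Lemma bdP_le P r e e' f : e <= e' -> bdP P r e f -> bdP P r e' f.
Proof.
move=> ee; elim: r f => [|r IH] f [h1 h2];
  (split; first by move=> x Sx; apply: le_trans (h1 x Sx) ee) => //.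
by move=> i Pi; apply: IH; exact: h2.
Qed.

Lemma bdPD P r e e' f g : sm S f -> sm S g -> bdP P r e f -> bdP P r e' g ->
  bdP P r (e + e') (fun x => f x + g x).
Proof.
elim: r f g => [|r IH] f g sf sg [f1 f2] [g1 g2];
  (split; first by move=> x Sx; apply: le_trans (nmD _ _) _; rewrite lerD ?f1 ?g1) => //.
move=> i Pi.
have h := IH _ _ (sm_d i sf) (sm_d i sg) (f2 i Pi) (g2 i Pi).
apply: bdP_eq h; first by move=> x Sx; rewrite dSD.
by apply: smD; exact: sm_d.
Qed.

Lemma bdP_partials r e f : sm S f -> bdP xpredT r e f ->
  forall s, (size s <= r)%N -> forall x, S x -> nm (partials S f s x) <= e.
Proof.
elim: r f => [|r IH] f sf [h1 h2] s.
  by rewrite leqn0 size_eq0 => /eqP -> /=.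
case/lastP: s => [|s i]; first by move=> _ x Sx; exact: h1.
rewrite size_rcons ltnS => ss x Sx; rewrite /partials foldr_rcons.
by apply: (IH (dS i f)) => //; [exact: sm_d|exact: h2].
Qed.

(** Partial derivatives commute: those along i can be taken first. *)
Lemma bdP_all i r e f : sm S f ->
  (forall m, (m <= r)%N -> bdP (predC1 i) r e (iter m (fun g => dS i g) f)) ->
  bdP xpredT r e f.
Proof.
elim: r f => [|r IH] f sf h; first by have [h1 _] := h 0%N isT; split.
have [h1 _] := h 0%N isT; split => // j _.
have sm_iter m g : sm S g -> sm S (iter m (fun g => dS i g) g).
  by move=> sg; elim: m => //= m hm; exact: sm_d.
apply: IH => [|m mr]; first exact: sm_d.
have [->|ji] := eqVneq j i.
  by rewrite -iterSr; apply: bdP_pred; exact: h.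
have [_ h2] := h m (leq_trans mr (leqnSn r)).
apply: bdP_eq (h2 j ji); last by apply: sm_d; exact: sm_iter.
move=> x Sx; elim: m {mr h2} x Sx => //= m IHm x Sx.
rewrite dS_comm//; last exact: sm_iter.
by apply: dS_eq => //; apply: sm_d; exact: sm_iter.
Qed.

End Fixed.
End Ck.

(** * Bernstein weights *)
Section Poly.
Variables (R : realType).
Implicit Types (p : {poly R}).

Lemma poly_part n (S : set 'rV[R]_n) p i j x :
  is_part S (fun y => toC p.[y 0 j]) i x
    ((i == j)%:R * (toC p^`().[x 0 j] : R[i]) : R[i]^o).
Proof.
elim/poly_ind: p => [|p c IH].
  rewrite deriv0 horner0 toC0 mulr0.
  have -> : (fun y : 'rV[R]_n => toC (0 : {poly R}).[y 0 j]) = (fun=> 0).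
    by apply/funext => y; rewrite horner0 toC0.
  exact: is_part_cst.
have -> : (fun y : 'rV[R]_n => toC (p * 'X + c%:P).[y 0 j]) =
   (fun y => toC p.[y 0 j] *: toC (y 0 j) + toC c).
  by apply/funext => y; rewrite !hornerE /toC rmorphD rmorphM.
have := is_partD (is_part_bilin (scale_bilin (R[i]^o)) IH (coord_part S i j x))
  (is_part_cst S (toC c) i x).
congr is_part; rewrite derivD derivM derivX derivC addr0 mulr1 !hornerE.
rewrite /toC rmorphD rmorphM /= mulrDr mulrA; congr (_ + _).
by rewrite mulrC.
Qed.

Lemma sm_poly n (S : set 'rV[R]_n) p j : sm S (fun y => toC p.[y 0 j]).
Proof.
have ct q : contS S (fun y => toC q.[y 0 j]).
  have cx : contS S (fun y : 'rV[R]_n => toC (y 0 j)).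
    by apply: (@cc_cont _ _ tt (globally [set: unit]) _ _ 0%N S (fun _ y => toC (y 0 j)) tt); exact: cc_coord.
  elim/poly_ind: q => [|q c IH].
    have h0 : contS S (fun _ : 'rV[R]_n => 0 : R[i]^o) by exact: contS_cst.
    apply: (contS_eq _ h0) => y _. by rewrite horner0 toC0.
  have h0 : contS S (fun _ : 'rV[R]_n => toC c) by exact: contS_cst.
  apply: (contS_eq _ (contSD (contS_bilin (scale_bilin (R[i]^o)) IH cx) h0)) => y _.
  by rewrite !hornerE /toC rmorphD rmorphM.
move=> k; elim: k p => [|k IH] p;
  (split; [by move=> _; exact: ct|exact: loc_unif_cst|]) => // i.
exists (fun _ y => (i == j)%:R *: toC p^`().[y 0 j]).
  by move=> _ x _; exact: poly_part.
by apply: ccZ; [exact: cc_cst|exact: IH].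
Qed.

(** The polynomials binomial(N, k) T^k (1 - T)^(N - k), through the recursion
    of Pascal, which reduces moments to inductions on N. *)
Fixpoint bern (T : {poly R}) (N k : nat) : {poly R} :=
  if N is N'.+1 then
    (if k is k'.+1 then T * bern T N' k' else 0) + (1 - T) * bern T N' k
  else (k == 0%N)%:R.

Lemma bern_out T N k : (N < k)%N -> bern T N k = 0.
Proof.
elim: N k => [|N IH] [|k] //= Nk.
by rewrite !IH ?mulr0 ?addr0// ltnW.
Qed.

(** The expectation of phi for the binomial law of parameters N and T(t). *)
Definition bsum (T : {poly R}) (N : nat) (t : R) (phi : nat -> R) :=
  \sum_(k < N.+1) (bern T N k).[t] * phi k.

Lemma bsumS T N t phi : bsum T N.+1 t phi =
  T.[t] * bsum T N t (fun k => phi k.+1) + (1 - T.[t]) * bsum T N t phi.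
Proof.
rewrite /bsum !mulr_sumr big_ord_recl /= add0r.
under eq_bigr => i _ do rewrite /bump /= add1n hornerD !hornerM mulrDl.
rewrite big_split /= addrCA; congr (_ + _).
  by apply: eq_bigr => i _; rewrite mulrA.
rewrite big_ord_recr /= (bern_out T (ltnSn N)) horner0 mulr0 mul0r addr0.
rewrite [RHS]big_ord_recl /= hornerM hornerD hornerN hornerC; congr (_ + _); first by rewrite mulrA.
by apply: eq_bigr => i _; rewrite /bump /= add1n  mulrA.
Qed.

Lemma bsum1 T N t : bsum T N t (fun=> 1) = 1.
Proof.
elim: N => [|N IH]; first by rewrite /bsum big_ord1 /= !hornerE.
by rewrite bsumS !IH; ring.
Qed.

(** At c = N T(t) this is the variance of the binomial law; a general c is
    what the recursion bsumS requires. *)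
Lemma bsum_var T N t c : bsum T N t (fun k => (k%:R - c) ^+ 2) =
  N%:R * T.[t] * (1 - T.[t]) + (N%:R * T.[t] - c) ^+ 2.
Proof.
elim: N c => [|N IH] c.
  rewrite /bsum big_ord1 /= -[(1 : {poly R})]/(1%:P) hornerC. ring.
rewrite bsumS IH.
have -> : bsum T N t (fun k => (k.+1%:R - c) ^+ 2) =
          bsum T N t (fun k => (k%:R - (c - 1)) ^+ 2).
  by apply: eq_bigr => k _; rewrite -natr1; congr (_ * _ ^+ 2); ring.
rewrite IH -natr1; ring.
Qed.

Lemma bern_ge0 T N k t : 0 <= T.[t] <= 1 -> 0 <= (bern T N k).[t].
Proof.
move=> /andP[t0 t1]; elim: N k => [|N IH] k /=.
  by case: k => [|k] /=; rewrite hornerE.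
rewrite hornerD hornerM addr_ge0// ?mulr_ge0//.
  by case: k => [|k]; rewrite ?horner0// hornerM mulr_ge0.
by rewrite hornerD hornerN hornerC subr_ge0.
Qed.

(** Normalized to vanish at a. *)
Definition antider p (a : R) : {poly R} :=
  let q := \poly_(k < (size p).+1) (p`_k.-1 / k%:R) in q - q.[a]%:P.

Lemma antider_deriv p a : (antider p a)^`() = p.
Proof.
apply/polyP => k; rewrite derivB derivC subr0 coef_deriv coef_poly ltnS /=.
case: ltnP => kp; last by rewrite mul0rn nth_default.
by rewrite -[LHS]mulr_natr divfK// pnatr_eq0.
Qed.

Lemma antider_root p a : (antider p a).[a] = 0.
Proof. by rewrite !hornerE subrr. Qed.

End Poly.

(** * Uniformity on compact sets *)
Section Compact.
Variables (R : realType) (n : nat).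

(** Compactness in its near-covering form, for the filter of the positive
    reals near 0. *)
Lemma compact_unif (K : set 'rV[R]_n) (Q : R -> 'rV[R]_n -> Prop) :
  compact K -> (forall d d' y, d' <= d -> Q d y -> Q d' y) ->
  (forall x, K x -> exists2 d : R, 0 < d & forall y, near_pt x d y -> Q d y) ->
  exists2 d : R, 0 < d & forall x, K x -> Q d x.
Proof.
move=> /compact_near_coveringP Kc mQ hQ.
have h : \forall e \near (0 : R)^'+, K `<=` Q e.
  apply: Kc => x Kx; have [d d0 hd] := hQ x Kx.
  exists ([set y | near_pt x d y], [set e | e <= d]) => /=; last first.
    by move=> [y e] [/= xy ed]; apply: mQ ed _; exact: hd.
  split; first by apply/near_ptP; exists d.
  exists d => //= e; rewrite /ball_ /= sub0r normrN => /ltW h _.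
  by apply: le_trans h; exact: ler_norm.
have : \forall e \near (0 : R)^'+, 0 < e /\ (forall x, K x -> Q e x).
  by near=> e; split; [near: e; exact: nbhs_right_gt|near: e; exact: h].
by move=> /filter_ex[e [e0 he]]; exists e.
Unshelve. all: by end_near.
Qed.

(** Compactness in its near-covering form, for the filter FT. *)
Lemma compact_loc_unif (T : Type) (t0 : T) (FT : set_system T) {FF : Filter FT}
    (E : normedModType R[i]) (S K : set 'rV[R]_n) (H : T -> 'rV[R]_n -> E) :
  compact K -> K `<=` S -> loc_unif t0 FT S H -> forall e : R, 0 < e ->
  \forall t \near FT, forall x, K x -> nm (H t x - H t0 x) <= e.
Proof.
move=> /compact_near_coveringP Kc KS hl e e0.
have : \forall t \near FT, K `<=` (fun x => S x -> nm (H t x - H t0 x) <= e).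
  apply: Kc => x Kx; have [d d0 hd] := hl x (KS _ Kx) e e0.
  exists ([set y | near_pt x d y], [set t | forall y, S y -> near_pt x d y ->
      nm (H t y - H t0 y) <= e]) => /=.
    by split; [apply/near_ptP; exists d|].
  by move=> [y t] [/= xy ht] Sy; exact: ht.
by apply: filterS => t ht x Kx; apply: ht => //; exact: KS.
Qed.

Lemma box_compact (l u : 'rV[R]_n) : compact (box l u).
Proof.
have := @rV_compact R n (fun i => `[l 0 i, u 0 i]%classic) (fun i => @segment_compact R _ _).
by congr compact; apply/seteqP; split => x /= h i; have := h i; rewrite /= in_itv.
Qed.

Lemma unif_cont (E : normedModType R[i]) (l u : 'rV[R]_n) (f : 'rV[R]_n -> E) :
  contS (box l u) f -> forall e : R, 0 < e -> exists2 d : R, 0 < d &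
  forall x y, box l u x -> box l u y -> near_pt x d y -> nm (f y - f x) <= e.
Proof.
move=> cf e e0.
have [|x Bx|d d0 hd] := @compact_unif (box l u)
  (fun d x => forall y, box l u x -> box l u y -> near_pt x d y -> nm (f y - f x) <= e)
  (@box_compact l u).
- move=> d d' x dd h y Bx By xy; apply: h => //; exact: near_pt_le xy.
- have e2 : 0 < e / 2 by rewrite divr_gt0.
  have [d d0 hd] := cf x Bx _ e2.
  exists (d / 2); first by rewrite divr_gt0.
  move=> y xy z By Bz yz.
  have dd : d / 2 <= d by lra.
  have h1 := hd y By (near_pt_le dd xy).
  have h2 : near_pt x d z by rewrite [d]splitr; exact: near_pt_trans xy yz.
  rewrite (sub_tele _ _ (f x)); apply: le_trans (nmD _ _) _.
  by rewrite [nm (f x - _)]nmB [leRHS]splitr; apply: lerD; [exact: hd|].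
- by exists d => // x y Bx By; exact: hd.
Qed.

Lemma box_bdd (E : normedModType R[i]) (l u : 'rV[R]_n) (f : 'rV[R]_n -> E) :
  contS (box l u) f -> exists2 M : R, 0 <= M &
  forall x, box l u x -> nm (f x) <= M.
Proof.
move=> cf.
have [|x Bx|d d0 hd] := @compact_unif (box l u)
  (fun d x => box l u x -> 0 < d -> nm (f x) <= d^-1) (@box_compact l u).
- move=> d d' x dd h Bx d'0; have d0 : 0 < d by exact: lt_le_trans d'0 dd.
  by apply: le_trans (h Bx d0) _; rewrite lef_pV2.
- have [d d0 hd] := cf x Bx _ ltr01.
  have m0 : 0 < nm (f x) + 1 by have := nm_ge0 (f x); lra.
  exists (Num.min d (nm (f x) + 1)^-1); first by rewrite lt_min d0 invr_gt0.
  move=> y xy By m1.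
  have h1 : nm (f y - f x) <= 1.
    by apply: hd => //; apply: near_pt_le xy; rewrite ge_min lexx.
  apply: (@le_trans _ _ (nm (f x) + 1)).
    by rewrite -(subrK (f x) (f y)) addrC; apply: le_trans (nmD _ _) _; rewrite lerD2l.
  by rewrite -[leLHS]invrK lef_pV2 ?posrE ?invr_gt0// ge_min lexx orbT.
- by exists d^-1; [rewrite invr_ge0 ltW|move=> x Bx; exact: hd].
Qed.

End Compact.

(** * Bernstein operators in one variable *)
Section OneVar.
Variables (R : realType) (n : nat) (E : normedModType R[i]).
Variables (l u : 'rV[R]_n) (i : 'I_n).
Hypothesis lu : nondeg l u.
Let B := box l u.
Let Bb : locbox B := locbox_box lu.
Implicit Types (f g G : 'rV[R]_n -> E) (x y : 'rV[R]_n).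
Notation dB j f := (partial B f j).

Definition freeze (v : R) x : 'rV[R]_n := \row_j (if j == i then v else x 0 j).

Lemma freeze_box v x : l 0 i <= v <= u 0 i -> B x -> B (freeze v x).
Proof. by move=> hv Bx j; rewrite mxE; case: eqP => [->|]. Qed.

Lemma freeze_id x : freeze (x 0 i) x = x.
Proof. by apply/rowP => j; rewrite mxE; case: eqP => [->|]. Qed.

Lemma freeze_stp v x j h : j != i -> freeze v (stp j x h) = stp j (freeze v x) h.
Proof.
move=> ji; apply/rowP => m; rewrite !(mxE, stpE).
by case: (eqVneq m i) => // ->; rewrite (negbTE ji) mulr0n addr0.
Qed.

Lemma freeze_stpi v x h : freeze v (stp i x h) = freeze v x.
Proof.
apply/rowP => m; rewrite !(mxE, stpE).
by case: (eqVneq m i) => // mi; rewrite mulr0n addr0.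
Qed.

Lemma freeze_part v G j x d : l 0 i <= v <= u 0 i -> j != i ->
  is_part B G j (freeze v x) d -> is_part B (fun y => G (freeze v y)) j x d.
Proof.
move=> hv ji h e e0; have [r r0 hr] := h e e0; exists r => // k kr Bk.
by rewrite freeze_stp//; apply: hr => //; rewrite -freeze_stp//; exact: freeze_box.
Qed.

Lemma freeze_parti v G x : is_part B (fun y => G (freeze v y)) i x 0.
Proof.
move=> e e0; exists 1 => // k _ _.
by rewrite freeze_stpi subrr scaler0 subrr nm0 mulr_ge0// ltW.
Qed.

Lemma freeze_near v x d y : 0 < d -> near_pt x d y -> near_pt (freeze v x) d (freeze v y).
Proof. by move=> d0 h j; rewrite !mxE; case: eqP => // _; rewrite subrr normr0. Qed.

Lemma freeze_sm v G : l 0 i <= v <= u 0 i -> sm B G -> sm B (fun y => G (freeze v y)).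
Proof.
move=> hv sG k; elim: k G sG => [|k IH] G sG.
  split => [_||//]; last exact: loc_unif_cst.
  move=> x Bx e e0; have [d d0 hd] := sm_cont sG (freeze_box hv Bx) e0.
  exists d => // y By xy; apply: hd; first exact: freeze_box.
  exact: freeze_near.
split => [_||j]; last 1 first.
- exists (fun _ y => if j == i then 0 else dB j G (freeze v y)).
    move=> _ x Bx; case: eqVneq => [->|ji]; first exact: freeze_parti.
    by apply: freeze_part => //; apply: sm_part => //; exact: freeze_box.
  case: eqVneq => _; first exact: cc_cst.
  by apply: IH; exact: sm_d.
- move=> x Bx e e0; have [d d0 hd] := sm_cont sG (freeze_box hv Bx) e0.
  exists d => // y By xy; apply: hd; first exact: freeze_box.
  exact: freeze_near.
- exact: loc_unif_cst.
Qed.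

Let W := u 0 i - l 0 i.
Let W0 : 0 < W. Proof. by rewrite subr_gt0. Qed.

(** Mean value inequality on a segment in direction i, starting from the face.
    The derivatives of f in the other directions vanish on the face as well,
    so they obey the same bound. *)
Lemma bdP_face r e f : 0 <= e -> sm B f ->
  (forall x, B x -> x 0 i = l 0 i -> f x = 0) ->
  bdP B (predC1 i) r e (dB i f) -> bdP B (predC1 i) r (e * W) f.
Proof.
move=> e0.
have base g : sm B g -> (forall x, B x -> x 0 i = l 0 i -> g x = 0) ->
    (forall x, B x -> nm (dB i g x) <= e) -> forall x, B x -> nm (g x) <= e * W.
  move=> sf f0 hb x Bx.
  pose z := freeze (l 0 i) x.
  have lb : l 0 i <= l 0 i <= u 0 i by rewrite lexx ltW.
  have Bz : B z by exact: freeze_box.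
  have xE : x = stp i z (x 0 i - l 0 i).
    apply/rowP => j; rewrite stpE mxE.
    case: (eqVneq j i) => [->|ji]; first by rewrite mulr1n addrC subrK.
    by rewrite mulr0n addr0.
  have zS s : 0 <= s <= 1 -> B (stp i z (s * (x 0 i - l 0 i))).
    move=> s01 j; rewrite stpE mxE; case: (eqVneq j i) => [->|ji].
      by rewrite mulr1n; apply: conv_itv => //; exact: Bx.
    by rewrite mulr0n addr0; exact: Bx.
  have := @seg_mvt R n E B g i z (x 0 i - l 0 i) 0 e e0 zS.
  rewrite -xE scaler0 subr0 (f0 z)// ?subr0; last by rewrite mxE eqxx.
  have xW : `|x 0 i - l 0 i| <= W.
    by have /andP[? ?] := Bx i; rewrite ger0_norm ?subr_ge0// lerB.
  move=> h; apply: le_trans (h _) _; last by rewrite ler_wpM2l.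
  move=> s s01; exists (dB i g (stp i z (s * (x 0 i - l 0 i)))).
    by apply: sm_part => //; exact: zS.
  by rewrite subr0; apply: hb; exact: zS.
elim: r f => [|r IH] f sf f0 [h1 h2]; (split; first exact: base) => //.
move=> j ji; apply: IH; first exact: sm_d.
  move=> x Bx xl; have := sm_part Bb j sf Bx.
  have : is_part B f j x 0.
    move=> d d0; exists 1 => // h _ Bh; rewrite scaler0 subr0.
    rewrite (f0 x)// (f0 (stp j x h))// ?subrr ?nm0 ?mulr_ge0 ?(ltW d0)//.
    by rewrite stpE (negbTE ji) mulr0n addr0.
  by move=> a b; rewrite (is_part_uniq Bb Bx b a).
have hE x : B x -> dB j (dB i f) x = dB i (dB j f) x by exact: dS_comm.
have hs : sm B (dB j (dB i f)) by apply: (sm_d Bb); exact: (sm_d Bb).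
exact: (bdP_eq Bb hE hs (h2 j ji)).
Qed.

(** The affine coordinate along i that goes from 0 to 1 on the box. *)
Definition oneT : {poly R} := ('X - (l 0 i)%:P) * (W^-1)%:P.

Lemma oneTE t : oneT.[t] = (t - l 0 i) / W.
Proof. by rewrite !hornerE. Qed.

Lemma oneT01 x : B x -> 0 <= oneT.[x 0 i] <= 1.
Proof.
move=> Bx; rewrite oneTE; have /andP[h1 h2] := Bx i.
apply/andP; split; first by apply: divr_ge0; [rewrite subr_ge0|exact: ltW].
by rewrite ler_pdivrMr ?W0// mul1r lerB.
Qed.

(** The points of the side i of the box at which G is sampled. *)
Definition node N (k : nat) : R := l 0 i + W * (k%:R / N%:R).

Lemma node_in N k : (0 < N)%N -> (k <= N)%N -> l 0 i <= node N k <= u 0 i.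
Proof.
move=> N0 kN; have Np : (0 : R) < N%:R by rewrite ltr0n.
have h : 0 <= (k%:R / N%:R : R) <= 1.
  by apply/andP; split; [exact: divr_ge0|rewrite ler_pdivrMr// mul1r ler_nat].
apply/andP; split; rewrite /node.
  by rewrite lerDl mulr_ge0 ?(ltW W0)//; case/andP: h.
rewrite -lerBrDl -[leRHS]mulr1 ler_wpM2l ?(ltW W0)//; case/andP: h => //.
Qed.

(** Bernstein's operator in the variable i, in which the other variables are
    parameters. *)
Definition bernop N G : 'rV[R]_n -> E := fun x =>
  \sum_(k < N.+1) toC (bern oneT N k).[x 0 i] *: G (freeze (node N k) x).

(** Bernstein's argument: the nodes closer than d to x_i contribute at most e
    / 2 by uniform continuity, the other ones at most C / N by Chebyshev's
    inequality with the variance bsum_var. *)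
Lemma bernop_cvg G e : contS B G -> 0 < e -> exists N0, forall N, (N0 < N)%N ->
  forall x, B x -> nm (G x - bernop N G x) <= e.
Proof.
move=> cG e0; have e2 : 0 < e / 2 by rewrite divr_gt0.
have [d d0 hd] := unif_cont cG e2; have [M M0 hM] := box_bdd cG.
pose C := 2 * M * W ^+ 2 / d ^+ 2.
have C0 : 0 <= C by rewrite /C !mulr_ge0// ?invr_ge0 ?exprn_ge0// ltW.
pose N0 := Num.truncn (C / (e / 2)).
exists N0 => N NN x Bx.
have N1 : (0 < N)%N by exact: leq_ltn_trans NN.
have Np : (0 : R) < N%:R by rewrite ltr0n.
have CN : C / N%:R <= e / 2.
  rewrite ler_pdivrMr// mulrC -ler_pdivrMr//.
  apply: le_trans (ltW (truncnS_gt _)) _; rewrite ler_nat; exact: NN.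
pose w k := (bern oneT N k).[x 0 i].
have w0 k : 0 <= w k by apply: bern_ge0; exact: oneT01.
have w1 : \sum_(k < N.+1) w k = 1.
  rewrite -(bsum1 oneT N (x 0 i)); apply: eq_bigr => k _.
  by rewrite mulr1.
have -> : G x - bernop N G x = \sum_(k < N.+1) toC (w k) *: (G x - G (freeze (node N k) x)).
  rewrite /bernop; under [RHS]eq_bigr do rewrite scalerBr.
  rewrite sumrB -scaler_suml; congr (_ - _).
  by rewrite /toC -rmorph_sum w1 rmorph1 scale1r.
apply: le_trans (nm_sum _ _ _) _.
pose t := oneT.[x 0 i].
have bound (k : 'I_N.+1) : nm (toC (w k) *: (G x - G (freeze (node N k) x))) <=
   w k * (e / 2) + C / N%:R ^+ 2 * (w k * (k%:R - N%:R * t) ^+ 2).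
  rewrite nmZr ger0_norm//.
  have -> : w k * (e / 2) + C / N%:R ^+ 2 * (w k * (k%:R - N%:R * t) ^+ 2) =
    w k * (e / 2 + C / N%:R ^+ 2 * (k%:R - N%:R * t) ^+ 2) by ring.
  apply: ler_wpM2l => //.
  have kN : (k <= N)%N by rewrite -ltnS.
  have Bf : B (freeze (node N k) x) by apply: freeze_box => //; exact: node_in.
  have [xd|xd] := ltP `|node N k - x 0 i| d.
    apply: (@le_trans _ _ (e / 2)); last first.
      by rewrite lerDl mulr_ge0 ?sqr_ge0// divr_ge0// exprn_ge0.
    rewrite nmB; apply: hd => // j; rewrite mxE.
    by case: eqP => [->//|_]; rewrite subrr normr0.
  apply: (@le_trans _ _ (2 * M)).
    apply: le_trans (nmD _ _) _; rewrite nmN.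
    by have := hM _ Bx; have := hM _ Bf; lra.
  have -> : C / N%:R ^+ 2 * (k%:R - N%:R * t) ^+ 2 =
      2 * M * (`|node N k - x 0 i| / d) ^+ 2.
    rewrite exprMn -normrX ger0_norm ?sqr_ge0// /node /t oneTE /C.
    by field; rewrite !gt_eqF//=.
  have h1 : 1 <= (`|node N k - x 0 i| / d) ^+ 2.
    by rewrite expr_ge1 ?divr_ge0 ?(ltW d0)// ler_pdivlMr// mul1r.
  apply: (@le_trans _ _ (2 * M * (`|node N k - x 0 i| / d) ^+ 2)).
    by rewrite -[leLHS]mulr1 ler_wpM2l// mulr_ge0.
  by rewrite lerDr ltW.
apply: le_trans (ler_sum _ (fun k _ => bound k)) _.
rewrite big_split /= -mulr_suml w1 mul1r -mulr_sumr.
have -> : \sum_(k < N.+1) w k * (k%:R - N%:R * t) ^+ 2 = N%:R * t * (1 - t).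
  have := bsum_var oneT N (x 0 i) (N%:R * t); rewrite /bsum -/t => ->.
  by rewrite subrr; ring.
have /andP[t0 t1] : 0 <= t <= 1 by exact: oneT01.
rewrite [leRHS]splitr lerD2l; apply: le_trans CN.
have -> : C / N%:R ^+ 2 * (N%:R * t * (1 - t)) = C / N%:R * (t * (1 - t)).
  by field; rewrite gt_eqF.
rewrite -[leRHS]mulr1; apply: ler_wpM2l; first exact: divr_ge0 C0 (ltW Np).
by nra.
Qed.

End OneVar.

(** * Density of the tensors on a box *)
Section OneVarSpan.
Variables (R : realType) (n : nat) (E : normedModType R[i]).
Variables (l u : 'rV[R]_n) (i : 'I_n).
Hypothesis lu : nondeg l u.
Let B := box l u.
Let Bb : locbox B := locbox_box lu.
Implicit Types (f g G A : 'rV[R]_n -> E) (x y : 'rV[R]_n).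
Notation dB j f := (partial B f j).
Variable P : ('rV[R]_n -> E) -> Prop.
Hypothesis Psm : forall G, P G -> sm B G.
Hypothesis Pd : forall G, P G -> P (dB i G).

(** What Bernstein's operators and integration along i produce from a class P
    of functions closed under derivation along i: polynomials in x_i times
    members of P in which x_i is frozen. *)
Inductive span : ('rV[R]_n -> E) -> Prop :=
| span0 : span (fun=> 0)
| spanD p G v A : P G -> l 0 i <= v <= u 0 i -> span A ->
    span (fun x => toC p.[x 0 i] *: G (freeze i v x) + A x).

Lemma span_sm A : span A -> sm B A.
Proof.
elim=> [|p G v A' PG hv _ IH]; first by move=> k; exact: cc_cst.
by apply: smD => //; apply: smZ; [exact: sm_poly|apply: freeze_sm => //; exact: Psm].
Qed.

(** The factors with x_i frozen are constants for the integration along i, so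
    only the polynomials are integrated. *)
Lemma span_anti A : span A -> exists A', [/\ span A',
  forall x, B x -> is_part B A' i x (A x) &
  forall x, x 0 i = l 0 i -> A' x = 0].
Proof.
elim=> [|p G v A1 PG hv _ [A' [sA' dA' A'0]]].
  by exists (fun=> 0); split => //; [exact: span0|move=> x _; exact: is_part_cst].
exists (fun x => toC (antider p (l 0 i)).[x 0 i] *: G (freeze i v x) + A' x); split.
- exact: spanD.
- move=> x Bx; apply: is_partD (dA' x Bx).
  have := is_part_bilin (scale_bilin E) (poly_part B (antider p (l 0 i)) i i x)
    (freeze_parti l u i v G x).
  by rewrite scaler0 addr0 eqxx mul1r antider_deriv.
- by move=> x xl; rewrite A'0// xl antider_root toC0 scale0r addr0.
Qed.

Lemma span_bernop N G : (0 < N)%N -> P G -> span (bernop l u i N G).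
Proof.
move=> N0 PG; rewrite /bernop.
have : forall k : 'I_N.+1, l 0 i <= node l u i N k <= u 0 i.
  by move=> k; apply: node_in => //; rewrite -ltnS.
move=> hk.
suff h (s : seq 'I_N.+1) : span (fun x =>
    \sum_(k <- s) toC (bern (oneT l u i) N k).[x 0 i] *: G (freeze i (node l u i N k) x)).
  exact: h.
elim: s => [|k s IH].
  by under eq_fun do rewrite big_nil; exact: span0.
by under eq_fun do rewrite big_cons; apply: spanD.
Qed.

Lemma bernop_sm N G : (0 < N)%N -> sm B G -> sm B (bernop l u i N G).
Proof.
move=> N0 sG; apply: sm_sum => k; apply: smZ; first exact: sm_poly.
by apply: freeze_sm => //; apply: node_in => //; rewrite -ltnS.
Qed.

(** Hence the derivatives of G in the other directions are approximated by
    those of the approximations of G. *)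
Lemma bernop_d N G j : (0 < N)%N -> j != i -> sm B G ->
  forall x, B x -> dB j (bernop l u i N G) x = bernop l u i N (dB j G) x.
Proof.
move=> N0 ji sG x Bx; have hk (k : 'I_N.+1) : l 0 i <= node l u i N k <= u 0 i.
  by apply: node_in => //; rewrite -ltnS.
rewrite /bernop dS_sum//; last first.
  by move=> k; apply: smZ; [exact: sm_poly|exact: freeze_sm].
apply: eq_bigr => k _; apply: is_part_partial => //.
have h := freeze_part (hk k) ji (sm_part Bb j sG (freeze_box (hk k) Bx)).
have := is_part_bilin (scale_bilin E) (poly_part B (bern (oneT l u i) N k) j i x) h.
by rewrite (negbTE ji) mul0r scale0r add0r.
Qed.

Lemma bernop_bdP r G e : sm B G -> 0 < e -> exists N0, forall N, (N0 < N)%N ->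
  bdP B (predC1 i) r e (fun x => G x - bernop l u i N G x).
Proof.
move=> sG e0; elim: r G sG => [|r IH] G sG.
  have [N0 hN] := bernop_cvg i lu (sm_cont sG) e0.
  by exists N0 => N NN; split => //; exact: hN.
have [N0 hN] := bernop_cvg i lu (sm_cont sG) e0.
have /choice[N1 hN1] : forall j, exists N0, forall N, (N0 < N)%N ->
    bdP B (predC1 i) r e (fun x => dB j G x - bernop l u i N (dB j G) x).
  by move=> j; apply: IH; exact: sm_d.
exists (maxn N0 (\max_j N1 j)) => N; rewrite gtn_max => /andP[NN0 NN1].
have Np : (0 < N)%N by exact: leq_ltn_trans NN0.
split; first exact: hN.
move=> j ji.
have NNj : (N1 j < N)%N by apply: leq_ltn_trans NN1; exact: leq_bigmax.
have sb := bernop_sm Np sG.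
apply: bdP_eq (hN1 j N NNj) => //.
  by move=> x Bx; rewrite dSB// bernop_d.
by apply: smB; [exact: sm_d|apply: bernop_sm => //; exact: sm_d].
Qed.

(** By induction on a, approximate the derivative of G along i, then integrate
    from the face x_i = l_i, on which the values of G are kept; bdP_face
    bounds the error. *)
Lemma span_approx a G r e : P G -> 0 < e -> exists2 A, span A &
  forall m, (m <= a)%N ->
    bdP B (predC1 i) r e (iter m (fun g => dB i g) (fun x => G x - A x)).
Proof.
have sm_iter m g : sm B g -> sm B (iter m (fun g => dB i g) g).
  by move=> sg; elim: m => //= m hm; exact: sm_d.
elim: a G e => [|a IH] G e PG e0.
  have [N0 hN] := bernop_bdP r (Psm PG) e0.
  exists (bernop l u i N0.+1 G); first exact: span_bernop.
  by move=> m; rewrite leqn0 => /eqP ->; exact: hN.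
have W0 : 0 < u 0 i - l 0 i by rewrite subr_gt0.
pose e' := Num.min e (e / (u 0 i - l 0 i)).
have e'0 : 0 < e' by rewrite lt_min e0 divr_gt0.
have [A1 sA1 hA1] := IH _ e' (Pd PG) e'0.
have [A' [sA' dA' A'0]] := span_anti sA1.
pose A x := toC (1 : {poly R}).[x 0 i] *: G (freeze i (l 0 i) x) + A' x.
have lb : l 0 i <= l 0 i <= u 0 i by rewrite lexx ltW.
have sA : span A by apply: spanD.
have AE x : A x = G (freeze i (l 0 i) x) + A' x.
  by rewrite /A hornerC scale1r.
have smGA : sm B (fun x => G x - A x) by apply: smB; [exact: Psm|exact: span_sm].
have dE x : B x -> dB i G x - A1 x = dB i (fun x => G x - A x) x.
  move=> Bx; rewrite dSB//; [|exact: Psm|exact: span_sm].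
  congr (_ - _); apply/esym; apply: is_part_partial => //.
  rewrite -[A1 x]add0r.
  have -> : A = (fun x => G (freeze i (l 0 i) x) + A' x) by apply/funext.
  by apply: is_partD (dA' x Bx); exact: freeze_parti.
have smD1 : sm B (fun x => dB i G x - A1 x).
  by apply: smB; [apply: sm_d => //; exact: Psm|exact: span_sm].
have iterE m x : B x -> iter m (fun g => dB i g) (fun x => dB i G x - A1 x) x =
    iter m.+1 (fun g => dB i g) (fun x => G x - A x) x.
  rewrite iterSr; elim: m x => [|m IHm] x Bx; first exact: dE.
  by rewrite !iterS; apply: dS_eq => //; exact: sm_iter.
exists A => // -[_|m ma]; last first.
  apply: (@bdP_le _ _ _ _ _ _ e'); first by rewrite ge_min lexx.
  by apply: bdP_eq (iterE m) _ (hA1 m ma) => //; exact: sm_iter.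
apply: (@bdP_le _ _ _ _ _ _ (e' * (u 0 i - l 0 i))).
  by rewrite -ler_pdivlMr// ge_min lexx orbT.
apply: bdP_face => //; first exact: ltW.
  move=> x Bx xl; have AxE : A x = G x by rewrite AE A'0// -xl freeze_id addr0.
  by change (G x - A x = 0); rewrite AxE subrr.
by apply: bdP_eq dE _ (hA1 0%N isT).
Qed.

End OneVarSpan.

Section Tensors.
Variables (R : realType) (n : nat) (E : normedModType R[i]).
Implicit Types (G A P : 'rV[R]_n -> E) (x y : 'rV[R]_n).

(** The image of C^oo(R^n) (x) E in C^oo(R^n, E). *)
Inductive tens : ('rV[R]_n -> E) -> Prop :=
| tens0 : tens (fun=> 0)
| tensD (c : 'rV[R]_n -> R[i]^o) q P : (forall S, sm S c) -> tens P ->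
    tens (fun x => c x *: q + P x).

Lemma tens_sm S P : tens P -> sm S P.
Proof.
elim=> [|c q P' sc _ IH]; first by move=> k; exact: cc_cst.
by apply: smD => //; apply: smZ => // k; exact: cc_cst.
Qed.

Lemma tens_add P P' : tens P -> tens P' -> tens (fun x => P x + P' x).
Proof.
move=> tP tP'; elim: tP => [|c q P1 sc _ IH].
  by under eq_fun do rewrite add0r.
by under eq_fun do rewrite -addrA; exact: tensD.
Qed.

Lemma tens_mul (c : 'rV[R]_n -> R[i]^o) P : (forall S, sm S c) -> tens P ->
  tens (fun x => c x *: P x).
Proof.
move=> sc; elim=> [|c' q P1 sc' _ IH].
  by under eq_fun do rewrite scaler0; exact: tens0.
under eq_fun do rewrite scalerDr scalerA; apply: tensD => // S.
by apply: smZ.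
Qed.

Variables (l u : 'rV[R]_n).
Hypothesis lu : nondeg l u.
Let B := box l u.
Let Bb : locbox B := locbox_box lu.
Notation dB j f := (partial B f j).

(** The Leibniz rule; K depends on c and r but not on D, so it is known before
    D is chosen. *)
Lemma bdP_mul r (c : 'rV[R]_n -> R[i]^o) : sm B c -> exists2 K : R, 0 <= K &
  forall (p : pred 'I_n) (D : 'rV[R]_n -> E) (e : R), sm B D -> 0 <= e -> bdP B p r e D ->
    bdP B p r (K * e) (fun x => c x *: D x : E).
Proof.
elim: r c => [|r IH] c sc; have [M M0 hM] := box_bdd (sm_cont sc).
  exists M => // p D e sD e0 [h _]; split => // x Bx.
  by rewrite nmZ; apply: ler_pM; rewrite ?nm_ge0//; [exact: hM|exact: h].
have [K0 K00 hK0] := IH c sc.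
have /choice[K1 hK1] : forall j, exists K : R, 0 <= K /\ forall (p : pred 'I_n) (D : 'rV[R]_n -> E) (e : R), sm B D -> 0 <= e ->
    bdP B p r e D -> bdP B p r (K * e) (fun x => partial B c j x *: D x : E).
  by move=> j; have [K K_0 hK] := IH _ (sm_d Bb j sc); exists K.
have K10 : 0 <= \sum_j K1 j by apply: sumr_ge0 => j _; have [] := hK1 j.
exists (M + (K0 + \sum_j K1 j)); first by rewrite !addr_ge0.
move=> p D e sD e0 hD; have [h1 h2] := hD; split.
  move=> x Bx; rewrite nmZ; apply: (@le_trans _ _ (M * e)).
    by apply: ler_pM; rewrite ?nm_ge0//; [exact: hM|exact: h1].
  by rewrite ler_wpM2r// lerDl addr_ge0.
move=> j pj; have a := (hK1 j).2 p D e sD e0 (bdP_pred hD).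
have b := hK0 p _ e (sm_d Bb j sD) e0 (h2 j pj).
apply: (@bdP_le _ _ _ _ _ _ (K1 j * e + K0 * e)).
  rewrite -mulrDl ler_wpM2r// addrC.
  rewrite (bigD1 j)//=; have : 0 <= \sum_(k | k != j) K1 k.
    by apply: sumr_ge0 => k _; have [] := hK1 k.
  by lra.
have sm1 : sm B (fun x => partial B c j x *: D x) by apply: smZ => //; exact: sm_d.
have sm2 : sm B (fun x => c x *: partial B D j x) by apply: smZ => //; exact: sm_d.
apply: bdP_eq (bdPD Bb sm1 sm2 a b) => //; last exact: smD.
by move=> x Bx; rewrite dSZ.
Qed.

Definition dep (d : nat) G := forall x y, B x -> B y ->
  (forall m : 'I_n, (d <= m)%N -> x 0 m = y 0 m) -> G x = G y.

Lemma dep_d (i : 'I_n) G : sm B G -> dep i G -> dep i (dB i G).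
Proof.
move=> sG dG x y Bx By xy; have hx := sm_part Bb i sG Bx.
suff : is_part B G i y (dB i G x).
  by move=> h; rewrite (is_part_uniq Bb By h (sm_part Bb i sG By)).
move=> e e0; have [r r0 hr] := hx e e0; exists r => // h hh Bh.
have Bxh : B (stp i x h).
  move=> j; rewrite stpE; case: (eqVneq i j) => [<-|ij].
    by have := Bh i; rewrite stpE eqxx xy.
  by rewrite mulr0n addr0; exact: Bx.
rewrite -(dG x y)// -(dG (stp i x h) (stp i y h))//; first exact: hr.
by move=> m im; rewrite !stpE xy.
Qed.

Lemma bdP_zero p r (e : R) : 0 <= e -> bdP B p r e (fun _ : 'rV[R]_n => 0 : E).
Proof.
move=> e0.
have sm0 : sm B (fun _ : 'rV[R]_n => 0 : E) by move=> j; exact: cc_cst.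
have z0 j x : B x -> 0 = dB j (fun _ : 'rV[R]_n => 0 : E) x.
  by move=> Bx; rewrite (is_part_partial Bb Bx (is_part_cst _ _ _ _)).
elim: r => [|r IHr]; (split; first by move=> x _; rewrite nm0) => //.
by move=> j _; exact: (bdP_eq Bb (z0 j) sm0 IHr).
Qed.

(** Induction on the number k of variables that G depends on. Up to a small
    error span_approx writes G with polynomials in x_d and functions of the
    later variables; the induction applies to the latter, with a precision
    that bdP_mul dictates. *)
Lemma tens_dep k d G r e : (d + k)%N = n -> sm B G -> dep d G -> 0 < e ->
  exists2 P, tens P & bdP B xpredT r e (fun x => G x - P x).
Proof.
elim: k d G e => [|k IH] d G e dk sG dG e0.
  rewrite addn0 in dk.
  exists (fun x => (1 : R[i]^o) *: G l + 0).
    apply: tensD tens0 => S j; exact: cc_cst.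
  have Bl : B l by move=> j; rewrite lexx ltW.
  have z x : B x -> 0 = G x - ((1 : R[i]^o) *: G l + 0).
    move=> Bx; rewrite scale1r addr0 (dG x l)// ?subrr// => m.
    by rewrite dk leqNgt ltn_ord.
  have sm0 : sm B (fun _ : 'rV[R]_n => 0 : E) by move=> j; exact: cc_cst.
  apply: (bdP_eq Bb z sm0).
  by apply: bdP_zero; exact: ltW.
have dn : (d < n)%N by rewrite -dk -addSnnS leq_addr.
pose i := Ordinal dn.
pose Q G := sm B G /\ dep d G.
have Qd H : Q H -> Q (dB i H) by case=> ? ?; split; [exact: sm_d|exact: (@dep_d i)].
have e2 : 0 < e / 2 by rewrite divr_gt0.
have [A sA hA] := @span_approx R n E l u i lu Q (fun _ h => h.1) Qd r G r _ (conj sG dG) e2.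
have smA : sm B A by apply: (@span_sm R n E l u i lu Q) => // ? [].
have h1 := bdP_all Bb (smB sG smA) hA.
suff [P tP hP] : exists2 P, tens P & bdP B xpredT r (e / 2) (fun x => A x - P x).
  exists P => //.
  have smP := tens_sm B tP.
  have := bdPD Bb (smB sG smA) (smB smA smP) h1 hP.
  rewrite -splitr; apply: bdP_eq => // [x Bx|]; first by rewrite -sub_tele.
  by apply: smD; exact: smB.
clear h1 hA smA; move: (e / 2) e2 => {e e0} {}e e0.
elim: sA e e0 => [|p H v A1 [sH dH] hv sA1 IHA] e e0.
  exists (fun=> 0); first exact: tens0.
  have sm0 : sm B (fun _ : 'rV[R]_n => 0 : E) by move=> j; exact: cc_cst.
  have zz x : B x -> 0 = 0 - 0 :> E by rewrite subrr.
  apply: (bdP_eq Bb zz sm0).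
  by apply: bdP_zero; exact: ltW.
have e2 : 0 < e / 2 by rewrite divr_gt0.
have [P1 tP1 hP1] := IHA _ e2.
have smA1 : sm B A1 by apply: (@span_sm R n E l u i lu Q) => // ? [].
have sp : sm B (fun x => toC p.[x 0 i]) by exact: sm_poly.
have [K K0 hK] := bdP_mul r sp.
have K1 : 0 < K + 1 by lra.
have sHf : sm B (fun x => H (freeze i v x)) by exact: freeze_sm.
have dHf : dep d.+1 (fun x => H (freeze i v x)).
  move=> x y Bx By xy; apply: dH; [exact: freeze_box|exact: freeze_box|].
  move=> m dm; rewrite !mxE; case: eqVneq => // mi; apply: xy.
  by rewrite ltn_neqAle dm andbT eq_sym.
have [P2 tP2 hP2] := IH d.+1 _ (e / 2 / (K + 1)) (etrans (addSnnS _ _) dk) sHf dHf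
  (divr_gt0 e2 K1).
exists (fun x => toC p.[x 0 i] *: P2 x + P1 x).
  by apply: tens_add => //; apply: tens_mul => // S; exact: sm_poly.
have sm1 : sm B (fun x => H (freeze i v x) - P2 x) by apply: smB => //; exact: tens_sm.
have h2 := hK _ _ _ sm1 (ltW (divr_gt0 e2 K1)) hP2.
have sm2 : sm B (fun x => A1 x - P1 x) by apply: smB => //; exact: tens_sm.
have h3 := bdPD Bb (smZ sp sm1) sm2 h2 hP1.
apply: (@bdP_le _ _ _ _ _ _ (K * (e / 2 / (K + 1)) + e / 2)).
  rewrite [leRHS]splitr lerD2r mulrA ler_pdivrMr// mulrC ler_wpM2l ?(ltW e2)//.
  by lra.
apply: bdP_eq h3 => //; last by apply: smD => //; exact: smZ.
by move=> x Bx; rewrite scalerBr -subD_sub.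
Qed.

Lemma tens_approx G r e : sm B G -> 0 < e ->
  exists2 P, tens P & forall s, (size s <= r)%N -> forall x, B x ->
    nm (partials B (fun x => G x - P x) s x) <= e.
Proof.
move=> sG e0; have [|P tP hP] := @tens_dep n 0 G r e (add0n n) sG _ e0.
  by move=> x y _ _ h; congr G; apply/rowP => j; exact: h.
exists P => // s sr x Bx; apply: (bdP_partials _ _ hP) => //.
by apply: smB => //; exact: tens_sm.
Qed.

End Tensors.

(** * Functions and one-forms on a manifold *)
Section Manifold.
Variables (R : realType) (n : nat) (M : manifold R n).
Implicit Types (a b c : chart M) (p q : M) (x y : 'rV[R]_n).
Implicit Types (E : normedModType R[i]).

(** The box of radius r around x, cut by the half-space. *)
Definition mbox (hf : bool) x (r : R) : 'rV[R]_n * 'rV[R]_n :=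
  (\row_i (if hf && (val i == 0%N) then Num.max 0 (x 0 i - r) else x 0 i - r),
   \row_i (x 0 i + r)).

Lemma mboxP hf x (r : R) y : 0 < r -> box (mbox hf x r).1 (mbox hf x r).2 y <->
  @model R n hf y /\ forall i, `|y 0 i - x 0 i| <= r.
Proof.
move=> r0; split=> [h|[h1 h2] i].
  split=> [hh i i0|i].
    by have := h i; rewrite !mxE hh i0 /= ge_max => /andP[/andP[]].
  have := h i; rewrite !mxE ler_norml; case: ifP => _; rewrite ?ge_max.
    by move=> /andP[/andP[_ ?] ?]; apply/andP; split; lra.
  by move=> /andP[? ?]; apply/andP; split; lra.
have := h2 i; rewrite !mxE ler_norml => /andP[? ?].
case: ifPn => [/andP[hh /eqP i0]|_]; last by apply/andP; split; lra.
by rewrite ge_max (h1 hh i i0)/=; apply/andP; split; lra.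
Qed.

Lemma mbox_nondeg hf x (r : R) : 0 < r -> @model R n hf x ->
  nondeg (mbox hf x r).1 (mbox hf x r).2.
Proof.
move=> r0 hx i; rewrite !mxE; case: ifPn => [/andP[hh /eqP i0]|_]; last by lra.
by have := hx hh i i0; rewrite gt_max => ?; apply/andP; split; lra.
Qed.

Lemma locbox_model hf : locbox (@model R n hf).
Proof.
move=> x hx; exists (mbox hf x 1).1, (mbox hf x 1).2; split.
- exact: mbox_nondeg.
- by apply/mboxP => //; split => // i; rewrite subrr normr0.
- by move=> y /mboxP[].
- exists 1 => // y hy xy; apply/mboxP => //; split => // i; exact: ltW.
Qed.

Lemma open_relopen (S O : set 'rV[R]_n) : open O -> relopen S O.
Proof.
move=> Oo x Sx Ox; have /near_ptP[d d0 hd] : nbhs x O by exact: open_nbhs_nbhs.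
by exists d => // y _; exact: hd.
Qed.

Lemma locbox_cod a : locbox (@cod _ _ M a).
Proof.
have [U Uo ->] := cod_open a; rewrite setIC.
by apply: locbox_open (@locbox_model _) _; exact: open_relopen.
Qed.

Lemma psi_relopen a (U : set M) : open U -> relopen (cod a) (psi a @^-1` U).
Proof.
move=> Uo x Sx Ux; have /subspace_continuousP/(_ x Sx) := @psi_continuous _ _ M a.
move=> /(_ U) /=; rewrite /within /= /nbhs /=.
move=> /(_ (open_nbhs_nbhs (conj Uo Ux))) /near_ptP[d d0 hd].
by exists d => // y Sy xy; exact: hd.
Qed.

Notation tdom a b := (transition_dom (@dom _ _ M) (@cod _ _ M) (@psi _ _ M) a b).
(** The transition map from the chart a to the chart b. *)
Definition tau a b x := phi b (psi a x).

Lemma locbox_tdom a b : locbox (tdom a b).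
Proof. by apply: locbox_open (@locbox_cod a) _; apply: psi_relopen; exact: dom_open. Qed.

Lemma tau_sm a b j : sm (tdom a b) (fun x => toC (tau a b x 0 j)).
Proof. by apply/sm_smooth_on; [exact: locbox_tdom|exact: transition_smooth]. Qed.

Lemma tau_cod a b x : tdom a b x -> cod b (tau a b x).
Proof. by move=> [Sx Dx]; exact: phi_cod. Qed.

Lemma smoothP E (F : M -> E) : smooth F <-> forall a, sm (cod a) (F \o psi a).
Proof. by split=> h a; apply/sm_smooth_on; [exact: locbox_cod|exact: h|exact: locbox_cod|exact: h]. Qed.

Lemma jac_part a b p j i : dom a p -> dom b p ->
  is_part (tdom a b) (fun x => toC (tau a b x 0 j)) i (phi a p) (Defs.jacobian a b p j i).
Proof.
move=> ap bp; apply: sm_part; [exact: locbox_tdom|exact: tau_sm|].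
by split; [exact: phi_cod|rewrite /= phiK].
Qed.

Lemma ext_d_part E (F : M -> E) a p i : smooth F -> dom a p ->
  is_part (cod a) (F \o psi a) i (phi a p) (ext_d F a p i).
Proof.
move=> /smoothP sF ap; rewrite /ext_d asboolT//.
by apply: sm_part; [exact: locbox_cod|exact: sF|exact: phi_cod].
Qed.

Lemma ext_dE E (F : M -> E) a p i d : dom a p ->
  is_part (cod a) (F \o psi a) i (phi a p) d -> ext_d F a p i = d.
Proof.
move=> ap h; rewrite /ext_d asboolT//.
by apply: is_part_partial => //; [exact: locbox_cod|exact: phi_cod].
Qed.

Lemma ext_d_out E (F : M -> E) a p i : ~ dom a p -> ext_d F a p i = 0.
Proof. by move=> ap; rewrite /ext_d asboolF. Qed.

(** The chain rule for the transition map. *)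
Lemma ext_d_change E (F : M -> E) a b p i : smooth F -> dom a p -> dom b p ->
  ext_d F a p i = \sum_j Defs.jacobian a b p j i *: ext_d F b p j.
Proof.
move=> sF ap bp; have Sx : tdom a b (phi a p).
  by split; [exact: phi_cod|rewrite /= phiK].
have h1 : is_part (tdom a b) (F \o psi a) i (phi a p) (ext_d F a p i).
  by apply: is_partS (ext_d_part i sF ap) => x [].
have sFb : sm (cod b) (F \o psi b) by move/smoothP: sF; apply.
have h2 := @is_part_comp R n n E (tdom a b) (cod b) (F \o psi b)
  (fun j => partial (cod b) (F \o psi b) j) (tau a b) i (phi a p)
  (fun j => Defs.jacobian a b p j i) (@locbox_cod b)
  (fun j y h => sm_part (@locbox_cod b) j sFb h)
  (fun j => sm_cont (sm_d (@locbox_cod b) j sFb))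
  (@tau_cod a b) Sx (fun j => jac_part j i ap bp).
have h3 : is_part (tdom a b) (F \o psi a) i (phi a p)
   (\sum_j Defs.jacobian a b p j i *: partial (cod b) (F \o psi b) j (tau a b (phi a p))).
  apply: is_part_eq Sx _ h2 => y [Sy Dy].
  by rewrite /= /tau phiK.
rewrite (is_part_uniq (@locbox_tdom a b) Sx h1 h3); apply: eq_bigr => j _.
by rewrite /ext_d asboolT// /tau phiK.
Qed.

Lemma smooth_formP E (w : one_form M E) : smooth_form w <->
  [/\ forall a i, sm (cod a) (fun x => w a (psi a x) i),
      forall a p i, ~ dom a p -> w a p i = 0 &
      forall a b p i, dom a p -> dom b p ->
        w a p i = \sum_j Defs.jacobian a b p j i *: w b p j].
Proof.
by split=> -[h1 h2 h3]; split => // a i; apply/sm_smooth_on;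
  [exact: locbox_cod|exact: h1|exact: locbox_cod|exact: h1].
Qed.

Lemma ext_d_smooth E (F : M -> E) : smooth F -> smooth_form (ext_d F).
Proof.
move=> sF; apply/smooth_formP; split => [a i|a p i|a b p i].
- apply: (@sm_eq _ _ _ _ (partial (cod a) (F \o psi a) i)).
    by move=> x Sx; rewrite /ext_d asboolT ?psiK//; exact: psi_dom.
  by apply: sm_d; [exact: locbox_cod|move/smoothP: sF; apply].
- exact: ext_d_out.
- exact: ext_d_change.
Qed.

Definition ext0 E a (h : 'rV[R]_n -> E) : M -> E := fun p =>
  if `[< dom a p >] then h (phi a p) else 0.

Lemma ext0_psi E a (h : 'rV[R]_n -> E) x : cod a x -> ext0 a h (psi a x) = h x.
Proof. by move=> Sx; rewrite /ext0 asboolT ?psiK//; exact: psi_dom. Qed.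

Lemma ext0_out E a (h : 'rV[R]_n -> E) p : ~ dom a p -> ext0 a h p = 0.
Proof. by move=> ap; rewrite /ext0 asboolF. Qed.

Section Ext.
Variables (T : Type) (t0 : T) (FT : set_system T).
Context {FF : Filter FT}.

(** In the chart c, near the points of dom a this is a composition with the
    transition map, and near the other ones it is 0, since psi a @` K is
    closed. *)
Lemma cc_ext E a (K : set 'rV[R]_n) k (H : T -> 'rV[R]_n -> E) c :
  compact K -> K `<=` cod a -> (forall t x, cod a x -> ~ K x -> H t x = 0) ->
  ccfam t0 FT k (cod a) H ->
  ccfam t0 FT k (cod c) (fun t => ext0 a (H t) \o psi c).
Proof.
move=> Kc Ka H0 hH; apply: cc_local; first exact: locbox_cod.
move=> x Sx; have [ax|ax] := pselect (dom a (psi c x)).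
  exists (psi c @^-1` dom a); split => //.
    by apply: psi_relopen; exact: dom_open.
  have h : ccfam t0 FT k (tdom c a) (fun t y => H t (tau c a y)).
    apply: (cc_comp (@locbox_cod a) (@tau_cod c a)) hH => j.
    by apply: sm_cc; [exact: locbox_tdom|exact: tau_sm].
  by apply: (cc_eq _ h) => t y [Sy Dy]; rewrite /= /ext0 asboolT.
pose Z := psi a @` K.
have Zc : closed Z.
  apply: compact_closed; first exact: manifold_hausdorff.
  apply: continuous_compact => //.
  exact: continuous_subspaceW Ka (@psi_continuous _ _ M a).
exists (psi c @^-1` (~` Z)); split.
- by move=> [y Ky yx]; apply: ax; rewrite -yx; exact/psi_dom/Ka.
- by apply: psi_relopen; exact: closed_openC.
apply: (cc_eq _ (cc_cst t0 k _ 0)) => t y [Sy Zy] /=.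
rewrite /ext0; case: asboolP => // ay; rewrite H0//; first exact: phi_cod.
by move=> Ky; apply: Zy; exists (phi a (psi c y)) => //; exact: phiK.
Qed.

End Ext.

Lemma ext0_smooth E a (K : set 'rV[R]_n) (h : 'rV[R]_n -> E) :
  compact K -> K `<=` cod a -> (forall x, cod a x -> ~ K x -> h x = 0) ->
  sm (cod a) h -> smooth (ext0 a h).
Proof.
move=> Kc Ka h0 sh; apply/smoothP => c k.
by apply: (cc_ext c Kc Ka) => // t x; exact: h0.
Qed.

End Manifold.

(** * Bump functions on a manifold *)
Section Bumps.
Variables (R : realType) (n : nat) (M : manifold R n).
Implicit Types (a b c : chart M) (p q : M) (x y : 'rV[R]_n).
Implicit Types (E : normedModType R[i]).

(** A bump function in a chart. It vanishes outside of a compact set bK well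
    inside of a box of the chart (bump_nbhd), so that an approximation on the
    box, multiplied by the bump function, is an approximation on the whole
    chart. *)
Record bump_chart := Bump {
  bch : chart M;
  bl : 'rV[R]_n;
  bu : 'rV[R]_n;
  bK : set 'rV[R]_n;
  bfun : 'rV[R]_n -> R;
  bump_nondeg : nondeg bl bu;
  bump_box : box bl bu `<=` cod bch;
  bump_compact : compact bK;
  bump_Kbox : bK `<=` box bl bu;
  bump_nbhd : forall x, bK x -> exists2 d : R, 0 < d &
    forall y, cod bch y -> near_pt x d y -> box bl bu y;
  bump_ge0 : forall x, 0 <= bfun x;
  bump_sm : forall S, sm S (fun x => toC (bfun x));
  bump_out : forall x, cod bch x -> ~ bK x -> bfun x = 0 }.

Lemma bump_Kcod (d : bump_chart) : bK d `<=` cod (bch d).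
Proof. by move=> x /bump_Kbox /bump_box. Qed.

(** A product of flat functions of the coordinates that is positive on a box
    centered at the point. *)
Lemma bump_at p : exists d : bump_chart,
  \forall q \near p, dom (bch d) q /\ 0 < bfun d (phi (bch d) q).
Proof.
pose a := chart_at p; have ap : dom a p := chart_atP p.
pose x0 := phi a p; have cx0 : cod a x0 by exact: phi_cod.
have [U Uo aE] := cod_open a.
have [Ux0 mx0] : (U `&` @model R n (Defs.half a)) x0 by rewrite -aE.
have /near_ptP[r0 r00 hr0] : nbhs x0 U by exact: open_nbhs_nbhs.
(* support of radius r, box of approximation of radius 2 r, inside of the
   neighborhood of radius r0 = 3 r on which the chart is defined *)
pose r := r0 / 3; have r_gt0 : 0 < r by rewrite divr_gt0.
have r2_gt0 : 0 < 2 * r by rewrite mulr_gt0.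
pose B := mbox (Defs.half a) x0 (2 * r); pose K := mbox (Defs.half a) x0 r.
pose br y : R := \prod_j (flat 0 (1 * y 0 j + (r - x0 0 j)) *
                          flat 0 ((-1) * y 0 j + (r + x0 0 j))).
have Bcod : box B.1 B.2 `<=` cod a.
  move=> y /mboxP[//|my yr]; rewrite aE; split => //.
  by apply: hr0 => j; apply: le_lt_trans (yr j) _; rewrite /r; lra.
have KB : box K.1 K.2 `<=` box B.1 B.2.
  move=> y /mboxP[//|my yr]; apply/mboxP => //; split => // j.
  by apply: le_trans (yr j) _; lra.
have Knb x : box K.1 K.2 x -> exists2 d : R, 0 < d &
    forall y, cod a y -> near_pt x d y -> box B.1 B.2 y.
  move=> /mboxP[//|mx xr]; exists r => // y; rewrite aE => -[_ my] xy.
  apply/mboxP => //; split => // j.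
  have := ler_distD (x 0 j) (y 0 j) (x0 0 j).
  by have := ltW (xy j); have := xr j; lra.
have br0 y : 0 <= br y.
  by apply: prodr_ge0 => j _; rewrite mulr_ge0 ?flat_ge0.
have brsm S : sm S (fun x => toC (br x)).
  move=> k; pose H j (_ : unit) y : R[i]^o :=
    (toC (flat 0 (1 * y 0 j + (r - x0 0 j))) : R[i]) *
    (toC (flat 0 ((-1) * y 0 j + (r + x0 0 j))) : R[i]).
  have h : ccfam tt (globally [set: unit]) k S
      (fun t y => \prod_(j <- index_enum 'I_n) (H j t y : R[i]) : R[i]^o).
    by apply: cc_prod => j; apply: ccZ; exact: cc_flat.
  apply: (cc_eq _ h) => t y _.
  by rewrite /br /toC rmorph_prod; apply: eq_bigr => j _; rewrite rmorphM.
have brout x : cod a x -> ~ box K.1 K.2 x -> br x = 0.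
  move=> cx Kx; have [j xj] : exists j, r < `|x 0 j - x0 0 j|.
    apply: contrapT => h; apply: Kx; apply/mboxP => //; split.
      by move: cx; rewrite aE => -[].
    by move=> j; rewrite leNgt; apply/negP => hj; apply: h; exists j.
  have f0 t : t <= 0 -> flat 0 t = 0 :> R by rewrite /flat leNgt; case: ltP.
  rewrite /br (bigD1 j)//=; have [|] := leP (x 0 j - x0 0 j) 0 => s.
    by rewrite f0 ?mul0r//; move: xj; rewrite ler0_norm//; lra.
  by rewrite [X in _ * X * _]f0 ?mulr0 ?mul0r//; move: xj; rewrite gtr0_norm//; lra.
exists (Bump (mbox_nondeg r2_gt0 mx0) Bcod (@box_compact _ _ _ _) KB Knb br0 brsm brout).
rewrite /=; have /subspace_continuousP/(_ p ap) := @phi_continuous _ _ M a.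
have : nbhs x0 [set y | near_pt x0 r y] by apply/near_ptP; exists r.
move=> h /(_ _ h); rewrite /within /= /nbhs /=.
have : nbhs p (dom a) by apply: open_nbhs_nbhs; split => //; exact: dom_open.
apply: filterS2 => q aq /(_ aq) xq; split => //.
rewrite /br prodr_gt0// => j _; have := xq j; rewrite ltr_norml => /andP[h1 h2].
by rewrite mulr_gt0// flat_gt0; move: h1 h2; rewrite -/x0; lra.
Qed.

Hypothesis Mc : compact [set: M].

(** Compactness of M in its near-covering form, for the filter of the finite
    lists that contain a given list. *)
Lemma bump_cover : exists (N : nat) (d : 'I_N -> bump_chart), forall p,
  exists k, dom (bch (d k)) p /\ 0 < bfun (d k) (phi (bch (d k)) p).
Proof.
pose F : set_system (seq bump_chart) := [set A | exists s0, forall s,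
  (forall d, List.In d s0 -> List.In d s) -> A s].
have FF : Filter F.
  split; first by exists [::].
    move=> A A' [s hs] [s' hs']; exists (s ++ s') => s1 h; split.
      by apply: hs => d ds; apply: h; apply: List.in_or_app; left.
    by apply: hs' => d ds; apply: h; apply: List.in_or_app; right.
  by move=> A A' AA [s hs]; exists s => s1 h; apply: AA; exact: hs.
pose pos (d : bump_chart) p := dom (bch d) p /\ 0 < bfun d (phi (bch d) p).
have /compact_near_coveringP Mc' := Mc.
have : \forall s \near F, [set: M] `<=` (fun p => exists2 d, List.In d s & pos d p).
  apply: Mc' => p _; have [d hd] := bump_at p.
  exists ([set q | pos d q], [set s | List.In d s]) => /=.
    by split => //; exists [:: d] => s; apply; left.
  by move=> [q s] [/= hq ds]; exists d.
move=> [s /(_ s (fun _ h => h)) hs].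
exists (size s), (tnth (in_tuple s)) => p.
have [d ds dp] := hs p I.
suff [k kd] : exists k : 'I_(size s), tnth (in_tuple s) k = d by exists k; rewrite kd.
elim: s d ds {hs dp p} => //= d' s IH d [->|/IH[k kd]].
  by exists ord0; rewrite (tnth_nth d).
exists (lift ord0 k); by rewrite -kd !(tnth_nth d') lift0.
Qed.

End Bumps.

(** * Generation of the one-forms by exact forms *)
Section SmoothRules.
Variables (R : realType) (n : nat) (M : manifold R n).
Implicit Types (a b c : chart M) (p q : M) (x y : 'rV[R]_n).
Implicit Types (E : normedModType R[i]).

Lemma smooth_bilin (E1 E2 E3 : normedModType R[i]) (m : E1 -> E2 -> E3)
    (F : M -> E1) (G : M -> E2) : bdd_bilin m -> smooth F -> smooth G ->
  smooth (fun p => m (F p) (G p)).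
Proof.
move=> mP /smoothP sF /smoothP sG; apply/smoothP => a k.
exact: (cc_bilin mP (sF a k) (sG a k)).
Qed.

Lemma smooth_cst E (c : E) : smooth (fun _ : M => c).
Proof. by apply/smoothP => a k; exact: cc_cst. Qed.

Lemma smoothD E (F G : M -> E) : smooth F -> smooth G -> smooth (fun p => F p + G p).
Proof.
move=> /smoothP sF /smoothP sG; apply/smoothP => a k.
exact: (ccD (sF a k) (sG a k)).
Qed.

Lemma smooth_sum E (I : Type) (r : seq I) (F : I -> M -> E) :
  (forall i, smooth (F i)) -> smooth (fun p => \sum_(i <- r) F i p).
Proof.
move=> sF; apply/smoothP => a; apply: sm_sum => i.
by have /smoothP := sF i; apply.
Qed.

Lemma smoothZ E (c : M -> R[i]^o) (F : M -> E) : smooth c -> smooth F ->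
  smooth (fun p => c p *: F p).
Proof. exact: smooth_bilin (scale_bilin E). Qed.

Lemma smooth_lin (E1 E2 : normedModType R[i]) (L : E1 -> E2) (F : M -> E1) :
  bdd_linear L -> smooth F -> smooth (fun p => L (F p)).
Proof.
move=> hL /smoothP sF; apply/smoothP => a k.
exact: (cc_lin hL (sF a k)).
Qed.

Lemma smooth_inv (F : M -> R[i]^o) : (forall p, F p != 0) -> smooth F ->
  smooth (fun p => (F p : R[i])^-1 : R[i]^o).
Proof.
move=> F0 /smoothP sF; apply/smoothP => a k.
by apply: (cc_inv _ (sF a k)) => x _; exact: F0.
Qed.

Lemma ext_d_bilin (E1 E2 E3 : normedModType R[i]) (m : E1 -> E2 -> E3)
    (F : M -> E1) (G : M -> E2) a p i : bdd_bilin m -> smooth F -> smooth G ->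
  ext_d (fun p => m (F p) (G p)) a p i =
  m (ext_d F a p i) (G p) + m (F p) (ext_d G a p i).
Proof.
move=> mP sF sG; have [ap|ap] := pselect (dom a p); last first.
  rewrite !ext_d_out// -(subrr (0 : E1)) -(subrr (0 : E2)).
  by rewrite (bilBl mP) (bilBr mP) !subrr addr0.
apply: ext_dE => //.
have := is_part_bilin mP (ext_d_part i sF ap) (ext_d_part i sG ap).
by rewrite /= phiK.
Qed.

Lemma ext_dD E (F G : M -> E) a p i : smooth F -> smooth G ->
  ext_d (fun p => F p + G p) a p i = ext_d F a p i + ext_d G a p i.
Proof.
move=> sF sG; have [ap|ap] := pselect (dom a p); last by rewrite !ext_d_out// addr0.
by apply: ext_dE => //; exact: is_partD (ext_d_part i sF ap) (ext_d_part i sG ap).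
Qed.

Lemma ext_d_lin (E1 E2 : normedModType R[i]) (L : E1 -> E2) (F : M -> E1) a p i :
  bdd_linear L -> smooth F ->
  ext_d (fun p => L (F p)) a p i = L (ext_d F a p i).
Proof.
move=> hL sF; have [ap|ap] := pselect (dom a p); last first.
  rewrite !ext_d_out//; have := blinZ hL 0 0.
  by rewrite toC0 !scale0r.
by apply: ext_dE => //; exact: (is_part_lin hL (ext_d_part i sF ap)).
Qed.

Lemma ext_d_sum E (I : Type) (r : seq I) (F : I -> M -> E) a p i :
  (forall k, smooth (F k)) ->
  ext_d (fun p => \sum_(k <- r) F k p) a p i = \sum_(k <- r) ext_d (F k) a p i.
Proof.
move=> sF; have [ap|ap] := pselect (dom a p); last first.
  by rewrite ext_d_out// big1// => k _; rewrite ext_d_out.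
apply: ext_dE => //; elim: r => [|k r IH].
  rewrite big_nil; have := is_part_cst (cod a) (0 : E) i (phi a p).
  by apply: is_part_eq; [exact: phi_cod|move=> y _; rewrite /= big_nil].
rewrite big_cons; have := is_partD (ext_d_part i (sF k) ap) IH.
by apply: is_part_eq; [exact: phi_cod|move=> y _; rewrite /= big_cons].
Qed.

Lemma ext_d_ext0 E (h : 'rV[R]_n -> E) a p i d : dom a p ->
  is_part (cod a) h i (phi a p) d -> ext_d (ext0 a h) a p i = d.
Proof.
move=> ap hd; apply: ext_dE => //; apply: is_part_eq hd; first exact: phi_cod.
by move=> y cy; rewrite /= ext0_psi.
Qed.

End SmoothRules.

Section Decomposition.
Variables (R : realType) (n : nat) (M : manifold R n).
Implicit Types (a b c : chart M) (p q : M) (x y : 'rV[R]_n).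
Implicit Types (E : normedModType R[i]).

(** The smooth one-forms are generated by finitely many exact forms, with
    explicit coefficients: a scalar function times a component in a chart. The
    supports dK make these coefficients smooth on M. The formula is required
    for values in all spaces because it is used for scalar forms and for forms
    with values in Q. *)
Record decomp := Decomp {
  dI : finType;
  dg : dI -> M -> R[i]^o;
  dc : dI -> M -> R[i]^o;
  da : dI -> chart M;
  dj : dI -> 'I_n;
  dK : dI -> set 'rV[R]_n;
  dg_smooth : forall i, smooth (dg i);
  dc_smooth : forall i, smooth (dc i);
  dK_compact : forall i, compact (dK i);
  dK_cod : forall i, dK i `<=` cod (da i);
  dc_out : forall i x, cod (da i) x -> ~ dK i x -> dc i (psi (da i) x) = 0;
  dc_dom : forall i p, ~ dom (da i) p -> dc i p = 0;
  decompE : forall E (w : one_form M E), smooth_form w ->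
    forall a p m, w a p m =
      \sum_i (ext_d (dg i) a p m : R[i]) *: ((dc i p : R[i]) *: w (da i) p (dj i)) }.

Lemma scale00 E (x : R[i]) (v : E) : x *: ((0 : R[i]) *: v) = 0.
Proof. by rewrite scale0r scaler0. Qed.

Definition bumpM (d : bump_chart M) : M -> R[i]^o :=
  ext0 (bch d) (fun x => toC (bfun d x)).

Lemma bump_ext_smooth E (d : bump_chart M) (h : 'rV[R]_n -> E) :
  sm (cod (bch d)) h ->
  smooth (ext0 (bch d) (fun x => (toC (bfun d x) : R[i]^o) *: h x)).
Proof.
move=> sh; apply: ext0_smooth (@bump_compact _ _ _ d) (@bump_Kcod _ _ _ d) _ _.
  by move=> x cx Kx; rewrite (bump_out cx Kx) toC0 scale0r.
by apply: smZ; [exact: bump_sm|exact: sh].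
Qed.

Lemma bumpM_smooth d : smooth (bumpM d).
Proof.
have -> : bumpM d = ext0 (bch d) (fun x => (toC (bfun d x) : R[i]^o) *: (1 : R[i]^o)).
  by congr ext0; apply/funext => x; rewrite [RHS]mulr1.
by apply: bump_ext_smooth => k; exact: cc_cst.
Qed.

Hypothesis Mc : compact [set: M].

(** A partition of unity made of squares: in each term one factor b is
    absorbed in a function that d is applied to, the other one in a
    coefficient. *)
Lemma bump_partition : exists (N : nat) (d : 'I_N -> bump_chart M) (si : M -> R[i]^o),
  smooth si /\ forall p, \sum_k (si p : R[i]) * (bumpM (d k) p * bumpM (d k) p) = 1.
Proof.
have [N [d hd]] := bump_cover Mc.
pose s p : R[i]^o := \sum_k bumpM (d k) p *: bumpM (d k) p.
have s_sm : smooth s.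
  by apply: smooth_sum => k; apply: smoothZ; exact: bumpM_smooth.
pose t k p : R :=
  if `[< dom (bch (d k)) p >] then bfun (d k) (phi (bch (d k)) p) else 0.
have beE k p : bumpM (d k) p = toC (t k p).
  by rewrite /bumpM /ext0 /t; case: ifP => // _; rewrite toC0.
have s0 p : s p != 0.
  have -> : s p = toC (\sum_k t k p * t k p).
    by rewrite /s /toC rmorph_sum; apply: eq_bigr => k _; rewrite beE /toC rmorphM.
  have [k [kp k0]] := hd p.
  suff h : 0 < \sum_k t k p * t k p.
    by apply/eqP => /(congr1 (@complex.Re R))/= h0; rewrite h0 ltxx in h.
  have tk : 0 < t k p * t k p by rewrite /t asboolT// mulr_gt0.
  rewrite (bigD1 k)//=; apply: ltr_pwDl => //.
  by apply: sumr_ge0 => j _; rewrite -expr2 sqr_ge0.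
exists N, d, (fun p => (s p : R[i])^-1 : R[i]^o); split; first exact: smooth_inv.
move=> p; rewrite -mulr_sumr.
have -> : \sum_k (bumpM (d k) p : R[i]) * bumpM (d k) p = s p by [].
by rewrite mulVf ?s0.
Qed.

(** If b is a bump function and x_j a coordinate of its chart, b^2 dx_j = b
    d(b x_j) - (b x_j) db, in which b and b x_j extend to smooth functions on
    M. The boolean index selects the term. *)
Lemma decomp_ex : exists D : decomp, True.
Proof.
have [N [d [si [si_sm si1]]]] := bump_partition.
pose ch k := bch (d k).
pose br k x : R[i]^o := toC (bfun (d k) x).
pose be k : M -> R[i]^o := bumpM (d k).
pose bx k j : M -> R[i]^o := ext0 (ch k) (fun x => br k x *: (toC (x 0 j) : R[i]^o)).
have br_sm k S : sm S (br k) by exact: bump_sm.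
have be_sm k : smooth (be k) by exact: bumpM_smooth.
have bx_sm k j : smooth (bx k j) by apply: bump_ext_smooth => m; exact: cc_coord.
pose I := ('I_N * 'I_n * bool)%type.
pose g (i : I) : M -> R[i]^o := if i.2 then be i.1.1 else bx i.1.1 i.1.2.
pose c0 (i : I) : M -> R[i]^o := if i.2 then (fun p => - bx i.1.1 i.1.2 p) else be i.1.1.
pose c (i : I) p : R[i]^o := si p *: c0 i p.
have g_sm i : smooth (g i).
  by rewrite /g; case: (i.2); [exact: be_sm|exact: bx_sm].
have c_sm i : smooth (c i).
  apply: smoothZ; first exact: si_sm.
  rewrite /c0; case: (i.2); last exact: be_sm.
  have -> : (fun p => - bx i.1.1 i.1.2 p) = (fun p => (-1 : R[i]^o) *: bx i.1.1 i.1.2 p).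
    by apply/funext => p; rewrite scaleN1r.
  by apply: smoothZ; [exact: smooth_cst|exact: bx_sm].
have c_dom (i : I) p : ~ dom (ch i.1.1) p -> c i p = 0.
  move=> ip; rewrite /c /c0 /be /bumpM /bx; case: ifP => _; rewrite ext0_out// ?oppr0 scaler0//.
have c_out (i : I) x : cod (ch i.1.1) x -> ~ bK (d i.1.1) x -> c i (psi (ch i.1.1) x) = 0.
  move=> cx Kx; rewrite /c /c0 /be /bumpM /bx /br; case: ifP => _; rewrite ext0_psi// (bump_out cx Kx) toC0.
    by rewrite scale0r oppr0 scaler0.
  by rewrite scaler0.
suff dE E (w : one_form M E) : smooth_form w -> forall a p m, w a p m =
    \sum_(i : I) (ext_d (g i) a p m : R[i]) *: ((c i p : R[i]) *: w (ch i.1.1) p i.1.2).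
  by exists (@Decomp I g c (fun i => ch i.1.1) (fun i => i.1.2)
    (fun i => bK (d i.1.1)) g_sm c_sm (fun i => @bump_compact _ _ _ (d i.1.1))
    (fun i => @bump_Kcod _ _ _ (d i.1.1)) c_out c_dom dE).
move=> /smooth_formP[w1 w2 w3] a p m.
have [ap|ap] := pselect (dom a p); last first.
  by rewrite w2// big1// => i _; rewrite ext_d_out// scale0r.
have -> : w a p m = \sum_k ((si p : R[i]) * (be k p * be k p)) *: w a p m.
  by rewrite -scaler_suml si1 scale1r.
rewrite -(pair_bigA _ (fun (kj : 'I_N * 'I_n) (b : bool) => (ext_d (g (kj, b)) a p m : R[i]) *:
    ((c (kj, b) p : R[i]) *: w (ch kj.1) p kj.2))) /=.
rewrite -(pair_bigA _ (fun (k : 'I_N) (j : 'I_n) => \sum_(b : bool) (ext_d (g (k, j, b)) a p m : R[i]) *: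
    ((c (k, j, b) p : R[i]) *: w (ch k) p j))) /=.
apply: eq_bigr => k _.
have [kp|kp] := pselect (dom (ch k) p); last first.
  have -> : be k p = 0 by exact: ext0_out.
  rewrite mul0r mulr0 scale0r big1// => j _; apply: big1 => b _.
  rewrite (_ : c (k, j, b) p = 0); first exact: scale00.
  exact: c_dom.
rewrite (w3 a (ch k) p m ap kp) scaler_sumr; apply: eq_bigr => j _.
rewrite big_bool /=.
rewrite /g /= (ext_d_change m (be_sm k) ap kp) (ext_d_change m (bx_sm k j) ap kp).
pose db l : R[i]^o := ext_d (be k) (ch k) p l.
have dbx l : ext_d (bx k j) (ch k) p l =
    (db l : R[i]) * toC (phi (ch k) p 0 j) + be k p * (l == j)%:R.
  apply: ext_d_ext0 => //.
  have := is_part_bilin (scale_bilin R[i]^o) (sm_part (@locbox_cod _ _ M (ch k)) l (br_sm k _)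
    (phi_cod kp)) (coord_part (cod (ch k)) l j (phi (ch k) p)).
  congr is_part; congr (_ + _); last by rewrite /be /bumpM /ext0 asboolT.
  congr (_ * _); rewrite /db (ext_d_ext0 kp (d := partial (cod (ch k)) (br k) l (phi (ch k) p)))//.
  by apply: sm_part; [exact: locbox_cod|exact: br_sm|exact: phi_cod].
under [X in _ + X *: _]eq_bigr do rewrite dbx.
rewrite !scalerA -scalerDl; congr (_ *: _).
have -> : c (k, j, true) p = - (si p : R[i]) * be k p * toC (phi (ch k) p 0 j).
  rewrite /c /c0 /= /bx /be /bumpM /ext0 asboolT// -[_ *: _]/((_ : R[i]) * _ : R[i]) mulrN mulNr mulNr.
  by rewrite -mulrA.
have -> : c (k, j, false) p = (si p : R[i]) * be k p by [].
pose J l : R[i]^o := Defs.jacobian a (ch k) p l m.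
rewrite -/(J j).
have -> : \sum_l (J l : R[i]) *: (ext_d (be k) (ch k) p l) =
          \sum_l (J l : R[i]) * db l by [].
have -> : \sum_l (J l : R[i]) *: ((db l : R[i]) * toC (phi (ch k) p 0 j) + be k p * (l == j)%:R : R[i]^o) =
   (\sum_l (J l : R[i]) * db l) * toC (phi (ch k) p 0 j) + be k p * J j :> R[i].
  have -> : (be k p : R[i]) * J j = \sum_(l | l == j) (be k p : R[i]) * J l.
    by rewrite big_pred1_eq.
  rewrite mulr_suml.
  under eq_bigr => l _ do rewrite -[_ *: _]/((_ : R[i]) * _ : R[i]) mulrDr mulrA.
  rewrite big_split /=; congr (_ + _).
  rewrite [RHS]big_mkcond /=; apply: eq_bigr => l _.
  by case: eqP => _; rewrite ?mulr1 ?mulr0// mulrC.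
by ring.
Qed.

End Decomposition.

(** * Convergence in the Frechet topologies *)
Section Partials.
Variables (R : realType) (n : nat) (E : normedModType R[i]) (S : set 'rV[R]_n).
Hypothesis Sb : locbox S.

Lemma sm_partials (f : 'rV[R]_n -> E) s : sm S f -> sm S (partials S f s).
Proof. by move=> sf; elim: s => //= i s IH; exact: sm_d. Qed.

Lemma partialsB (f g : 'rV[R]_n -> E) s : sm S f -> sm S g -> forall x, S x ->
  partials S (fun x => f x - g x) s x = partials S f s x - partials S g s x.
Proof.
move=> sf sg; elim: s => //= i s IH x Sx.
have h1 := sm_partials s sf; have h2 := sm_partials s sg.
rewrite -(dSB Sb i h1 h2 Sx).
have sD : sm S (partials S (fun x => f x - g x) s).
  by apply: sm_partials; exact: smB.
exact: (dS_eq Sb i IH sD Sx).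
Qed.

Variables (T : Type) (t0 : T) (FT : set_system T).
Context {FF : Filter FT}.

Lemma partials_cc (H : T -> 'rV[R]_n -> E) r : (forall t, sm S (H t)) ->
  (forall s, (size s <= r)%N -> loc_unif t0 FT S (fun t => partials S (H t) s)) ->
  ccfam t0 FT r S H.
Proof.
move=> sH hl; suff h k s : (size s + k <= r)%N ->
    ccfam t0 FT k S (fun t => partials S (H t) s) by exact: (h r [::]).
elim: k s => [|k IH] s sk.
  split => //; last by apply: hl; rewrite addn0 in sk.
  by move=> t; apply: sm_cont; exact: sm_partials.
split => [t||i].
- by apply: sm_cont; exact: sm_partials.
- by apply: hl; apply: leq_trans sk; exact: leq_addr.
exists (fun t => partials S (H t) (i :: s)); last by apply: IH; rewrite addSnnS.
by move=> t x Sx; apply: (sm_part Sb i _ Sx); exact: sm_partials.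
Qed.

End Partials.

Section Frechet.
Variables (R : realType) (n : nat) (M : manifold R n) (E : normedModType R[i]).
Variables (X J : Type) (smX : X -> Prop).
Variable loc : X -> chart M -> J -> 'rV[R]_n -> E.
Hypothesis loc_sm : forall G, smX G -> forall a j, sm (cod a) (loc G a j).
Let nX := frechet_nbhs smX loc.

Lemma frechet_filter F : Filter (nX F).
Proof.
split.
- pose absurd Z (k : 'I_0) : Z :=
    False_rect Z (notF (etrans (esym (ltn0 k)) (ltn_ord k))).
  exists 0%N, (absurd _), (absurd _), (absurd _), (absurd _), 1.
  by split => // -[].
- move=> A B [m [a [j [K [s [e [hK e0 h]]]]]]] [m' [a' [j' [K' [s' [e' [hK' e'0 h']]]]]]].
  pose sel Z (u : 'I_m -> Z) (v : 'I_m' -> Z) (k : 'I_(m + m')) : Z :=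
    match fintype.split k with inl i => u i | inr i => v i end.
  exists (m + m')%N, (sel _ a a'), (sel _ j j'), (sel _ K K'), (sel _ s s'), (Num.min e e').
  have le1 : (toC (Num.min e e') : R[i]) <= toC e by rewrite /toC lecR ge_min lexx.
  have le2 : (toC (Num.min e e') : R[i]) <= toC e' by rewrite /toC lecR ge_min lexx orbT.
  split; first by move=> k; rewrite /sel; case: (fintype.split k) => i.
    by rewrite lt_min e0.
  move=> G sG hG; split.
    apply: h => // k x Kx; apply: lt_le_trans le1.
    have := hG (lshift m' k) x; rewrite /sel.
    by rewrite -[lshift m' k]/(unsplit (inl k)) unsplitK; apply.
  apply: h' => // k x Kx; apply: lt_le_trans le2.
  have := hG (rshift m k) x; rewrite /sel.
  by rewrite -[rshift m k]/(unsplit (inr k)) unsplitK; apply.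
- move=> A B AB [m [a [j [K [s [e [hK e0 h]]]]]]].
  exists m, a, j, K, s, e; split => // G sG hG; apply: AB; exact: h.
Qed.

Section Family.
Variables (T : Type) (t0 : T) (FT : set_system T).
Context {FF : Filter FT}.

Definition tends (L : T -> X) := forall B, nX (L t0) B -> FT [set t | B (L t)].

Lemma tends_cc (L : T -> X) : (forall t, smX (L t)) -> tends L ->
  forall k a j, ccfam t0 FT k (cod a) (fun t => loc (L t) a j).
Proof.
move=> sL hL k a j; apply: (partials_cc (@locbox_cod _ _ M a)).
  by move=> t; exact: loc_sm.
move=> s _ x Sx e e0; have [l [u [lu xlu luS [d d0 hd]]]] := @locbox_cod _ _ M a x Sx.
exists d => //.
pose B : set X := [set G | forall y, box l u y ->
  nm (partials (cod a) (loc G a j) s y - partials (cod a) (loc (L t0) a j) s y) <= e].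
have : nX (L t0) B.
  exists 1%N, (fun _ => a), (fun _ => j), (fun _ => box l u), (fun _ => s), e; split => //.
    by move=> _; split => //; exact: box_compact.
  move=> G sG hG y By; rewrite nmB; apply/ltW; rewrite -nm_lt.
  exact: (hG ord0).
move=> /hL; apply: filterS => t Bt y Sy xy; apply: Bt; exact: hd.
Qed.

End Family.

(** B only constrains derivatives of bounded order on compact sets, on which
    local uniform convergence is uniform. *)
Lemma cc_tends_order F B : nX F B -> exists r : nat,
  forall (T : Type) (t0 : T) (FT : set_system T) (FF : Filter FT) (L : T -> X),
  L t0 = F -> (forall t, smX (L t)) ->
  (forall a j, ccfam t0 FT r (cod a) (fun t => loc (L t) a j)) ->
  FT [set t | B (L t)].
Proof.
move=> [m [a [j [K [s [e [hK e0 h]]]]]]].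
exists (\max_k size (s k)) => T t0 FT FF L LF sL hL.
have e2 : 0 < e / 2 by rewrite divr_gt0.
have hk k : \forall t \near FT, forall x, K k x ->
    `|partials (cod (a k)) (loc F (a k) (j k)) (s k) x -
      partials (cod (a k)) (loc (L t) (a k) (j k)) (s k) x| < (toC e : R[i]).
  have [Kc Ka] := hK k.
  have h1 : ccfam t0 FT 0 (cod (a k)) (fun t => partials (cod (a k)) (loc (L t) (a k) (j k)) (s k)).
    have hH : ccfam t0 FT (size (s k) + 0) (cod (a k)) (fun t => loc (L t) (a k) (j k)).
      by rewrite addn0; apply: cc_le (hL _ _); exact: leq_bigmax.
    exact: (cc_partials (@locbox_cod _ _ M (a k)) hH).
  apply: filterS (compact_loc_unif Kc Ka (cc_loc_unif h1) e2) => t ht x Kx; rewrite nm_lt nmB -LF.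
  by apply: le_lt_trans (ht x Kx) _; lra.
by apply: filterS (filter_forall _ hk) => t ht; apply: h => // k x; exact: ht.
Qed.

Lemma cc_tends (T : Type) (t0 : T) (FT : set_system T) (FF : Filter FT) (L : T -> X) :
  (forall t, smX (L t)) ->
  (forall k a j, ccfam t0 FT k (cod a) (fun t => loc (L t) a j)) ->
  tends t0 FT L.
Proof.
move=> sL hL B hB; have [r hr] := cc_tends_order hB.
exact: (hr T t0 FT FF L).
Qed.

(** The parameter filter of the universal family that converges to F: the
    inclusion of the smooth elements. *)
Definition sub_nbhs F : set_system {G | smX G} :=
  [set A | nX F [set G | forall h : smX G, A (exist _ G h)]].

Lemma sub_filter F : Filter (sub_nbhs F).
Proof.
have FF := frechet_filter F; split.
- by apply: (@filterE _ (nX F) FF) => G h.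
- move=> A B hA hB; apply: (@filterS2 _ (nX F) FF _ _ _ _ hA hB) => G h1 h2 h.
  by split; [exact: h1|exact: h2].
- by move=> A B AB; apply: (@filterS _ (nX F) FF) => G h1 h; exact: AB.
Qed.

Lemma sub_tends F (sF : smX F) :
  tends (exist _ F sF) (sub_nbhs F) (fun t => sval t).
Proof.
have FF := frechet_filter F.
by move=> B /= hB; apply: filterS hB => G BG h.
Qed.

Lemma sub_near F (A : set X) :
  sub_nbhs F [set t | A (sval t)] -> nX F A.
Proof.
move=> [m [a [j [K [s [e [hK e0 h]]]]]]].
by exists m, a, j, K, s, e; split => // G sG hG; apply: (h G sG hG sG).
Qed.

End Frechet.

(** * Density of the algebraic tensor product *)
Lemma near_pt_relopen (R : realType) n (S : set 'rV[R]_n) x e :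
  relopen S [set y | near_pt x e y].
Proof.
move=> y _ /= xy.
have [d d0 hd] : exists2 d : R, 0 < d & forall j, forall z : 'rV[R]_n,
    `|z 0 j - y 0 j| < d -> `|z 0 j - x 0 j| < e.
  apply: (@fin_delta R n (fun j d => forall z : 'rV[R]_n,
    `|z 0 j - y 0 j| < d -> `|z 0 j - x 0 j| < e)) => [j u v vu h z zy|j].
    by apply: h; exact: lt_le_trans vu.
  exists (e - `|y 0 j - x 0 j|); first by rewrite subr_gt0; exact: xy.
  by move=> z zy; have := ler_distD (y 0 j) (z 0 j) (x 0 j); lra.
by exists d => // z _ yz j; exact: hd.
Qed.

Section Density.
Variables (R : realType) (n : nat) (M : manifold R n) (E : normedModType R[i]).
Implicit Types (F G : M -> E) (p : M).

(** The image of C^oo(M) (x) E in C^oo(M, E). *)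
Inductive alg : (M -> E) -> Prop :=
| alg0 : alg (fun=> 0)
| algD (f : M -> R[i]^o) q G : smooth f -> alg G -> alg (fun p => f p *: q + G p).

Lemma alg_smooth G : alg G -> smooth G.
Proof.
elim=> [|f q G' sf _ IH]; first exact: smooth_cst.
by apply: smoothD; [apply: smoothZ; [exact: sf|exact: smooth_cst]|exact: IH].
Qed.

Lemma alg_add G G' : alg G -> alg G' -> alg (fun p => G p + G' p).
Proof.
move=> aG aG'; elim: aG => [|f q G1 sf _ IH].
  by under eq_fun do rewrite add0r.
by under eq_fun do rewrite -addrA; exact: algD.
Qed.

Lemma alg_mul (c : M -> R[i]^o) G : smooth c -> alg G -> alg (fun p => c p *: G p).
Proof.
move=> sc; elim=> [|f q G' sf _ IH].
  by under eq_fun do rewrite scaler0; exact: alg0.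
under eq_fun do rewrite scalerDr scalerA; apply: algD; last exact: IH.
exact: (smoothZ sc sf).
Qed.

Lemma alg_sum (I : Type) (r : seq I) (G : I -> M -> E) :
  (forall i, alg (G i)) -> alg (fun p => \sum_(i <- r) G i p).
Proof.
move=> aG; elim: r => [|i r IH].
  by under eq_fun do rewrite big_nil; exact: alg0.
by under eq_fun do rewrite big_cons; exact: alg_add.
Qed.

Lemma alg_ext0 (d : bump_chart M) P : tens P ->
  alg (ext0 (bch d) (fun x => (toC (bfun d x) : R[i]^o) *: P x)).
Proof.
elim=> [|c q P' sc _ IH].
  have -> : ext0 (bch d) (fun x => (toC (bfun d x) : R[i]^o) *: (0 : E)) = (fun=> 0).
    by apply/funext => p; rewrite /ext0; case: ifP => // _; rewrite scaler0.
  exact: alg0.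
set h := ext0 _ _ in IH.
pose f := ext0 (bch d) (fun x => (toC (bfun d x) : R[i]^o) *: c x).
have -> : ext0 (bch d) (fun x => (toC (bfun d x) : R[i]^o) *: (c x *: q + P' x)) =
    (fun p => f p *: q + h p).
  apply/funext => p; rewrite /f /h /ext0; case: ifP => _; last by rewrite scale0r addr0.
  by rewrite scalerDr scalerA.
by apply: algD; [apply: bump_ext_smooth; exact: sc|exact: IH].
Qed.

Lemma fun_loc_sm G : smooth G -> forall a (_ : unit), sm (cod a) (G \o psi a).
Proof. by move=> /smoothP sG a _; exact: sG. Qed.

Hypothesis Mc : compact [set: M].

(** Approximate F by a tensor in the box of each bump function, multiply by
    the bump function, extend by zero and glue with the partition of unity.
    Together with F, the limit, the approximations form a family indexed by
    option nat, whose convergence follows from the rules for families. *)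
Lemma alg_dense F B : smooth F -> fun_nbhs F B -> exists G, alg G /\ B G.
Proof.
move=> sF hB.
have [r hr] := cc_tends_order hB.
have [N [d [si [si_sm si1]]]] := bump_partition Mc.
pose ch k := bch (d k); pose bx k := box (bl (d k)) (bu (d k)).
have bxb k : locbox (bx k) by apply: locbox_box; exact: bump_nondeg.
pose G k x := F (psi (ch k) x).
have sGc k : sm (cod (ch k)) (G k) by exact: (fun_loc_sm sF (ch k) tt).
have sG k : sm (bx k) (G k).
  by move=> m; apply: ccS (sGc k m); exact: bump_box.
have /choice[P hP] : forall kN : 'I_N * nat, exists P : 'rV[R]_n -> E, tens P /\
    forall s, (size s <= r)%N -> forall x, bx kN.1 x ->
      nm (partials (bx kN.1) (fun x => G kN.1 x - P x) s x) <= kN.2.+1%:R^-1.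
  move=> [k m] /=; have m0 : (0 : R) < m.+1%:R^-1 by rewrite invr_gt0 ltr0n.
  by have [P tP hP] := tens_approx (bump_nondeg (d k)) r (sG k) m0; exists P.
pose FT : set_system (option nat) := Some @ \oo.
have FF : Filter FT by exact: fmap_filter.
(* the parameter None stands for the limit *)
pose H k t x := if t is Some m then P (k, m) x else G k x.
have sHc k t : sm (cod (ch k)) (H k t).
  by case: t => [m|]; [apply: tens_sm; exact: (hP (k, m)).1|exact: sGc].
have sH k t : sm (bx k) (H k t).
  by move=> m; apply: ccS (sHc k t m); exact: bump_box.
have ccH k : ccfam None FT r (bx k) (H k).
  apply: (partials_cc (bxb k)) => [t|s sr x bxx e e0]; first exact: sH.
  exists 1 => //.
  have : \forall m \near \oo, m.+1%:R^-1 < e.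
    by have := near_infty_natSinv_lt (PosNum e0).
  rewrite /FT /=; apply: filterS => m me y By _.
  rewrite nmB -(partialsB (bxb k) s (sH k None) (sH k (Some m)) By).
  by apply: le_trans (ltW me); exact: (hP (k, m)).2.
have ccC k : ccfam None FT r (cod (ch k))
    (fun t x => (toC (bfun (d k) x) : R[i]^o) *: H k t x).
  apply: (cc_local (@locbox_cod _ _ M (ch k))) => x cx.
  have [Kx|Kx] := pselect (bK (d k) x).
    have [e e0 he] := bump_nbhd Kx.
    exists [set y | near_pt x e y]; split; first exact: near_ptxx.
      exact: near_pt_relopen.
    apply: ccZ.
      by apply: sm_cc; [|exact: bump_sm]; apply: locbox_open;
        [exact: locbox_cod|exact: near_pt_relopen].
    by apply: ccS (ccH k) => y [cy xy]; exact: he.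
  exists (~` bK (d k)); split => //.
    apply: open_relopen; apply: closed_openC; apply: compact_closed.
      exact: norm_hausdorff.
    exact: bump_compact.
  apply: (cc_eq _ (cc_cst None r _ 0)) => t y [cy Ky].
  by rewrite (bump_out cy Ky) toC0 scale0r.
pose Psi k t : M -> E := ext0 (ch k) (fun x => (toC (bfun (d k) x) : R[i]^o) *: H k t x).
pose Phi t p := si p *: \sum_k bumpM (d k) p *: Psi k t p.
have Psi_sm k t : smooth (Psi k t) by apply: bump_ext_smooth; exact: sHc.
have Phi_sm t : smooth (Phi t).
  apply: smoothZ; [exact: si_sm|]; apply: smooth_sum => k; apply: smoothZ; last exact: Psi_sm.
  exact: bumpM_smooth.
have PhiF : Phi None = F.
  apply/funext => p; rewrite /Phi scaler_sumr.
  transitivity (\sum_k ((si p : R[i]) * (bumpM (d k) p * bumpM (d k) p)) *: F p).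
    apply: eq_bigr => k _; rewrite scalerA /Psi /bumpM /ext0 /H /G.
    case: asboolP => [kp|_]; last by rewrite scaler0 !mulr0 scale0r.
    by rewrite scalerA phiK// mulrA.
  by rewrite -scaler_suml si1 scale1r.
have ccPhi a (_ : unit) : ccfam None FT r (cod a) (fun t => Phi t \o psi a).
  apply: ccZ.
    by apply: sm_cc; [exact: locbox_cod|exact: ((smoothP _).1 si_sm a)].
  apply: cc_sum => k _; apply: ccZ.
    apply: sm_cc; [exact: locbox_cod|].
    exact: ((smoothP _).1 (bumpM_smooth (d k)) a).
  apply: (cc_ext a (@bump_compact _ _ _ (d k)) (@bump_Kcod _ _ _ (d k)) _ (ccC k)).
  by move=> t x cx Kx; rewrite (bump_out cx Kx) toC0 scale0r.
have := hr (option nat) None FT FF Phi PhiF Phi_sm ccPhi.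
rewrite /FT /= => hS; have [m Bm] : exists m, B (Phi (Some m)) by exact: (@filter_ex _ \oo _ _ hS).
exists (Phi (Some m)); split; last exact: Bm.
apply: alg_mul; [exact: si_sm|]; apply: alg_sum => k; apply: alg_mul; first exact: bumpM_smooth.
by apply: alg_ext0; exact: (hP (k, m)).1.
Qed.

End Density.

(** * Boundedness of the star homomorphisms *)
Section Star.
Variables (R : realType) (A : preCStarType R[i]).
Implicit Types (a b : A) (c : R[i]).

Lemma star0 : star (0 : A) = 0.
Proof.
have := star_antilin 1 (0 : A) 0; rewrite rmorph1 !scale1r addr0 => h.
by apply: (addrI (star (0 : A))); rewrite -h addr0.
Qed.

Lemma starD a b : star (a + b) = star a + star b.
Proof. by have := star_antilin 1 a b; rewrite conjC1 !scale1r. Qed.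

Lemma starZ c a : star (c *: a) = c^* *: star a.
Proof. by have := star_antilin c a 0; rewrite star0 !addr0. Qed.

Lemma starN a : star (- a) = - star a.
Proof. by rewrite -scaleN1r starZ rmorphN rmorph1 scaleN1r. Qed.

Lemma starB a b : star (a - b) = star a - star b.
Proof. by rewrite starD starN. Qed.

Lemma star1 : star (aone : A) = aone.
Proof.
rewrite -[LHS]amul1r -[X in _ ** X]starK -starM.
by rewrite amul1r starK.
Qed.

Lemma nm_cstar a : nm (star a ** a) = nm a ^+ 2.
Proof.
have : (toC (nm (star a ** a)) : R[i]) = toC (nm a ^+ 2).
  by rewrite -nmE cstar_identity (nmE a) /toC rmorphXn.
by move=> /(congr1 (@complex.Re R)).
Qed.

Lemma nm_star a : nm (star a) = nm a.
Proof.
suff le b : nm b <= nm (star b).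
  by apply/eqP; rewrite eq_le le -{2}[a]starK le.
have [->|b0] := eqVneq b 0; first by rewrite star0.
have h := nm_amul (star b) b; rewrite nm_cstar expr2 in h.
by rewrite ler_pM2r ?nm_gt0 in h.
Qed.

Lemma star_blin : bdd_linear (fun a => star a).
Proof.
split => [a b|r a|]; first exact: starD.
  rewrite starZ; congr (_ *: _); apply/conj_Creal.
  by rewrite /toC complex_real.
by exists 1 => // a; rewrite nm_star mul1r.
Qed.

Lemma amulNl a b : (- a) ** b = - (a ** b).
Proof. by rewrite -scaleN1r amulZl scaleN1r. Qed.

Lemma amulNr a b : a ** (- b) = - (a ** b).
Proof. by rewrite -scaleN1r amulZr scaleN1r. Qed.

Lemma amulBl a b d : (a - b) ** d = a ** d - b ** d.
Proof. by rewrite amulDl amulNl. Qed.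

Lemma amulBr a b d : d ** (a - b) = d ** a - d ** b.
Proof. by rewrite amulDr amulNr. Qed.

Lemma amul_suml (I : Type) (r : seq I) (P : pred I) (F : I -> A) b :
  (\sum_(i <- r | P i) F i) ** b = \sum_(i <- r | P i) F i ** b.
Proof.
by elim/big_rec2 : _ => [|i y x _ <-]; rewrite ?amul0l ?amulDl.
Qed.

Lemma amul_sumr (I : Type) (r : seq I) (P : pred I) (F : I -> A) b :
  b ** (\sum_(i <- r | P i) F i) = \sum_(i <- r | P i) b ** F i.
Proof.
by elim/big_rec2 : _ => [|i y x _ <-]; rewrite ?amul0r ?amulDr.
Qed.

Lemma star_sum (I : Type) (r : seq I) (P : pred I) (F : I -> A) :
  star (\sum_(i <- r | P i) F i) = \sum_(i <- r | P i) star (F i).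
Proof.
by elim/big_rec2 : _ => [|i y x _ <-]; rewrite ?star0 ?starD.
Qed.

End Star.

Section Sqrt.
Variables (R : realType) (A : cstarType R[i]) (b : A).
Hypotheses (b_sa : star b = b) (b_small : nm b <= 1 / 2).

Let h : R[i] := toC (1 / 2).
Let f (y : A) : A := h *: (b ** b + y ** y).

Let nmh (y : A) : nm (h *: y) = nm y / 2.
Proof. by rewrite /h nmZr ger0_norm// mulrC mul1r. Qed.

Let f_small y : nm y <= 1 / 2 -> nm (f y) <= 1 / 2.
Proof.
move=> y1; rewrite /f nmh.
have h1 := nm_amul b b; have h2 := nm_amul y y.
have b0 := nm_ge0 b; have y0 := nm_ge0 y.
have h3 := ler_wpM2l b0 b_small; have h4 := ler_wpM2l y0 y1.
have h5 := nmD (b ** b) (y ** y); have h6 := b_small; lra.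
Qed.

Let f_contr y z : nm y <= 1 / 2 -> nm z <= 1 / 2 ->
  nm (f y - f z) <= nm (y - z) / 2.
Proof.
move=> y1 z1; rewrite /f -scalerBr nmh ler_wpM2r//.
have -> : b ** b + y ** y - (b ** b + z ** z) = y ** (y - z) + (y - z) ** z.
  by rewrite amulBr amulBl -sub_tele subD_sub subrr add0r.
apply: le_trans (nmD _ _) _.
have h1 := nm_amul y (y - z); have h2 := nm_amul (y - z) z.
have d0 := nm_ge0 (y - z).
have h3 := ler_wpM2r d0 y1; have h4 := ler_wpM2l d0 z1.
by lra.
Qed.

Let y_ k := iter k f 0.

Let y_small k : nm (y_ k) <= 1 / 2.
Proof. by elim: k => [|k IH]; [rewrite /= nm0|exact: f_small]. Qed.

Let y_cauchy k m : nm (y_ (k + m) - y_ k) <= (1 / 2) ^+ k.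
Proof.
elim: k => [|k IH].
  by rewrite add0n subr0 expr0; have := y_small m; lra.
rewrite addSn /y_ !iterS; apply: le_trans (f_contr (y_small _) (y_small _)) _.
by rewrite exprS; move: IH; move: (nm _) (_ ^+ k) => u v; lra.
Qed.

Let y_sa k : star (y_ k) = y_ k.
Proof.
elim: k => [|k IH]; first exact: star0.
rewrite /y_ iterS -/(y_ k) /f starZ starD !starM IH b_sa; congr (_ *: _).
by apply/conj_Creal; rewrite /h /toC complex_real.
Qed.

Let y_comm k : y_ k ** b = b ** y_ k.
Proof.
elim: k => [|k IH]; first by rewrite /= amul0l amul0r.
rewrite /y_ iterS -/(y_ k) /f amulZl amulZr amulDl amulDr; congr (_ *: (_ + _)).
  by rewrite amulA.
by rewrite -amulA IH !amulA IH.
Qed.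

(** c = 1 - z, where z is the fixed point of y |-> (b^2 + y^2) / 2, which is a
    contraction on the ball of radius 1 / 2: then 2 z = b^2 + z^2, that is (1
    - z)^2 = 1 - b^2. The iterates from 0 are self-adjoint and commute with b,
    hence so does z. *)
Lemma star_sqrt : exists c : A,
  [/\ star c = c, c ** b = b ** c & c ** c = aone - b ** b].
Proof.
have ycvg : cvg (y_ @ \oo).
  apply/cauchy_cvgP; apply: cauchy_exP => e e0.
  have eE : e = toC (complex.Re e) by rewrite /toC RRe_real // gtr0_real.
  have r0 : 0 < complex.Re e by move: e0; rewrite {1}eE /toC ltcR.
  have [k hk] : exists k : nat, (1 / 2 : R) ^+ k < complex.Re e.
    have h1 : `|1 / 2 : R| < 1 by rewrite ger0_norm//; lra.
    have /cvgrPdist_lt/(_ _ r0) := cvg_expr h1.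
    move=> /filter_ex[k hk]; exists k; move: hk.
    by rewrite /= sub0r normrN ger0_norm ?exprn_ge0//.
  exists (y_ k); exists k => // m /= km.
  rewrite -ball_normE /= distrC eE nm_lt -(subnKC km).
  exact: le_lt_trans (y_cauchy _ _) hk.
pose z : A := lim (y_ @ \oo).
have yz2 (e : R) : 0 < e -> exists k, nm (y_ k - z) <= e /\ nm (y_ k.+1 - z) <= e.
  move=> e0; have /cvg_nmP/(_ e e0)[k _ hk] : y_ @ \oo --> z by exact: ycvg.
  by exists k; split; apply: ltW; apply: hk => //=.
have yz (e : R) : 0 < e -> exists k, nm (y_ k - z) <= e.
  by move=> /yz2[k [hk _]]; exists k.
have z_small : nm z <= 1 / 2.
  apply/ler_addgt0Pr => e e0; have [k hk] := yz e e0.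
  rewrite -(subrK (y_ k) z); apply: le_trans (nmD _ _) _.
  by rewrite nmB; have := y_small k; lra.
have z_sa : star z = z.
  apply/eqP; rewrite -subr_eq0; apply/eqP/nm_small => e e0.
  have [k hk] := yz (e / 2) (divr_gt0 e0 (ltr0Sn R 1)).
  rewrite (sub_tele _ _ (star (y_ k))) {2}y_sa -starB.
  apply: le_trans (nmD _ _) _; rewrite nm_star nmB; lra.
have z_comm : z ** b = b ** z.
  apply/eqP; rewrite -subr_eq0; apply/eqP/nm_small => e e0.
  have [k hk] := yz e e0.
  rewrite (sub_tele _ _ (y_ k ** b)) {2}y_comm -amulBl -amulBr.
  apply: le_trans (nmD _ _) _.
  have h1 := nm_amul (z - y_ k) b; have h2 := nm_amul b (y_ k - z).
  rewrite nmB in h1; have b0 := nm_ge0 b; have d0 := nm_ge0 (y_ k - z).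
  have h3 := ler_wpM2r d0 b_small; have h4 := ler_wpM2l d0 b_small.
  by lra.
have z_fix : f z = z.
  apply/eqP; rewrite -subr_eq0; apply/eqP/nm_small => e e0.
  have [k [hk hk']] := yz2 (e / 2) (divr_gt0 e0 (ltr0Sn R 1)).
  have h1 := f_contr z_small (y_small k); rewrite nmB in hk.
  have d0 := nm_ge0 (z - y_ k).
  rewrite (sub_tele _ _ (y_ k.+1)); apply: le_trans (nmD _ _) _.
  rewrite [y_ k.+1]/y_ iterS -/(y_ k) -/(y_ k.+1) in hk' *; lra.
exists (aone - z); split.
- by rewrite starB star1 z_sa.
- by rewrite amulBl amulBr amul1l amul1r z_comm.
have zE : z + z = b ** b + z ** z.
  rewrite -{1 2}z_fix /f -scalerDl.
  have -> : h + h = 1 by rewrite /h /toC -rmorphD -[RHS](rmorph1 (@real_complex R)); congr (_%:C%C); lra.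
  by rewrite scale1r.
have -> : b ** b = z + z - z ** z by rewrite zE addrK.
by rewrite amulBl !amulBr !amul1l amul1r -addrA -opprD addrA.
Qed.

End Sqrt.

Lemma half_le (R : realType) (s t : R) : s <= 1 -> t <= s + s -> 1 / 2 * t <= 1.
Proof. lra. Qed.

Section Hom.
Variables (R : realType) (A B : cstarType R[i]) (h : A -> B).
Hypothesis hP : star_hom h.

Let hD a b : h (a + b) = h a + h b.
Proof. by have [H _ _] := hP; have := H 1 a b; rewrite !scale1r. Qed.

Let h0 : h 0 = 0.
Proof. by apply: (addrI (h 0)); rewrite -hD !addr0. Qed.

Let hZ c a : h (c *: a) = c *: h a.
Proof. by have [H _ _] := hP; have := H c a 0; rewrite h0 !addr0. Qed.

Let hM a b : h (a ** b) = h a ** h b.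
Proof. by have [_ H _] := hP. Qed.

Let hS a : h (star a) = star (h a).
Proof. by have [_ _ H] := hP. Qed.

Let hN a : h (- a) = - h a.
Proof. by rewrite -scaleN1r hZ scaleN1r. Qed.

Let nm_proj : nm (h aone) <= 1.
Proof.
have e2 := nm_cstar (h aone).
have E : star (h aone) ** h aone = h aone by rewrite -hS star1 -hM amul1l.
rewrite E expr2 in e2; have x0 := nm_ge0 (h aone).
clear E; move: (nm _) x0 e2 => t t0 te; have [//|t1] := leP t 1; nra.
Qed.

(** Let c be a square root of 1 - b^2 and u = h b + i h c. Then u^* u = h 1,
    which is a projection, so that nm u <= 1, and h b is the real part of u. *)
Let hom_sa_small b : star b = b -> nm b <= 1 / 2 -> nm (h b) <= 1.
Proof.
move=> b_sa b_small; have [c [c_sa cb cc]] := star_sqrt b_sa b_small.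
pose u := h b + 'i *: h c.
have su : star u = h b - 'i *: h c.
  by rewrite /u starD starZ -!hS b_sa c_sa conjCi scaleNr.
have uu : star u ** u = h aone.
  rewrite su /u amulBl !amulDr !amulZl !amulZr scalerA -expr2 sqrCi scaleN1r.
  rewrite -!hM cb opprD opprK addrA addrK -hD.
  by rewrite cc addrC subrK.
have nu : nm u <= 1.
  have := nm_cstar u; rewrite uu => e2; have := nm_proj; rewrite e2.
  by rewrite expr_le1 ?nm_ge0.
have hb : h b = toC (1 / 2) *: (u + star u).
  have half2 : toC (1 / 2) + toC (1 / 2) = 1 :> R[i].
    rewrite /toC -rmorphD -[RHS](rmorph1 (@real_complex R)); congr (_%:C%C); lra.
  by rewrite su /u addrACA subrr addr0 scalerDr -scalerDl half2 scale1r.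
rewrite hb nmZr ger0_norm//; have := nmD u (star u); rewrite nm_star.
exact: half_le.
Qed.

(** Scale a self-adjoint b to the norm 1 / 2; for a general a use that the
    square of nm (h a) is nm (h (a^* a)). *)
Lemma star_hom_blin : bdd_linear h.
Proof.
split; [exact: hD|by move=> r a; exact: hZ|].
have sa b : star b = b -> nm (h b) <= 2 * nm b.
  move=> b_sa; have [->|b0] := eqVneq b 0; first by rewrite h0 !nm0 mulr0.
  have nb : 0 < nm b by exact: nm_gt0.
  have r0 : 0 < (2 * nm b)^-1 by rewrite invr_gt0 mulr_gt0.
  have := @hom_sa_small (toC (2 * nm b)^-1 *: b).
  rewrite hZ !nmZr (gtr0_norm r0) => H.
  rewrite -[leRHS]mulr1 -ler_pdivrMl ?mulr_gt0//; apply: H.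
    by rewrite starZ b_sa; congr (_ *: _); apply/conj_Creal; rewrite /toC complex_real.
  by rewrite invfM -mulrA mulVf ?gt_eqF//; lra.
exists 2 => // a; have a0 := nm_ge0 a; have ha0 := nm_ge0 (h a).
have := sa (star a ** a); rewrite starM starK => /(_ erefl).
rewrite hM hS !nm_cstar => H.
rewrite -(@ler_pXn2r _ 2) ?nnegrE ?mulr_ge0//; apply: le_trans H _.
by rewrite exprMn ler_wpM2r ?sqr_ge0//; lra.
Qed.

End Hom.

(** * The inner product of one-forms *)
Section Metric.
Variables (R : realType) (n : nat) (M : manifold R n) (g : riemannian M).
Implicit Types (a b : chart M) (p : M).

Lemma metric_unit a p : dom a p -> g a p \in unitmx.
Proof.
move=> ap; rewrite -row_free_unit -kermx_eq0.
apply/eqP/row_matrixP => i; rewrite row0; apply/eqP/negPn/negP => v0.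
have := @metric_pos _ _ _ g _ _ _ ap v0.
have -> : row i (kermx (g a p)) *m g a p = 0.
  by apply/sub_kermxP; exact: row_sub.
by rewrite mul0mx mxE ltxx.
Qed.

(** Conjugation is a bounded real-linear map that fixes the coordinates of the
    transition map, so it fixes their derivatives. *)
Lemma jac_real a b p j i : dom a p -> dom b p ->
  (Defs.jacobian a b p j i : R[i])^* = Defs.jacobian a b p j i.
Proof.
move=> ap bp; have h := jac_part j i ap bp.
have h' := is_part_lin (star_blin (R[i]^o : preCStarType R[i])) h.
have Sx : transition_dom (@dom _ _ M) (@cod _ _ M) (@psi _ _ M) a b (phi a p).
  by split; [exact: phi_cod|rewrite /= phiK].
apply: (is_part_uniq (@locbox_tdom _ _ M a b) Sx _ h).
apply: is_part_eq Sx _ h' => y _ /=.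
by apply/conj_Creal; rewrite /toC complex_real.
Qed.

Notation cR := (real_complex R).
Definition jacM a b p : 'M[R[i]]_n := \matrix_(j, i) (Defs.jacobian a b p j i : R[i]).

Lemma metric_changeM a b p : dom a p -> dom b p ->
  map_mx cR (g a p) = (jacM a b p)^T *m map_mx cR (g b p) *m jacM a b p.
Proof.
move=> ap bp; apply/matrixP => i k; rewrite !mxE.
rewrite -[LHS]/(toC (g a p i k) : R[i]) (@metric_change _ _ _ g _ _ _ i k ap bp) exchange_big /=.
apply: eq_bigr => l _; rewrite !mxE mulr_suml; apply: eq_bigr => j _.
by rewrite !mxE.
Qed.

Lemma inv_metric_change a b p : dom a p -> dom b p ->
  jacM a b p *m map_mx cR (invmx (g a p)) *m (jacM a b p)^T =
  map_mx cR (invmx (g b p)).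
Proof.
move=> ap bp; rewrite !map_invmx; have := metric_changeM ap bp.
have ga : map_mx cR (g a p) \in unitmx by rewrite map_unitmx metric_unit.
have gb : map_mx cR (g b p) \in unitmx by rewrite map_unitmx metric_unit.
move: ga gb; set Ga := map_mx _ _; set Gb := map_mx _ _; set J := jacM a b p.
move=> ga gb GE.
have Ju : J \in unitmx by move: ga; rewrite GE unitmx_mul => /andP[].
have Jtu : J^T \in unitmx by rewrite unitmx_tr.
apply: (can_inj (mulmxK gb)); rewrite mulVmx//.
apply: (can_inj (mulmxK Ju)); rewrite mul1mx -!mulmxA.
by rewrite (mulmxA J^T) -GE mulVmx// mulmx1.
Qed.

Section Values.
Variable E : preCStarType R[i].
Implicit Types w : one_form M E.

Definition ip_at a w w' p : E := \sum_i \sum_j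
  (toC (invmx (g a p) i j) : R[i]) *: (star (w a p i) ** w' a p j).

Definition tensorial w p := forall a b i, dom a p -> dom b p ->
  w a p i = \sum_j Defs.jacobian a b p j i *: w b p j.

Lemma ip_at_change w w' a b p : tensorial w p -> tensorial w' p ->
  dom a p -> dom b p -> ip_at a w w' p = ip_at b w w' p.
Proof.
move=> tw tw' ap bp.
pose J := jacM a b p; pose Ia := map_mx cR (invmx (g a p)).
pose X k l : E := star (w b p k) ** w' b p l.
have -> : ip_at b w w' p = \sum_k \sum_l (J *m Ia *m J^T) k l *: X k l.
  apply: eq_bigr => k _; apply: eq_bigr => l _; congr (_ *: _).
  by rewrite inv_metric_change// mxE.
transitivity (\sum_i \sum_j \sum_k \sum_l (Ia i j * J k i * J l j) *: X k l).
  apply: eq_bigr => i _; apply: eq_bigr => j _.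
  rewrite (tw a b i ap bp) (tw' a b j ap bp) star_sum amul_suml scaler_sumr.
  apply: eq_bigr => k _; rewrite amul_sumr scaler_sumr; apply: eq_bigr => l _.
  rewrite starZ amulZl amulZr !scalerA jac_real//; congr (_ *: _).
  by rewrite !mxE.
under eq_bigr => i _ do rewrite exchange_big /=.
rewrite exchange_big /=; apply: eq_bigr => k _.
under eq_bigr => i _ do rewrite exchange_big /=.
rewrite exchange_big /=; apply: eq_bigr => l _.
under eq_bigr do rewrite -scaler_suml.
rewrite -scaler_suml; congr (_ *: _).
rewrite !mxE exchange_big /=; apply: eq_bigr => j _.
rewrite !mxE mulr_suml; apply: eq_bigr => i _.
by ring.
Qed.

End Values.

(** form_ip is computed in the chart chart_at p, which depends on p in no
    regular way; smoothness is checked in a fixed chart. *)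
Lemma form_ipE (E : preCStarType R[i]) (w w' : one_form M E) a p :
  smooth_form w -> smooth_form w' -> dom a p -> form_ip g w w' p = ip_at a w w' p.
Proof.
move=> [_ _ h] [_ _ h'] ap; apply: ip_at_change ap.
- by move=> c b i cp bp; exact: h.
- by move=> c b i cp bp; exact: h'.
- exact: chart_atP.
Qed.

Lemma det_sm m (S : set 'rV[R]_n) (A : 'rV[R]_n -> 'M[R]_m) :
  (forall i j, sm S (fun x => toC (A x i j))) -> sm S (fun x => toC (\det (A x))).
Proof.
move=> hA; pose D (s : 'S_m) x : R[i]^o := ((-1) ^+ s : R[i]^o) *:
  (\prod_(i <- index_enum 'I_m) (toC (A x i (s i)) : R[i]) : R[i]^o).
have hD s : sm S (D s).
  apply: smZ; first by move=> k; exact: cc_cst.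
  move=> k; apply: (cc_prod (index_enum 'I_m) (H := fun i _ x => toC (A x i (s i)))) => i.
  exact: hA.
have hs : sm S (fun x => \sum_(s <- index_enum 'S_m) D s x) by exact: sm_sum.
move=> k; apply: (cc_eq _ (hs k)) => _ x _.
rewrite /determinant /toC rmorph_sum; apply: eq_bigr => s _.
rewrite /D rmorphM rmorph_prod; congr (_ * _).
by rewrite rmorphXn rmorphN rmorph1.
Qed.

(** Cramer's rule. *)
Lemma inv_metric_sm a i j : sm (cod a) (fun x => toC (invmx (g a (psi a x)) i j)).
Proof.
have hg i' j' : sm (cod a) (fun x => toC (g a (psi a x) i' j')).
  by apply/sm_smooth_on; [exact: locbox_cod|exact: metric_smooth].
have hdet := det_sm hg.
have hadj : sm (cod a) (fun x => toC (\det (row' j (col' i (g a (psi a x)))))).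
  apply: det_sm => i' j'.
  have h := hg (lift j i') (lift i j').
  by move=> k; apply: (cc_eq _ (h k)) => _ x _; rewrite !mxE.
have gu x : cod a x -> g a (psi a x) \in unitmx by move=> cx; apply: metric_unit; exact: psi_dom.
have hinv : sm (cod a) (fun x => (toC (\det (g a (psi a x))) : R[i])^-1 : R[i]^o).
  move=> k; apply: (cc_inv _ (hdet k)) => x cx.
  have := gu x cx; rewrite unitmxE unitfE => d0.
  by apply/eqP => /(congr1 (@complex.Re R))/= h0; rewrite h0 eqxx in d0.
have hc : sm (cod a) (fun _ : 'rV[R]_n => (-1) ^+ (j + i) : R[i]^o).
  by move=> k; exact: cc_cst.
have h := smZ hinv (smZ hc hadj).
move=> k; apply: (cc_eq _ (h k)) => _ x cx.
rewrite /invmx (gu x cx) !mxE /cofactor /toC !rmorphM fmorphV.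
by rewrite rmorphXn rmorphN rmorph1.
Qed.

Lemma form_ip_smooth (E : preCStarType R[i]) (w w' : one_form M E) :
  smooth_form w -> smooth_form w' -> smooth (form_ip g w w').
Proof.
move=> sw sw'; apply/smoothP => a.
have [h1 _ _] := (smooth_formP _).1 sw; have [h1' _ _] := (smooth_formP _).1 sw'.
pose t i j x : E := (toC (invmx (g a (psi a x)) i j) : R[i]^o) *:
  (star (w a (psi a x) i) ** w' a (psi a x) j).
have ht i j : sm (cod a) (t i j).
  apply: smZ; first exact: inv_metric_sm.
  move=> k; apply: cc_amul; last exact: h1'.
  by apply: cc_lin; [exact: star_blin|exact: h1].
have hs : sm (cod a) (fun x => \sum_(i <- index_enum 'I_n) \sum_(j <- index_enum 'I_n) t i j x).
  by apply: sm_sum => i; apply: sm_sum => j; exact: ht.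
move=> k; apply: (cc_eq _ (hs k)) => _ x cx.
by rewrite /= (form_ipE sw sw' (psi_dom cx)).
Qed.

Section Algebra.
Variable E : preCStarType R[i].
Implicit Types (w : one_form M E) (F : M -> E).

Lemma form_ipDr w w1 w2 p : form_ip g w (fun a p i => w1 a p i + w2 a p i) p =
  form_ip g w w1 p + form_ip g w w2 p.
Proof.
rewrite /form_ip -big_split; apply: eq_bigr => i _ /=.
by rewrite -big_split; apply: eq_bigr => j _ /=; rewrite amulDr scalerDr.
Qed.

Lemma form_ip_mulr w w' F p : form_ip g w (fun a p i => w' a p i ** F p) p =
  form_ip g w w' p ** F p.
Proof.
rewrite /form_ip amul_suml; apply: eq_bigr => i _ /=.
rewrite amul_suml; apply: eq_bigr => j _ /=.
by rewrite amulA amulZl.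
Qed.

Lemma form_ip_mull w w' F p : form_ip g (fun a p i => w a p i ** F p) w' p =
  star (F p) ** form_ip g w w' p.
Proof.
rewrite /form_ip amul_sumr; apply: eq_bigr => i _ /=.
rewrite amul_sumr; apply: eq_bigr => j _ /=.
by rewrite starM -amulA amulZr.
Qed.

Lemma form_ip_sumr (I : Type) (r : seq I) w (w' : I -> one_form M E) p :
  form_ip g w (fun a p i => \sum_(k <- r) w' k a p i) p =
  \sum_(k <- r) form_ip g w (w' k) p.
Proof.
rewrite /form_ip [RHS]exchange_big /=; apply: eq_bigr => i _.
rewrite [RHS]exchange_big /=; apply: eq_bigr => j _.
by rewrite amul_sumr scaler_sumr.
Qed.

Lemma form_ip_suml (I : Type) (r : seq I) w (w' : I -> one_form M E) p :
  form_ip g (fun a p i => \sum_(k <- r) w' k a p i) w p =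
  \sum_(k <- r) form_ip g (w' k) w p.
Proof.
rewrite /form_ip [RHS]exchange_big /=; apply: eq_bigr => i _.
rewrite [RHS]exchange_big /=; apply: eq_bigr => j _.
by rewrite star_sum amul_suml scaler_sumr.
Qed.

End Algebra.

End Metric.

(** * Continuity of the operations on functions and one-forms *)
Section FormRules.
Variables (R : realType) (n : nat) (M : manifold R n).
Implicit Types (a b : chart M) (p : M) (E : normedModType R[i]).

Lemma sformM (A : preCStarType R[i]) (W : one_form M A) (F : M -> A) :
  smooth_form W -> smooth F -> smooth_form (fun a p i => W a p i ** F p).
Proof.
move=> /smooth_formP[h1 h2 h3] /smoothP sF; apply/smooth_formP; split.
- by move=> a i k; exact: (cc_amul (h1 a i k) (sF a k)).
- by move=> a p i ap; rewrite h2// amul0l.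
- move=> a b p i ap bp; rewrite (h3 a b p i ap bp) amul_suml.
  by apply: eq_bigr => j _; rewrite amulZl.
Qed.

Lemma sformMl (A : preCStarType R[i]) (W : one_form M A) (F : M -> A) :
  smooth_form W -> smooth F -> smooth_form (fun a p i => F p ** W a p i).
Proof.
move=> /smooth_formP[h1 h2 h3] /smoothP sF; apply/smooth_formP; split.
- by move=> a i k; exact: (cc_amul (sF a k) (h1 a i k)).
- by move=> a p i ap; rewrite h2// amul0r.
- move=> a b p i ap bp; rewrite (h3 a b p i ap bp) amul_sumr.
  by apply: eq_bigr => j _; rewrite amulZr.
Qed.

Lemma sformB (E : normedModType R[i]) (W W' : one_form M E) :
  smooth_form W -> smooth_form W' -> smooth_form (fun a p i => W a p i - W' a p i).
Proof.
move=> /smooth_formP[h1 h2 h3] /smooth_formP[h1' h2' h3']; apply/smooth_formP; split.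
- by move=> a i k; exact: (ccB (h1 a i k) (h1' a i k)).
- by move=> a p i ap; rewrite h2// h2'// subrr.
- move=> a b p i ap bp; rewrite (h3 a b p i ap bp) (h3' a b p i ap bp) -sumrB.
  by apply: eq_bigr => j _; rewrite scalerBr.
Qed.

Lemma sform_sum (E : normedModType R[i]) (I : Type) (r : seq I) (W : I -> one_form M E) :
  (forall k, smooth_form (W k)) -> smooth_form (fun a p i => \sum_(k <- r) W k a p i).
Proof.
move=> sW; have h k := (smooth_formP _).1 (sW k); apply/smooth_formP; split.
- by move=> a i; apply: sm_sum => k; have [h1 _ _] := h k; exact: h1.
- by move=> a p i ap; rewrite big1// => k _; have [_ h2 _] := h k; exact: h2.
- move=> a b p i ap bp; under [RHS]eq_bigr do rewrite scaler_sumr.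
  rewrite exchange_big /=; apply: eq_bigr => k _.
  by have [_ _ h3] := h k; exact: h3.
Qed.

Lemma sform_lin (E1 E2 : normedModType R[i]) (L : E1 -> E2) (W : one_form M E1) :
  bdd_linear L -> (forall c x, L (c *: x) = c *: L x) -> smooth_form W ->
  smooth_form (fun a p i => L (W a p i)).
Proof.
move=> hL hc /smooth_formP[h1 h2 h3]; apply/smooth_formP.
have L0 : L 0 = 0 by have := hc 0 0; rewrite !scale0r.
split.
- by move=> a i k; exact: (cc_lin hL (h1 a i k)).
- by move=> a p i ap; rewrite h2.
- move=> a b p i ap bp; rewrite (h3 a b p i ap bp).
  elim/big_rec2 : _ => [|j y x _ <-]; first exact: L0.
  by rewrite (blinD hL) hc.
Qed.

Lemma sform_eq0 (E : normedModType R[i]) (W : one_form M E) : smooth_form W ->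
  (forall p, exists2 a, dom a p & forall i, W a p i = 0) -> forall a p i, W a p i = 0.
Proof.
move=> [_ h2 h3] h0 a p i; have [ap|ap] := pselect (dom a p); last exact: h2.
have [b bp hb] := h0 p; rewrite (h3 a b p i ap bp) big1// => j _.
by rewrite hb scaler0.
Qed.

Section Conv.
Variables (T : Type) (t0 : T) (FT : set_system T).
Context {FF : Filter FT}.

(** Convergence of functions in all charts with all derivatives. It is
    equivalent to convergence for fun_nbhs (tends_ccfun, ccfun_tends), and is
    preserved by the operations thanks to the rules for families. The same
    goes for ccform and form_nbhs. *)
Definition ccfun E (F : T -> M -> E) := forall k a,
  ccfam t0 FT k (cod a) (fun t => F t \o psi a).

Definition ccform E (W : T -> one_form M E) := forall k a i,
  ccfam t0 FT k (cod a) (fun t x => W t a (psi a x) i).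

Lemma ccfun_d E (F : T -> M -> E) : ccfun F -> ccform (fun t => ext_d (F t)).
Proof.
move=> hF k a i; have [_ h] := cc_canon (@locbox_cod _ _ M a) (hF k.+1 a) i.
apply: (cc_eq _ h) => t x cx.
by rewrite /ext_d asboolT ?psiK//; exact: psi_dom.
Qed.

Lemma ccform_sum E (I : Type) (r : seq I) (W : I -> T -> one_form M E) :
  (forall j, ccform (W j)) -> ccform (fun t a p i => \sum_(j <- r) W j t a p i).
Proof. by move=> hW k a i; apply: cc_sum => j _; exact: hW. Qed.

Lemma ccformM (A : preCStarType R[i]) (W : T -> one_form M A) (F : T -> M -> A) :
  ccform W -> ccfun F -> ccform (fun t a p i => W t a p i ** F t p).
Proof. by move=> hW hF k a i; exact: (cc_amul (hW k a i) (hF k a)). Qed.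

Lemma ccfunM (A : preCStarType R[i]) (F G : T -> M -> A) :
  ccfun F -> ccfun G -> ccfun (fun t p => F t p ** G t p).
Proof. by move=> hF hG k a; exact: (cc_amul (hF k a) (hG k a)). Qed.

Lemma ccfun_const E (F : M -> E) : smooth F -> ccfun (fun _ => F).
Proof.
move=> /smoothP sF k a; apply: sm_cc; [exact: locbox_cod|exact: sF].
Qed.

Lemma ccform_const E (W : one_form M E) : smooth_form W -> ccform (fun _ => W).
Proof.
move=> /smooth_formP[h1 _ _] k a i.
by apply: (sm_cc k t0 (@locbox_cod _ _ M a)); exact: h1.
Qed.

Lemma ccform_near E (W : T -> one_form M E) : ccform W -> forall a p i,
  (forall t, ~ dom a p -> W t a p i = 0) ->
  forall e : R, 0 < e -> \forall t \near FT, nm (W t a p i - W t0 a p i) <= e.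
Proof.
move=> hW a p i h0 e e0; have [ap|ap] := pselect (dom a p); last first.
  by apply: filterE => t; rewrite !h0// subrr nm0 ltW.
have [d d0 hd] := cc_loc_unif (hW 0%N a i) (phi_cod ap) e0.
apply: filterS hd => t /(_ (phi a p) (phi_cod ap) (near_ptxx _ d0)).
by rewrite phiK.
Qed.

Lemma ccfun_near E (F : T -> M -> E) : ccfun F -> forall p (e : R), 0 < e ->
  \forall t \near FT, nm (F t p - F t0 p) <= e.
Proof.
move=> hF p e e0; have ap := chart_atP p.
have [d d0 hd] := cc_loc_unif (hF 0%N (chart_at p)) (phi_cod ap) e0.
apply: filterS hd => t /(_ _ (phi_cod ap) (near_ptxx _ d0)).
by rewrite /= phiK.
Qed.

Lemma form_loc_sm E (W : one_form M E) : smooth_form W ->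
  forall a i, sm (cod a) (fun x => W a (psi a x) i).
Proof. by move=> /smooth_formP[]. Qed.

Lemma tends_ccfun E (F : T -> M -> E) : (forall t, smooth (F t)) ->
  (forall B, fun_nbhs (F t0) B -> FT [set t | B (F t)]) -> ccfun F.
Proof.
move=> sF hF k a.
exact: (tends_cc (@fun_loc_sm R n M E) sF hF k a tt).
Qed.

Lemma tends_ccform E (W : T -> one_form M E) : (forall t, smooth_form (W t)) ->
  (forall B, form_nbhs (W t0) B -> FT [set t | B (W t)]) -> ccform W.
Proof. by move=> sW hW; exact: (tends_cc (@form_loc_sm E) sW hW). Qed.

Lemma ccfun_tends E (F : T -> M -> E) : (forall t, smooth (F t)) ->
  ccfun F -> forall B, fun_nbhs (F t0) B -> FT [set t | B (F t)].
Proof.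
by move=> sF hF; apply: (cc_tends FF sF) => k a _; exact: hF.
Qed.

Lemma ccform_tends E (W : T -> one_form M E) : (forall t, smooth_form (W t)) ->
  ccform W -> forall B, form_nbhs (W t0) B -> FT [set t | B (W t)].
Proof. by move=> sW hW; exact: (cc_tends FF sW). Qed.

End Conv.
End FormRules.

(** * Forms orthogonal to the image of the action *)
Lemma ext_d_cst (R : realType) n (M : manifold R n) (E : normedModType R[i])
  (c : E) a p i : ext_d (fun _ : M => c) a p i = 0.
Proof.
have [ap|ap] := pselect (dom a p); last exact: ext_d_out.
by apply: ext_dE => //; exact: (is_part_cst (cod a) c i (phi a p)).
Qed.

Lemma ext_d_mulr (R : realType) n (M : manifold R n) (A : preCStarType R[i])
  (F : M -> A) (q : A) a p i : smooth F ->
  ext_d (fun p => F p ** q) a p i = ext_d F a p i ** q.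
Proof.
move=> sF; have sq : smooth (fun _ : M => q) by exact: smooth_cst.
by rewrite (ext_d_bilin a p i (amul_bilin A) sF sq) ext_d_cst amul0r addr0.
Qed.

Section Near.
Variables (R : realType) (n : nat) (M : manifold R n) (E : normedModType R[i]).

(** Continuity of an operation at F is tested on this filter, along which the
    inclusion of the smooth functions converges to F (fnear_ccfun); likewise
    for forms. *)
Definition fnear (F : M -> E) : set_system {G : M -> E | smooth G} :=
  sub_nbhs (smX := @smooth _ _ M E) (fun F a (_ : unit) => F \o psi a) F.

Definition wnear (W : one_form M E) : set_system {G : one_form M E | smooth_form G} :=
  sub_nbhs (smX := @smooth_form _ _ M E) (fun w a i x => w a (psi a x) i) W.

Lemma fnear_filter F : Filter (fnear F).
Proof. exact: sub_filter. Qed.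

Lemma wnear_filter W : Filter (wnear W).
Proof. exact: sub_filter. Qed.

Lemma fnear_ccfun F (sF : smooth F) :
  ccfun (exist _ F sF) (fnear F) (fun t => sval t).
Proof.
have FF := fnear_filter F.
apply: tends_ccfun; first by move=> t; exact: (svalP t).
by move=> B hB; exact: sub_tends.
Qed.

Lemma wnear_ccform W (sW : smooth_form W) :
  ccform (exist _ W sW) (wnear W) (fun t => sval t).
Proof.
have FF := wnear_filter W.
apply: tends_ccform; first by move=> t; exact: (svalP t).
by move=> B hB; exact: sub_tends.
Qed.

Lemma fnear_nbhs F (A : set (M -> E)) : fnear F [set t | A (sval t)] -> fun_nbhs F A.
Proof. exact: sub_near. Qed.

Lemma wnear_nbhs W (A : set (one_form M E)) :
  wnear W [set t | A (sval t)] -> form_nbhs W A.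
Proof. exact: sub_near. Qed.

End Near.

Section Main.
Variables (R : realType) (n : nat) (M : manifold R n) (Q : cqg R[i]).
Variable alpha : (M -> R[i]^o) -> (M -> Q).
Hypothesis aP : smooth_action alpha.
Let Q1 : cstarType R[i] := qg Q.
Implicit Types (f h : M -> R[i]^o) (a b : chart M) (p : M).

Lemma alpha_smooth f : smooth f -> smooth (alpha f).
Proof. by have [h _] := action_linear aP; exact: h. Qed.

Lemma alphaD f h : smooth f -> smooth h ->
  alpha (fun p => f p + h p) = fun p => alpha f p + alpha h p.
Proof.
move=> sf sh; have [_ H] := action_linear aP; have := H 1 f h sf sh.
have -> : (1 *: f + h : M -> R[i]^o) = (fun p => f p + h p).
  by apply/funext => p /=; rewrite -[LHS]/(1 *: f p + h p) scale1r.
by move=> ->; apply/funext => p; rewrite -[LHS]/(1 *: alpha f p + alpha h p) scale1r.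
Qed.

Lemma alpha0 : alpha (fun _ => 0) = fun _ => 0.
Proof.
have s0 : smooth (fun _ : M => 0 : R[i]^o) by exact: smooth_cst.
apply/funext => p; have := congr1 (fun F => F p) (alphaD s0 s0) => /=.
have -> : (fun _ : M => 0 + 0 : R[i]^o) = (fun _ => 0) by apply/funext => q; rewrite addr0.
by move=> h; apply: (addrI (alpha (fun _ => 0) p)); rewrite -h addr0.
Qed.

Lemma alphaM f h : smooth f -> smooth h ->
  alpha (fun p => (f p : R[i]) * h p : R[i]^o) = fun p => alpha f p ** alpha h p.
Proof. by move=> sf sh; exact: (action_mul aP sf sh). Qed.

Lemma alpha_sum (I : Type) (r : seq I) (f : I -> M -> R[i]^o) : (forall k, smooth (f k)) ->
  alpha (fun p => \sum_(k <- r) f k p) = fun p => \sum_(k <- r) alpha (f k) p.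
Proof.
move=> sf; elim: r => [|k r IH].
  have -> : (fun p => \sum_(k <- [::]) f k p) = (fun _ => 0).
    by apply/funext => p; rewrite big_nil.
  by rewrite alpha0; apply/funext => p; rewrite big_nil.
have -> : (fun p => \sum_(j <- k :: r) f j p) = (fun p => f k p + \sum_(j <- r) f j p).
  by apply/funext => p; rewrite big_cons.
rewrite alphaD; [|exact: sf|exact: smooth_sum].
by rewrite IH; apply/funext => p; rewrite big_cons.
Qed.

Lemma alpha_comm f h p : smooth f -> smooth h -> alpha f p ** alpha h p = alpha h p ** alpha f p.
Proof.
move=> sf sh; have e1 := congr1 (fun F => F p) (alphaM sf sh).
have e2 := congr1 (fun F => F p) (alphaM sh sf); move: e1 e2 => /= <- <-.
by congr (alpha _ p); apply/funext => q; rewrite mulrC.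
Qed.

Variable g : riemannian M.

Lemma approx_ext_d (F : M -> Q1) p (e : R) : smooth F -> 0 < e ->
  fun_nbhs F [set G | forall i, nm (ext_d G (chart_at p) p i - ext_d F (chart_at p) p i) <= e].
Proof.
move=> sF e0; have FF := fnear_filter F; apply: fnear_nbhs.
have hc : ccform (exist _ F sF) (fnear F) (fun t => ext_d (sval t)).
  exact: ccfun_d (fnear_ccfun sF).
have h1 i : \forall t \near fnear F, nm (ext_d (sval t) (chart_at p) p i - ext_d F (chart_at p) p i) <= e.
  apply: (ccform_near hc _ e0) => t ap; exact: ext_d_out.
exact: (filter_forall _ h1).
Qed.

(** The sums of the d(alpha f) q are orthogonal to W. By density of the
    action, F is approximated with its first derivatives at p by functions
    whose differentials are such sums. *)
Lemma exact_orth (W : one_form M Q1) : 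
  (forall f, smooth f -> forall p, form_ip g (ext_d (alpha f)) W p = 0) ->
  forall F : M -> Q1, smooth F -> forall p, form_ip g (ext_d F) W p = 0.
Proof.
move=> hW F sF p; apply: nm_small => e e0.
pose a := chart_at p.
pose C := \sum_i \sum_j nm (toC (invmx (g a p) i j) : R[i]^o) * nm (W a p j).
have C0 : 0 <= C by do 2 (apply: sumr_ge0 => ? _); rewrite mulr_ge0 ?nm_ge0.
have C1 : 0 < C + 1 by rewrite ltr_wpDl.
have d0 : 0 < e / (C + 1) by rewrite divr_gt0.
have [G [[m [f [q [sf GE]]]] hG]] := action_dense aP sF (approx_ext_d p sF d0).
have G0 : form_ip g (ext_d G) W p = 0.
  pose X k : one_form M Q1 := fun a p i => ext_d (alpha (f k)) a p i ** q k.
  have -> : ext_d G = (fun a p i => \sum_k X k a p i).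
    apply/funext => b; apply/funext => r; apply/funext => i; rewrite GE.
    rewrite ext_d_sum; last first.
      move=> k; apply: (smooth_bilin (amul_bilin Q1)); first exact: alpha_smooth.
      exact: smooth_cst.
    by apply: eq_bigr => k _; apply: ext_d_mulr; exact: alpha_smooth.
  rewrite form_ip_suml big1// => k _.
  by rewrite form_ip_mull hW// amul0r.
rewrite -[form_ip g (ext_d F) W p]subr0 -G0 /form_ip -sumrB.
have CE : C * (e / (C + 1)) <= e.
  by rewrite mulrA ler_pdivrMr// mulrC ler_wpM2l ?(ltW e0)//; lra.
apply: le_trans CE; rewrite mulr_suml; apply: le_trans (nm_sum _ _ _) _.
apply: ler_sum => i _; rewrite -sumrB mulr_suml; apply: le_trans (nm_sum _ _ _) _.
apply: ler_sum => j _; rewrite -scalerBr -amulBl -starB nmZ -mulrA.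
apply: ler_wpM2l; first exact: nm_ge0.
apply: le_trans (nm_amul _ _) _; rewrite mulrC ler_wpM2l ?nm_ge0//.
by rewrite nm_star nmB; exact: hG.
Qed.

End Main.

(** * Nondegeneracy on exact forms *)
Section Nondeg.
Variables (R : realType) (n : nat) (M : manifold R n) (g : riemannian M).
Variable A : preCStarType R[i].
Implicit Types (f h : M -> R[i]^o) (a b : chart M) (p : M).

Lemma ext_d_scale1 f a p i : smooth f ->
  ext_d (fun q => f q *: (aone : A)) a p i = (ext_d f a p i : R[i]) *: (aone : A).
Proof.
move=> sf; have s1 : smooth (fun _ : M => aone : A) by exact: smooth_cst.
by rewrite (ext_d_bilin a p i (scale_bilin A) sf s1) ext_d_cst scaler0 addr0.
Qed.

(** At p take F = b x_k and F = b, where b is a bump function with b(p) > 0.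
    As d(b x_k) - x_k db = b dx_k, W is orthogonal to dx_k at p for all k, and
    the metric is nondegenerate. *)
Lemma exact_forms_nondeg (W : one_form M A) : smooth_form W ->
  (forall F : M -> A, smooth F -> forall p, form_ip g (ext_d F) W p = 0) ->
  forall a p i, W a p i = 0.
Proof.
move=> sW hW; apply: sform_eq0 => // p.
have [d /nbhs_singleton[dp b0]] := bump_at p.
pose a := bch d; exists a => // i.
pose iv l j : R[i] := toC (invmx (g a p) l j).
suff S0 k : \sum_j iv k j *: W a p j = 0.
  have gu := metric_unit g dp.
  transitivity (\sum_k (toC (g a p i k) : R[i]) *: \sum_j iv k j *: W a p j); last first.
    by rewrite big1// => k _; rewrite S0 scaler0.
  under eq_bigr do rewrite scaler_sumr.
  rewrite exchange_big /= (bigD1 i)//= [X in _ = _ + X]big1 ?addr0.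
    under eq_bigr do rewrite scalerA.
    rewrite -scaler_suml.
    have -> : \sum_k (toC (g a p i k) : R[i]) * iv k i = toC ((g a p *m invmx (g a p)) i i).
      by rewrite mxE /toC rmorph_sum; apply: eq_bigr => k _; rewrite rmorphM.
    by rewrite mulmxV// mxE eqxx /toC rmorph1 scale1r.
  move=> j ji; under eq_bigr do rewrite scalerA.
  rewrite -scaler_suml.
  have -> : \sum_k (toC (g a p i k) : R[i]) * iv k j = toC ((g a p *m invmx (g a p)) i j).
    by rewrite mxE /toC rmorph_sum; apply: eq_bigr => k _; rewrite rmorphM.
  by rewrite mulmxV// mxE eq_sym (negbTE ji) /toC rmorph0 scale0r.
pose b x : R[i]^o := toC (bfun d x).
have sb S : sm S b by exact: bump_sm.
pose bx : M -> R[i]^o := ext0 a (fun x => b x *: (toC (x 0 k) : R[i]^o)).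
have sbx : smooth bx by apply: bump_ext_smooth => m; exact: cc_coord.
have sbe : smooth (bumpM d) by exact: bumpM_smooth.
pose db l : R[i]^o := partial (cod a) b l (phi a p).
have hdb l : is_part (cod a) b l (phi a p) (db l).
  by apply: sm_part; [exact: locbox_cod|exact: sb|exact: phi_cod].
have E2 l : ext_d (bumpM d) a p l = db l by exact: ext_d_ext0 (hdb l).
pose x : R[i] := toC (phi a p 0 k).
have E1 l : ext_d bx a p l = (db l : R[i]) * x + (b (phi a p) : R[i]) * (l == k)%:R.
  apply: ext_d_ext0 => //.
  exact: (is_part_bilin (scale_bilin R[i]^o) (hdb l) (coord_part (cod a) l k (phi a p))).
have ipz f : smooth f -> \sum_l \sum_j (iv l j * (ext_d f a p l : R[i])^*) *: W a p j = 0.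
  move=> sf; have sF : smooth (fun q => f q *: (aone : A)).
    by apply: smoothZ; [exact: sf|exact: smooth_cst].
  have := hW _ sF p; rewrite (form_ipE g (ext_d_smooth sF) sW dp) /ip_at => H.
  rewrite -[RHS]H; apply: eq_bigr => l _; apply: eq_bigr => j _.
  by rewrite ext_d_scale1// starZ star1 amulZl amul1l scalerA.
have h1 := ipz _ sbx; have h2 := ipz _ sbe.
have xr : x^* = x by apply/conj_Creal; rewrite /x /toC complex_real.
have br : (b (phi a p) : R[i])^* = b (phi a p).
  by apply/conj_Creal; rewrite /b /toC complex_real.
have h3 : \sum_l \sum_j (iv l j * (b (phi a p) : R[i]) * (l == k)%:R) *: W a p j = 0.
  (* b dx_k = d(b x_k) - x_k db *)
transitivity ((\sum_l \sum_j (iv l j * (ext_d bx a p l : R[i])^*) *: W a p j) -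
    x *: (\sum_l \sum_j (iv l j * (ext_d (bumpM d) a p l : R[i])^*) *: W a p j)); last first.
    apply: (etrans (f_equal2 (fun u v => u - x *: v) h1 h2)).
    by rewrite scaler0 subrr.
  rewrite scaler_sumr -sumrB.
  apply: eq_bigr => l _; rewrite scaler_sumr -sumrB; apply: eq_bigr => j _.
  rewrite scalerA -scalerBl; congr (_ *: _).
  have nr : ((l == k)%:R : R[i])^* = (l == k)%:R by rewrite rmorph_nat.
  have E1' : (ext_d bx a p l : R[i])^* =
      (db l : R[i])^* * x + (b (phi a p) : R[i]) * (l == k)%:R.
    rewrite E1 rmorphD !rmorphM; congr (_ * _ + _ * _); [exact: xr|exact: br|exact: nr].
  have E2' : (ext_d (bumpM d) a p l : R[i])^* = (db l : R[i])^* by rewrite E2.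
  apply: etrans (f_equal2 (fun u v => iv l j * u - x * (iv l j * v)) (esym E1') (esym E2')).
  by move: (_^*) (b _ : R[i]) ((l == k)%:R : R[i]) => u v w; ring.
move: h3; rewrite (bigD1 k)//= [X in _ + X]big1 ?addr0; last first.
  by move=> l lk; rewrite big1// => j _; rewrite (negbTE lk) mulr0 scale0r.
rewrite eqxx => h3.
have bn : (b (phi a p) : R[i]) != 0.
  by apply/eqP => /(congr1 (@complex.Re R))/= h; rewrite h ltxx in b0.
apply: (scalerI bn); rewrite scaler0 -[RHS]h3 scaler_sumr; apply: eq_bigr => j _.
by rewrite scalerA mulr1 mulrC.
Qed.

End Nondeg.

(** * Coefficients and commutation *)
Section Coefficients.
Variables (R : realType) (n : nat) (M : manifold R n) (D : decomp M).
Implicit Types (a b : chart M) (p : M) (E : normedModType R[i]).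

Definition coef E (i : dI D) (w : one_form M E) : M -> E :=
  fun p => (dc i p : R[i]) *: w (da i) p (dj i).

Lemma coefE E i (w : one_form M E) :
  coef i w = ext0 (da i) (fun x => (dc i (psi (da i) x) : R[i]^o) *: w (da i) (psi (da i) x) (dj i)).
Proof.
apply/funext => p; rewrite /coef /ext0; case: asboolP => ap; first by rewrite phiK.
by rewrite dc_dom// scale0r.
Qed.

Lemma coef_cc (T : Type) (t0 : T) (FT : set_system T) {FF : Filter FT} E i
  (W : T -> one_form M E) : ccform t0 FT W -> ccfun t0 FT (fun t => coef i (W t)).
Proof.
move=> hW k a.
pose H t x : E := (dc i (psi (da i) x) : R[i]^o) *: W t (da i) (psi (da i) x) (dj i).
have h : ccfam t0 FT k (cod a) (fun t => ext0 (da i) (H t) \o psi a).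
  apply: (cc_ext a (@dK_compact _ _ _ D i) (@dK_cod _ _ _ D i)).
    by move=> t x cx Kx; rewrite /H (dc_out cx Kx) scale0r.
  apply: ccZ; last exact: hW.
  have sc : smooth (dc i) := dc_smooth i.
  apply: sm_cc; [exact: locbox_cod|].
  exact: ((smoothP _).1 sc).
by apply: (cc_eq _ h) => t x cx /=; rewrite coefE.
Qed.

Lemma coef_smooth E i (w : one_form M E) : smooth_form w -> smooth (coef i w).
Proof.
move=> sw; apply/smoothP => a k.
have hc : ccform tt (globally [set: unit]) (fun _ : unit => w) by exact: ccform_const.
exact: (coef_cc i hc k a).
Qed.

Lemma coef_lin E i (c : R[i]) (w w' : one_form M E) p :
  coef i (c *: w + w') p = c *: coef i w p + coef i w' p.
Proof.
rewrite /coef -[(c *: w + w') _ _ _]/(c *: w (da i) p (dj i) + w' (da i) p (dj i)).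
by rewrite scalerDr !scalerA mulrC.
Qed.

Lemma decompM (A : preCStarType R[i]) (w : one_form M A) : smooth_form w ->
  forall a p m, w a p m =
    \sum_i ext_d (fun q => dg i q *: (aone : A)) a p m ** coef i w p.
Proof.
move=> sw a p m; rewrite (decompE D sw); apply: eq_bigr => i _.
rewrite ext_d_scale1; last exact: dg_smooth.
by rewrite amulZl amul1l.
Qed.

End Coefficients.

Section Lift.
Variables (R : realType) (n : nat) (M : manifold R n) (Q : cqg R[i]).
Variable alpha : (M -> R[i]^o) -> (M -> Q).
Hypothesis aP : smooth_action alpha.
Variable g : riemannian M.
Hypothesis ipp : inner_product_preserving g alpha.
Variable D : decomp M.
Let Q1 : cstarType R[i] := qg Q.
Implicit Types (f h k : M -> R[i]^o) (a b : chart M) (p : M).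
Implicit Types (w : one_form M R[i]^o).

Lemma orth0 (W : one_form M Q1) : smooth_form W ->
  (forall f, smooth f -> forall p, form_ip g (ext_d (alpha f)) W p = 0) ->
  forall a p i, W a p i = 0.
Proof. by move=> sW hW; exact: (exact_forms_nondeg sW (exact_orth aP hW)). Qed.

Lemma ippE f h p : smooth f -> smooth h ->
  form_ip g (ext_d (alpha f)) (ext_d (alpha h)) p =
  alpha (form_ip g (ext_d f) (ext_d h)) p.
Proof. by move=> sf sh; exact: (congr1 (fun F => F p) (ipp sf sh)). Qed.

Lemma smooth_mul f h : smooth f -> smooth h -> smooth (fun p => (f p : R[i]) * h p : R[i]^o).
Proof. by move=> sf sh; exact: (smoothZ sf sh). Qed.

(** Expand << d(alpha k), d(alpha (f h)) >> = alpha(<< dk, d(f h) >>) with the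
    Leibniz rule on both sides, and cancel the terms that contain df. *)
Lemma ip_left k f h p : smooth k -> smooth f -> smooth h ->
  form_ip g (ext_d (alpha k)) (fun a p i => alpha f p ** ext_d (alpha h) a p i) p =
  form_ip g (ext_d (alpha k)) (ext_d (alpha h)) p ** alpha f p.
Proof.
move=> sk sf sh.
have saf := alpha_smooth aP sf; have sah := alpha_smooth aP sh.
pose kf := form_ip g (ext_d k) (ext_d f); pose kh := form_ip g (ext_d k) (ext_d h).
have skf : smooth kf := form_ip_smooth g (ext_d_smooth sk) (ext_d_smooth sf).
have skh : smooth kh := form_ip_smooth g (ext_d_smooth sk) (ext_d_smooth sh).
have sfh := smooth_mul sf sh.
have H := ippE p sk sfh.
have E1 : ext_d (alpha (fun p => (f p : R[i]) * h p : R[i]^o)) =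
    (fun a p i => ext_d (alpha f) a p i ** alpha h p + alpha f p ** ext_d (alpha h) a p i).
  rewrite alphaM//; apply/funext => a; apply/funext => q; apply/funext => i.
  exact: (ext_d_bilin a q i (amul_bilin Q1) saf sah).
have E2 : form_ip g (ext_d k) (ext_d (fun p => (f p : R[i]) * h p : R[i]^o)) =
    (fun p => (kf p : R[i]) * h p + (kh p : R[i]) * f p).
  apply/funext => q.
  have -> : ext_d (fun p => (f p : R[i]) * h p : R[i]^o) =
      (fun a p i => (fun a p i => ext_d f a p i ** h p) a p i +
                    (fun a p i => ext_d h a p i ** f p) a p i).
    apply/funext => a; apply/funext => r; apply/funext => i.
    rewrite (ext_d_bilin a r i (scale_bilin (R[i]^o)) sf sh); congr (_ + _).
    exact: mulrC.
  by rewrite form_ipDr !form_ip_mulr.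
rewrite E1 E2 form_ipDr form_ip_mulr (ippE p sk sf) in H.
have sm1 := smooth_mul skf sh; have sm2 := smooth_mul skh sf.
rewrite (alphaD aP sm1 sm2) (alphaM aP skf sh) (alphaM aP skh sf) in H.
have {}H := @addrI Q1 (alpha kf p ** alpha h p) _ _ H.
rewrite H.
exact: (congr1 (fun z => z ** alpha f p) (esym (ippE p sk sh))).
Qed.

Lemma form_ip_sub (A : preCStarType R[i]) (W W1 W2 : one_form M A) p :
  form_ip g W (fun a p i => W1 a p i - W2 a p i) p =
  form_ip g W W1 p - form_ip g W W2 p.
Proof.
apply/eqP; rewrite eq_sym subr_eq -form_ipDr; apply/eqP.
by rewrite /form_ip; apply: eq_bigr => i _; apply: eq_bigr => j _; rewrite subrK.
Qed.

(** By ip_left the commutator is orthogonal to all the d(alpha k). *)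
Lemma d_comm f h a p i : smooth f -> smooth h ->
  alpha f p ** ext_d (alpha h) a p i = ext_d (alpha h) a p i ** alpha f p.
Proof.
move=> sf sh; have saf := alpha_smooth aP sf; have sah := alpha_smooth aP sh.
pose Z : one_form M Q1 := fun a p i =>
  (fun a p i => alpha f p ** ext_d (alpha h) a p i) a p i -
  (fun a p i => ext_d (alpha h) a p i ** alpha f p) a p i.
have sZ : smooth_form Z.
  exact: (sformB (sformMl (ext_d_smooth sah) saf) (sformM (ext_d_smooth sah) saf)).
apply/eqP; rewrite -subr_eq0; apply/eqP; apply: (orth0 sZ) => k sk q.
by rewrite /Z form_ip_sub (ip_left q sk sf sh) form_ip_mulr subrr.
Qed.

End Lift.

(** * The lift of the action to one-forms *)
Section LiftDef.
Variables (R : realType) (n : nat) (M : manifold R n) (Q : cqg R[i]).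
Variable alpha : (M -> R[i]^o) -> (M -> Q).
Hypothesis aP : smooth_action alpha.
Variable g : riemannian M.
Hypothesis ipp : inner_product_preserving g alpha.
Variable D : decomp M.
Let Q1 : cstarType R[i] := qg Q.
Implicit Types (f h k : M -> R[i]^o) (a b : chart M) (p : M).
Implicit Types (w : one_form M R[i]^o).

(** Linearity over C^oo(M) and compatibility with d force this formula. *)
Definition form_lift w : one_form M Q1 := fun a p m =>
  \sum_(i : dI D) ext_d (alpha (dg i)) a p m ** alpha (coef i w) p.

Lemma lift_smooth w : smooth_form w -> smooth_form (form_lift w).
Proof.
move=> sw; apply: sform_sum => i.
exact: (sformM (ext_d_smooth (alpha_smooth aP (dg_smooth i))) (alpha_smooth aP (coef_smooth i sw))).
Qed.

(** Combined with lift_pair, this turns identities between forms into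
    identities between functions. *)
Lemma orth_eq (W W' : one_form M Q1) : smooth_form W -> smooth_form W' ->
  (forall f, smooth f -> forall p,
    form_ip g (ext_d (alpha f)) W p = form_ip g (ext_d (alpha f)) W' p) -> W = W'.
Proof.
move=> sW sW' h; apply/funext => a; apply/funext => p; apply/funext => i.
apply/eqP; rewrite -subr_eq0; apply/eqP.
apply: (orth0 aP (sformB sW sW')) => f sf q.
rewrite form_ip_sub; apply/eqP; rewrite subr_eq0; apply/eqP; exact: h.
Qed.

Lemma decomp_ip w w' p : smooth_form w' ->
  form_ip g w w' p = \sum_(i : dI D) (form_ip g w (ext_d (dg i)) p : R[i]) * coef i w' p.
Proof.
move=> sw'; pose X (i : dI D) : one_form M R[i]^o := fun a p m => ext_d (dg i) a p m ** coef i w' p.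
have E : w' = (fun a p m => \sum_(i : dI D) X i a p m).
  apply/funext => a; apply/funext => q; apply/funext => m; exact: (decompE D sw' a q m).
rewrite {1}E form_ip_sumr; apply: eq_bigr => i _; exact: form_ip_mulr.
Qed.

(** By invariance this holds for w = d(g_i); the coefficients are then moved
    through alpha. *)
Lemma lift_pair h w p : smooth h -> smooth_form w ->
  form_ip g (ext_d (alpha h)) (form_lift w) p = alpha (form_ip g (ext_d h) w) p.
Proof.
move=> sh sw.
rewrite (form_ip_sumr g _ _ (fun i a p m => ext_d (alpha (dg i)) a p m ** alpha (coef i w) p)).
pose k (i : dI D) : M -> R[i]^o := form_ip g (ext_d h) (ext_d (dg i)).
have sk (i : dI D) : smooth (k i) := form_ip_smooth g (ext_d_smooth sh) (ext_d_smooth (dg_smooth i)).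
have sc (i : dI D) : smooth (coef i w) := coef_smooth i sw.
have -> : form_ip g (ext_d h) w = (fun q => \sum_(i : dI D) ((k i q : R[i]) * coef i w q : R[i]^o)).
  apply/funext => q; exact: decomp_ip.
have sm i := smooth_mul (sk i) (sc i).
rewrite (alpha_sum aP _ sm); apply: eq_bigr => i _.
rewrite form_ip_mulr (alphaM aP (sk i) (sc i)).
exact: (congr1 (fun z => z ** alpha (coef i w) p) (ippE ipp p sh (dg_smooth i))).
Qed.

Lemma lift_d f : smooth f -> form_lift (ext_d f) = ext_d (alpha f).
Proof.
move=> sf; apply: orth_eq.
- exact: (lift_smooth (ext_d_smooth sf)).
- exact: (ext_d_smooth (alpha_smooth aP sf)).
- move=> h sh p; rewrite (lift_pair p sh (ext_d_smooth sf)).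
  exact: (esym (ippE ipp p sh sf)).
Qed.

Lemma lift_mulr w f : smooth_form w -> smooth f ->
  form_lift (fun a p i => w a p i ** f p) = fun a p i => form_lift w a p i ** alpha f p.
Proof.
move=> sw sf; have swf : smooth_form (fun a p i => w a p i ** f p : R[i]^o) := sformM sw sf.
apply: orth_eq.
- exact: lift_smooth swf.
- exact: (sformM (lift_smooth sw) (alpha_smooth aP sf)).
- move=> h sh p; rewrite (lift_pair p sh swf) form_ip_mulr (lift_pair p sh sw).
  have sip : smooth (form_ip g (ext_d h) w) := form_ip_smooth g (ext_d_smooth sh) sw.
  rewrite -[RHS](congr1 (fun F => F p) (alphaM aP sip sf)).
  congr (alpha _ p); apply/funext => q; exact: form_ip_mulr.
Qed.

Lemma lift_comm w f a p i : smooth_form w -> smooth f ->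
  form_lift w a p i ** alpha f p = alpha f p ** form_lift w a p i.
Proof.
move=> sw sf; rewrite /form_lift amul_suml amul_sumr; apply: eq_bigr => j _.
rewrite -amulA (alpha_comm aP p (coef_smooth j sw) sf) !amulA.
by rewrite (d_comm aP ipp a p i sf (dg_smooth j)).
Qed.

Lemma lift_mull w f : smooth_form w -> smooth f ->
  form_lift (fun a p i => f p ** w a p i) = fun a p i => alpha f p ** form_lift w a p i.
Proof.
move=> sw sf.
have -> : (fun a p i => f p ** w a p i) = (fun a p i => w a p i ** f p) :> one_form M R[i]^o.
  apply/funext => a; apply/funext => p; apply/funext => i; exact: mulrC.
rewrite (lift_mulr sw sf); apply/funext => a; apply/funext => p; apply/funext => i.
exact: (lift_comm a p i sw sf).
Qed.

Lemma lift_lin : smooth_linear (@smooth_form _ _ M R[i]^o) (@smooth_form _ _ M Q1) form_lift.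
Proof.
split; first exact: lift_smooth.
move=> c w w' sw sw'; apply/funext => a; apply/funext => p; apply/funext => m.
rewrite -[RHS]/(c *: form_lift w a p m + form_lift w' a p m) /form_lift scaler_sumr -big_split.
apply: eq_bigr => i _ /=.
have -> : coef i (c *: w + w') = c *: coef i w + coef i w'.
  apply/funext => q; exact: coef_lin.
have [_ ->] := action_linear aP; [|exact: coef_smooth|exact: coef_smooth].
by rewrite -[(_ *: _ + _) p]/(c *: alpha (coef i w) p + alpha (coef i w') p) amulDr amulZr.
Qed.

Lemma smooth_star (F : M -> R[i]^o) : smooth F -> smooth (fun p => star (F p)).
Proof. exact: (smooth_lin (star_blin (R[i]^o))). Qed.

Lemma decomp_ipl w w' p : smooth_form w ->
  form_ip g w w' p = \sum_(i : dI D) (star (coef i w p) : R[i]) * form_ip g (ext_d (dg i)) w' p.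
Proof.
move=> sw; pose X (i : dI D) : one_form M R[i]^o := fun a p m => ext_d (dg i) a p m ** coef i w p.
have E : w = (fun a p m => \sum_(i : dI D) X i a p m).
  apply/funext => a; apply/funext => q; apply/funext => m; exact: (decompE D sw a q m).
rewrite {1}E form_ip_suml; apply: eq_bigr => i _; exact: form_ip_mull.
Qed.

(** Decompose the left argument: its coefficients come out starred and
    lift_pair applies to each term. *)
Lemma lift_ip w w' : smooth_form w -> smooth_form w' ->
  form_ip g (form_lift w) (form_lift w') = alpha (form_ip g w w').
Proof.
move=> sw sw'; apply/funext => p.
rewrite (form_ip_suml g _ _ (fun i a p m => ext_d (alpha (dg i)) a p m ** alpha (coef i w) p)).
pose k (i : dI D) : M -> R[i]^o := form_ip g (ext_d (dg i)) w'.
have sk (i : dI D) : smooth (k i) := form_ip_smooth g (ext_d_smooth (dg_smooth i)) sw'.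
have sc (i : dI D) : smooth (coef i w) := coef_smooth i sw.
have ssc i := smooth_star (sc i).
have -> : form_ip g w w' = (fun q => \sum_(i : dI D) ((star (coef i w q) : R[i]) * k i q : R[i]^o)).
  apply/funext => q; exact: decomp_ipl.
have sm i := smooth_mul (ssc i) (sk i).
rewrite (alpha_sum aP _ sm); apply: eq_bigr => i _.
rewrite form_ip_mull (alphaM aP (ssc i) (sk i)) (action_star aP (sc i)).
exact: (congr1 (fun z => star (alpha (coef i w) p) ** z) (lift_pair p (dg_smooth i) sw')).
Qed.

End LiftDef.

(** * Multiplicativity of the second stage of the action *)
Section Tensor.
Variables (R : realType) (Q : cqg R[i]).
Let Q1 : cstarType R[i] := qg Q.
Let Q2 : cstarType R[i] := qg2 Q.
Implicit Types (x y q r : Q1).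

Let qt : Q1 -> Q1 -> Q2 := @qtens _ Q.
Let tP : min_tensor qt := qtensP Q.

Lemma qtensM x y q r : qtens (x ** y) (q ** r) = qtens x q ** qtens y r :> Q2.
Proof. exact: (tensM tP). Qed.

Lemma qtensDl x y q : qtens (x + y) q = qtens x q + qtens y q :> Q2.
Proof. by have := tens_linl tP 1 x y q; rewrite !scale1r. Qed.

Lemma qtens1_hom : star_hom (fun x => qtens x aone : Q2).
Proof.
split.
- by move=> c x y; exact: (tens_linl tP).
- by move=> x y; rewrite -qtensM amul1l.
- by move=> x; rewrite -[RHS](tens_star tP) star1.
Qed.

(** As a star homomorphism; a bounded linear map commutes with partial
    derivatives. *)
Lemma qtens1_blin : bdd_linear (fun x => qtens x aone : Q2).
Proof. exact: (star_hom_blin qtens1_hom). Qed.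

Lemma qtens1Z (c : R[i]) x : qtens (c *: x) aone = c *: qtens x aone :> Q2.
Proof.
have [h _ _] := qtens1_hom; have := h c x 0; rewrite !addr0.
have -> : qtens 0 aone = 0 :> Q2.
  by have := h 1 0 0; rewrite !scale1r addr0 => e; apply: (addrI (qtens 0 aone : Q2)); rewrite -e addr0.
by rewrite addr0.
Qed.

Lemma qtens_split x q : qtens x q = qtens x aone ** qtens aone q :> Q2.
Proof. by rewrite -qtensM amul1l amul1r. Qed.

Lemma Delta_blin : bdd_linear (@Delta _ Q : Q1 -> Q2).
Proof. exact: (star_hom_blin (@Delta_hom _ Q)). Qed.

End Tensor.

Section DensityPrinciple.
Variables (R : realType) (n : nat) (M : manifold R n) (E E' : normedModType R[i]).
Hypothesis Mc : compact [set: M].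
Variables (u v : (M -> E) -> E').
Hypothesis uD : forall F G, smooth F -> smooth G -> u (fun p => F p + G p) = u F + u G.
Hypothesis vD : forall F G, smooth F -> smooth G -> v (fun p => F p + G p) = v F + v G.
Hypothesis uc : forall F, smooth F -> forall e : R, 0 < e ->
  fnear F [set t | nm (u (sval t) - u F) <= e].
Hypothesis vc : forall F, smooth F -> forall e : R, 0 < e ->
  fnear F [set t | nm (v (sval t) - v F) <= e].
Hypothesis uv : forall (f : M -> R[i]^o) q, smooth f ->
  u (fun p => f p *: q) = v (fun p => f p *: q).

Lemma additive0 (w : (M -> E) -> E') :
  (forall F G, smooth F -> smooth G -> w (fun p => F p + G p) = w F + w G) ->
  w (fun _ => 0) = 0.
Proof.
move=> wD; have s0 : smooth (fun _ : M => 0 : E) := smooth_cst (0 : E).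
apply: (addrI (w (fun _ => 0))); rewrite addr0 -(wD _ _ s0 s0).
by congr w; apply/funext => p; rewrite addr0.
Qed.

(** Maps that agree on the tensors f (x) q agree on their sums, which are
    dense. *)
Lemma tensor_eq F : smooth F -> u F = v F.
Proof.
move=> sF; apply/eqP; rewrite -subr_eq0; apply/eqP; apply: nm_small => e e0.
have e2 : 0 < e / 2 by rewrite divr_gt0.
have FF := fnear_filter F.
have hn : fun_nbhs F [set G | nm (u G - u F) <= e / 2 /\ nm (v G - v F) <= e / 2].
  apply: fnear_nbhs; exact: (@filterI _ _ FF _ _ (uc sF e2) (vc sF e2)).
have [G [aG [hu hv]]] := alg_dense Mc sF hn.
have uvG : u G = v G.
  elim: aG => [|f q G' sf aG' IH]; first by rewrite (additive0 uD) (additive0 vD).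
  have sfq : smooth (fun p => f p *: q) := smoothZ sf (smooth_cst q).
  by rewrite (uD sfq (alg_smooth aG')) (vD sfq (alg_smooth aG')) (uv q sf) IH.
have -> : u F - v F = (v G - v F) - (u G - u F).
  by rewrite uvG opprB [RHS]addrC addrA subrK.
apply: le_trans (nmD _ _) _; rewrite nmN.
by rewrite (splitr e) lerD.
Qed.

End DensityPrinciple.

Section Coassoc.
Variables (R : realType) (n : nat) (M : manifold R n) (Q : cqg R[i]).
Hypothesis Mc : compact [set: M].
Variable alpha : (M -> R[i]^o) -> (M -> Q).
Hypothesis aP : smooth_action alpha.
Let Q1 : cstarType R[i] := qg Q.
Let Q2 : cstarType R[i] := qg2 Q.
Variable alpha2 : (M -> Q1) -> (M -> Q2).
Hypothesis alpha2_linear : smooth_linear (@smooth _ _ M Q1) (@smooth _ _ M Q2) alpha2.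
Hypothesis alpha2_continuous : smooth_continuous (@smooth _ _ M Q1)
  (@fun_nbhs _ _ M Q1) (@fun_nbhs _ _ M Q2) alpha2.
Hypothesis alpha2_tens : forall (f : M -> R[i]^o) (q : Q1), smooth f ->
  alpha2 (fun p => f p *: q) = fun p => qtens (alpha f p) q.
Implicit Types (f h k : M -> R[i]^o) (a b : chart M) (p : M) (F G : M -> Q1).

Lemma alpha2_smooth F : smooth F -> smooth (alpha2 F).
Proof. by have [h _] := alpha2_linear; exact: h. Qed.

Lemma alpha2D F G : smooth F -> smooth G ->
  alpha2 (fun p => F p + G p) = fun p => alpha2 F p + alpha2 G p.
Proof.
move=> sF sG; have [_ H] := alpha2_linear; have := H 1 F G sF sG.
have -> : (1 *: F + G : M -> Q1) = (fun p => F p + G p).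
  by apply/funext => p; rewrite -[LHS]/(1 *: F p + G p) scale1r.
by move=> ->; apply/funext => p; rewrite -[LHS]/(1 *: alpha2 F p + alpha2 G p) scale1r.
Qed.

Lemma alpha2_ccfun (T : Type) (t0 : T) (FT : set_system T) {FF : Filter FT}
    (F : T -> M -> Q1) : (forall t, smooth (F t)) -> ccfun t0 FT F ->
  ccfun t0 FT (fun t => alpha2 (F t)).
Proof.
move=> sF hF; apply: tends_ccfun; first by move=> t; exact: (alpha2_smooth (sF t)).
move=> B hB.
exact: (ccfun_tends sF hF (alpha2_continuous (sF t0) hB)).
Qed.

Lemma smoothM F G : smooth F -> smooth G -> smooth (fun p => F p ** G p).
Proof. exact: (smooth_bilin (amul_bilin Q1)). Qed.

(** For G = h (x) r this is the multiplicativity of alpha; the general case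
    follows by density. *)
Lemma alpha2M_elem f q G p : smooth f -> smooth G ->
  alpha2 (fun p => (f p *: q) ** G p) p = alpha2 (fun p => f p *: q) p ** alpha2 G p.
Proof.
move=> sf sG.
have sfq : smooth (fun p => f p *: q : Q1) := smoothZ sf (smooth_cst q).
apply: (@tensor_eq _ _ _ _ _ Mc (fun G => alpha2 (fun p => (f p *: q) ** G p) p)
  (fun G => alpha2 (fun p => f p *: q) p ** alpha2 G p)).
- move=> F H sF sH /=; rewrite -[RHS](congr1 (fun K => K p) (alpha2D (smoothM sfq sF) (smoothM sfq sH))).
  by congr (alpha2 _ p); apply/funext => r; rewrite amulDr.
- by move=> F H sF sH /=; rewrite (alpha2D sF sH) amulDr.
- move=> F sF e e0; have FF := fnear_filter F.
  have h : ccfun (exist _ F sF) (fnear F) (fun t => alpha2 (fun p => (f p *: q) ** sval t p)).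
    apply: alpha2_ccfun; first by move=> t; exact: (smoothM sfq (svalP t)).
    exact: (ccfunM (ccfun_const _ sfq) (fnear_ccfun sF)).
  exact: (ccfun_near h p e0).
- move=> F sF e e0; have FF := fnear_filter F.
  have h : ccfun (exist _ F sF) (fnear F) (fun t p => alpha2 (fun p => f p *: q) p ** alpha2 (sval t) p).
    apply: (ccfunM (ccfun_const _ (alpha2_smooth sfq))).
    apply: alpha2_ccfun; first by move=> t; exact: (svalP t).
    exact: fnear_ccfun.
  exact: (ccfun_near h p e0).
- move=> h r sh /=; rewrite (alpha2_tens q sf) (alpha2_tens r sh) -qtensM.
  have sfh := smooth_mul sf sh.
  have -> : (fun p => (f p *: q) ** (h p *: r)) =
      (fun p => ((f p : R[i]) * h p : R[i]^o) *: (q ** r)) :> (M -> Q1).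
    by apply/funext => s; rewrite amulZl amulZr scalerA.
  by rewrite (alpha2_tens (q ** r) sfh) (alphaM aP sf sh).
- exact: sG.
Qed.

(** Density again, in the other argument. *)
Lemma alpha2M F G p : smooth F -> smooth G ->
  alpha2 (fun p => F p ** G p) p = alpha2 F p ** alpha2 G p.
Proof.
move=> sF0 sG.
apply: (@tensor_eq _ _ _ _ _ Mc (fun F => alpha2 (fun p => F p ** G p) p)
  (fun F => alpha2 F p ** alpha2 G p)).
- move=> F1 F2 sF sH /=; rewrite -[RHS](congr1 (fun K => K p) (alpha2D (smoothM sF sG) (smoothM sH sG))).
  by congr (alpha2 _ p); apply/funext => r; rewrite amulDl.
- by move=> F1 H sF sH /=; rewrite (alpha2D sF sH) amulDl.
- move=> F1 sF e e0; have FF := fnear_filter F1.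
  have h : ccfun (exist _ F1 sF) (fnear F1) (fun t => alpha2 (fun p => sval t p ** G p)).
    apply: alpha2_ccfun; first by move=> t; exact: (smoothM (svalP t) sG).
    exact: (ccfunM (fnear_ccfun sF) (ccfun_const _ sG)).
  exact: (ccfun_near h p e0).
- move=> F1 sF e e0; have FF := fnear_filter F1.
  have h : ccfun (exist _ F1 sF) (fnear F1) (fun t p => alpha2 (sval t) p ** alpha2 G p).
    apply: (fun x => ccfunM x (ccfun_const _ (alpha2_smooth sG))).
    apply: alpha2_ccfun; first by move=> t; exact: (svalP t).
    exact: fnear_ccfun.
  exact: (ccfun_near h p e0).
- by move=> f q sf; exact: (alpha2M_elem q p sf sG).
- exact: sF0.
Qed.

End Coassoc.

(** * Coassociativity of the lift *)
Section Gamma2.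
Variables (R : realType) (n : nat) (M : manifold R n) (Q : cqg R[i]).
Hypothesis Mc : compact [set: M].
Variable alpha : (M -> R[i]^o) -> (M -> Q).
Hypothesis aP : smooth_action alpha.
Variable g : riemannian M.
Hypothesis ipp : inner_product_preserving g alpha.
Variable D : decomp M.
Let Q1 : cstarType R[i] := qg Q.
Let Q2 : cstarType R[i] := qg2 Q.
Variable alpha2 : (M -> Q1) -> (M -> Q2).
Hypothesis alpha2_linear : smooth_linear (@smooth _ _ M Q1) (@smooth _ _ M Q2) alpha2.
Hypothesis alpha2_continuous : smooth_continuous (@smooth _ _ M Q1)
  (@fun_nbhs _ _ M Q1) (@fun_nbhs _ _ M Q2) alpha2.
Hypothesis alpha2_tens : forall (f : M -> R[i]^o) (q : Q1), smooth f ->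
  alpha2 (fun p => f p *: q) = fun p => qtens (alpha f p) q.
Hypothesis alpha2_alpha : forall f : M -> R[i]^o, smooth f ->
  alpha2 (alpha f) = fun p => Delta (alpha f p).
Implicit Types (f h : M -> R[i]^o) (a b : chart M) (p : M) (F G : M -> Q1).
Implicit Types (w : one_form M R[i]^o) (W : one_form M Q1).

Let dg2 (i : dI D) : one_form M Q2 := fun a p m => qtens (ext_d (alpha (dg i)) a p m) aone.

Lemma dg2_smooth i : smooth_form (dg2 i).
Proof.
apply: (sform_lin (qtens1_blin Q)); first exact: qtens1Z.
exact: (ext_d_smooth (alpha_smooth aP (dg_smooth i))).
Qed.

(** The formula of form_lift with alpha2 in place of alpha: alpha2 (g_i (x) 1)
    is alpha(g_i) (x) 1. *)
Definition lift2 W : one_form M Q2 := fun a p m =>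
  \sum_(i : dI D) dg2 i a p m ** alpha2 (coef i W) p.

Lemma lift2_smooth W : smooth_form W -> smooth_form (lift2 W).
Proof.
move=> sW; apply: sform_sum => i.
exact: (sformM (dg2_smooth i) (alpha2_smooth alpha2_linear (coef_smooth i sW))).
Qed.

Lemma lift2_lin :
  smooth_linear (@smooth_form _ _ M Q1) (@smooth_form _ _ M Q2) lift2.
Proof.
split; first exact: lift2_smooth.
move=> c W W' sW sW'; apply/funext => a; apply/funext => p; apply/funext => m.
rewrite -[RHS]/(c *: lift2 W a p m + lift2 W' a p m) /lift2 scaler_sumr -big_split.
apply: eq_bigr => i _ /=.
have -> : coef i (c *: W + W') = c *: coef i W + coef i W'.
  apply/funext => q; exact: coef_lin.
have [_ ->] := alpha2_linear; [|exact: coef_smooth|exact: coef_smooth].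
by rewrite -[(_ *: _ + _) p]/(c *: alpha2 (coef i W) p + alpha2 (coef i W') p) amulDr amulZr.
Qed.

Lemma lift2D W W' : smooth_form W -> smooth_form W' ->
  lift2 (fun a p m => W a p m + W' a p m) =
  fun a p m => lift2 W a p m + lift2 W' a p m.
Proof.
move=> sW sW'; have [_ H] := lift2_lin; have := H 1 W W' sW sW'.
have -> : 1 *: W + W' = (fun a p m => W a p m + W' a p m).
  apply/funext => a; apply/funext => p; apply/funext => m.
  by rewrite -[LHS]/(1 *: W a p m + W' a p m) scale1r.
move=> ->; apply/funext => a; apply/funext => p; apply/funext => m.
by rewrite -[LHS]/(1 *: lift2 W a p m + lift2 W' a p m) scale1r.
Qed.

Lemma lift2_ccform (T : Type) (t0 : T) (FT : set_system T) {FF : Filter FT}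
    (W : T -> one_form M Q1) : (forall t, smooth_form (W t)) ->
  ccform t0 FT W -> ccform t0 FT (fun t => lift2 (W t)).
Proof.
move=> sW hW; apply: ccform_sum => i.
apply: (ccformM (ccform_const _ (dg2_smooth i))).
apply: (alpha2_ccfun alpha2_linear alpha2_continuous); last exact: (coef_cc i hW).
by move=> t; exact: (coef_smooth i (sW t)).
Qed.

Lemma lift2_continuous : smooth_continuous (@smooth_form _ _ M Q1)
  (@form_nbhs _ _ M Q1) (@form_nbhs _ _ M Q2) lift2.
Proof.
move=> W sW B hB; have FF := wnear_filter W.
have hc : ccform (exist _ W sW) (wnear W) (fun t => lift2 (sval t)).
  by apply: lift2_ccform; [move=> t; exact: (svalP t)|exact: wnear_ccform].
apply: wnear_nbhs.
exact: (ccform_tends (fun t => lift2_smooth (svalP t)) hc hB).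
Qed.

Lemma lift2_tens w (q : Q1) : smooth_form w ->
  lift2 (fun a p i => w a p i *: q) = fun a p i => qtens (form_lift alpha D w a p i) q.
Proof.
move=> sw; apply/funext => a; apply/funext => p; apply/funext => m.
rewrite [in RHS]qtens_split /form_lift.
have -> : qtens (\sum_(i : dI D) ext_d (alpha (dg i)) a p m ** alpha (coef i w) p) aone =
   \sum_(i : dI D) (qtens (ext_d (alpha (dg i)) a p m ** alpha (coef i w) p) aone : Q2).
  elim/big_rec2 : _ => [|i x y _ <-]; last by rewrite qtensDl.
  by have := qtens1Z (0 : R[i]) (0 : Q1); rewrite !scale0r.
rewrite amul_suml; apply: eq_bigr => i _.
have -> : coef i (fun a p j => w a p j *: q) = (fun r => coef i w r *: q).
  by apply/funext => r; rewrite /coef scalerA.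
by rewrite (alpha2_tens q (coef_smooth i sw)) -!qtensM !amul1r !amul1l.
Qed.

Lemma lift2M W F : smooth_form W -> smooth F ->
  lift2 (fun a p i => W a p i ** F p) = fun a p i => lift2 W a p i ** alpha2 F p.
Proof.
move=> sW sF; apply/funext => a; apply/funext => p; apply/funext => m.
rewrite /lift2 amul_suml; apply: eq_bigr => i _.
rewrite -amulA -(alpha2M Mc aP alpha2_linear alpha2_continuous alpha2_tens p (coef_smooth i sW) sF).
congr (_ ** alpha2 _ p); apply/funext => q.
by rewrite /coef amulZl.
Qed.

Lemma lift2_sum (I : Type) (r : seq I) (W : I -> one_form M Q1) :
  (forall k, smooth_form (W k)) ->
  lift2 (fun a p m => \sum_(k <- r) W k a p m) =
  fun a p m => \sum_(k <- r) lift2 (W k) a p m.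
Proof.
move=> sW; elim: r => [|k r IH]; last first.
  under eq_fun do under eq_fun do under eq_fun do rewrite big_cons.
  under [RHS]eq_fun do under eq_fun do under eq_fun do rewrite big_cons.
  by rewrite (lift2D (sW k) (sform_sum r sW)) IH.
pose Z : one_form M Q1 := fun _ _ _ => 0.
have ZE : (fun a p m => \sum_(k <- [::]) W k a p m) = Z.
  by apply/funext => b; apply/funext => q; apply/funext => l; rewrite big_nil.
have sZ : smooth_form Z by rewrite -ZE; exact: sform_sum.
have ZZ : Z = (fun a p m => Z a p m + Z a p m).
  by apply/funext => b; apply/funext => q; apply/funext => l; rewrite addr0.
rewrite ZE; apply/funext => a; apply/funext => p; apply/funext => m; rewrite big_nil.
have := congr1 (fun V => V a p m) (lift2D sZ sZ); rewrite -ZZ => h.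
by apply: (addrI (lift2 Z a p m)); rewrite addr0 -h.
Qed.

Lemma ext_d_scaler f (q : Q1) a p m : smooth f ->
  ext_d (fun p => f p *: q) a p m = (ext_d f a p m : R[i]) *: q.
Proof.
move=> sf; rewrite (ext_d_bilin a p m (scale_bilin Q1) sf (smooth_cst q)).
by rewrite ext_d_cst scaler0 addr0.
Qed.

(** For F = f (x) q both sides are d(alpha f) (x) q; the general case follows
    by density. *)
Lemma lift2_d F : smooth F -> lift2 (ext_d F) = ext_d (alpha2 F).
Proof.
move=> sF; apply/funext => a; apply/funext => p; apply/funext => m.
apply: (@tensor_eq _ _ _ _ _ Mc (fun F => lift2 (ext_d F) a p m)
  (fun F => ext_d (alpha2 F) a p m)).
- move=> F1 F2 s1 s2 /=.
  have -> : ext_d (fun p => F1 p + F2 p) = (fun a p m => ext_d F1 a p m + ext_d F2 a p m).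
    apply/funext => b; apply/funext => q; apply/funext => l; exact: ext_dD.
  by rewrite (lift2D (ext_d_smooth s1) (ext_d_smooth s2)).
- move=> F1 F2 s1 s2 /=; rewrite (alpha2D alpha2_linear s1 s2).
  exact: (ext_dD a p m (alpha2_smooth alpha2_linear s1) (alpha2_smooth alpha2_linear s2)).
- move=> F1 s1 e e0; have FF := fnear_filter F1.
  have h : ccform (exist _ F1 s1) (fnear F1) (fun t => lift2 (ext_d (sval t))).
    apply: lift2_ccform; first by move=> t; exact: (ext_d_smooth (svalP t)).
    exact: (ccfun_d (fnear_ccfun s1)).
  apply: (ccform_near h _ e0) => t ap.
  by have [_ h0 _] := lift2_smooth (ext_d_smooth (svalP t)); exact: h0.
- move=> F1 s1 e e0; have FF := fnear_filter F1.
  have h : ccform (exist _ F1 s1) (fnear F1) (fun t => ext_d (alpha2 (sval t))).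
    apply: ccfun_d; apply: (alpha2_ccfun alpha2_linear alpha2_continuous).
      by move=> t; exact: (svalP t).
    exact: (fnear_ccfun s1).
  apply: (ccform_near h _ e0) => t ap; exact: ext_d_out.
- move=> f q sf /=.
  have -> : ext_d (fun p => f p *: q) = (fun a p m => (ext_d f a p m : R[i]^o) *: q).
    apply/funext => b; apply/funext => r; apply/funext => l; exact: ext_d_scaler.
  rewrite (lift2_tens q (ext_d_smooth sf)) (alpha2_tens q sf) (lift_d aP ipp D sf).
  have saf := alpha_smooth aP sf.
  rewrite qtens_split -(ext_d_lin a p m (qtens1_blin Q) saf).
  rewrite -(ext_d_mulr (qtens aone q) a p m (smooth_lin (qtens1_blin Q) saf)).
  by congr (ext_d _ a p m); apply/funext => r; rewrite -qtens_split.
- exact: sF.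
Qed.

(** Move lift2 inside of the sum with lift2M and lift2_d, then use alpha2
    (alpha f) = Delta (alpha f), and that Delta is multiplicative and commutes
    with d. *)
Lemma lift2_lift w : smooth_form w ->
  lift2 (form_lift alpha D w) = fun a p i => Delta (form_lift alpha D w a p i).
Proof.
move=> sw.
pose V (i : dI D) : one_form M Q1 := fun a p m => ext_d (alpha (dg i)) a p m ** alpha (coef i w) p.
have sd (i : dI D) := alpha_smooth aP (dg_smooth i).
have sc (i : dI D) := alpha_smooth aP (coef_smooth i sw).
have sV i : smooth_form (V i) := sformM (ext_d_smooth (sd i)) (sc i).
rewrite [in LHS]/form_lift (lift2_sum _ sV).
apply/funext => a; apply/funext => p; apply/funext => m.
rewrite [in RHS]/form_lift.
have [_ DM _] := @Delta_hom _ Q.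
have -> : Delta (\sum_(i : dI D) ext_d (alpha (dg i)) a p m ** alpha (coef i w) p) =
   \sum_(i : dI D) (Delta (ext_d (alpha (dg i)) a p m ** alpha (coef i w) p) : Q2).
  elim/big_rec2 : _ => [|i x y _ <-]; last exact: (blinD (Delta_blin Q)).
  by have := blinZ (Delta_blin Q) 0 0; rewrite toC0 !scale0r.
apply: eq_bigr => i _; rewrite (lift2M (ext_d_smooth (sd i)) (sc i)) (lift2_d (sd i)).
rewrite (alpha2_alpha (dg_smooth i)) (alpha2_alpha (coef_smooth i sw)) DM.
by rewrite (ext_d_lin a p m (Delta_blin Q) (sd i)).
Qed.

End Gamma2.

(** * Density of the lift and the equivalence *)
(** Halve e. This makes the set of limits of lspan closed, so that
    approximations can be done one after the other. *)
Lemma frechet_nbhs_nbhs (R : realType) n (M : manifold R n) (E : normedModType R[i])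
    (X J : Type) (smX : X -> Prop) (loc : X -> chart M -> J -> 'rV[R]_n -> E) F B :
  frechet_nbhs smX loc F B -> frechet_nbhs smX loc F [set G | frechet_nbhs smX loc G B].
Proof.
move=> [m [a [j [K [s [e [hK e0 h]]]]]]].
have e2 : 0 < e / 2 by rewrite divr_gt0.
exists m, a, j, K, s, (e / 2); split => // G sG hG.
exists m, a, j, K, s, (e / 2); split => // H sH hH.
apply: h => // k x Kx.
apply: le_lt_trans (ler_distD (partials (cod (a k)) (loc G (a k) (j k)) (s k) x) _ _) _.
have -> : toC e = toC (e / 2) + toC (e / 2) :> R[i] by rewrite /toC -rmorphD -splitr.
by apply: ltrD; [exact: hG|exact: hH].
Qed.

Section Dense.
Variables (R : realType) (n : nat) (M : manifold R n) (Q : cqg R[i]).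
Variable alpha : (M -> R[i]^o) -> (M -> Q).
Hypothesis aP : smooth_action alpha.
Variable g : riemannian M.
Hypothesis ipp : inner_product_preserving g alpha.
Variable D : decomp M.
Let Q1 : cstarType R[i] := qg Q.
Implicit Types (f h : M -> R[i]^o) (a b : chart M) (p : M) (F G : M -> Q1).
Implicit Types (w : one_form M R[i]^o) (V W : one_form M Q1).

(** The span of the Gamma(w) q. *)
Inductive lspan : one_form M Q1 -> Prop :=
| lspan0 : lspan (fun _ _ _ => 0)
| lspanD w (q : Q1) W : smooth_form w -> lspan W ->
    lspan (fun a p i => form_lift alpha D w a p i ** q + W a p i).

Lemma sform0 : smooth_form ((fun _ _ _ => 0) : one_form M Q1).
Proof.
apply/smooth_formP; split => [a i k|//|a b p i ap bp]; first exact: cc_cst.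
by rewrite big1// => j _; rewrite scaler0.
Qed.

Lemma sformD V W : smooth_form V -> smooth_form W ->
  smooth_form (fun a p i => V a p i + W a p i).
Proof.
move=> /smooth_formP[h1 h2 h3] /smooth_formP[h1' h2' h3']; apply/smooth_formP; split.
- by move=> a i k; exact: (ccD (h1 a i k) (h1' a i k)).
- by move=> a p i ap; rewrite h2// h2'// addr0.
- move=> a b p i ap bp; rewrite (h3 a b p i ap bp) (h3' a b p i ap bp) -big_split.
  by apply: eq_bigr => j _; rewrite scalerDr.
Qed.

Lemma lspan_smooth W : lspan W -> smooth_form W.
Proof.
elim=> [|w q W' sw _ IH]; first exact: sform0.
exact: (sformD (sformM (lift_smooth aP D sw) (smooth_cst q)) IH).
Qed.

Lemma lspan_add V W : lspan V -> lspan W -> lspan (fun a p i => V a p i + W a p i).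
Proof.
move=> hV hW; elim: hV => [|w q W' sw _ IH].
  by under eq_fun do under eq_fun do under eq_fun do rewrite add0r.
by under eq_fun do under eq_fun do under eq_fun do rewrite -addrA; exact: lspanD.
Qed.

Lemma lspan_sum (I : Type) (r : seq I) (V : I -> one_form M Q1) :
  (forall k, lspan (V k)) -> lspan (fun a p i => \sum_(k <- r) V k a p i).
Proof.
move=> hV; elim: r => [|k r IH].
  by under eq_fun do under eq_fun do under eq_fun do rewrite big_nil; exact: lspan0.
by under eq_fun do under eq_fun do under eq_fun do rewrite big_cons; exact: lspan_add.
Qed.

Lemma lspan_family W : lspan W ->
  exists (m : nat) (w : 'I_m -> one_form M R[i]^o) (q : 'I_m -> Q1),
    (forall k, smooth_form (w k)) /\
    W = fun a p i => \sum_k form_lift alpha D (w k) a p i ** q k.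
Proof.
elim=> [|w q W' sw _ [m [w' [q' [sw' ->]]]]].
  have no (k : 'I_0) : False by case: k.
  exists 0%N, (fun k => False_rect _ (no k)), (fun k => False_rect _ (no k)).
  split; first by move=> k; case: (no k).
  by apply/funext => a; apply/funext => p; apply/funext => i; rewrite big_ord0.
exists m.+1, (fun k => oapp w' w (unlift ord0 k)), (fun k => oapp q' q (unlift ord0 k)).
split; first by move=> k; case: (unlift ord0 k) => [l|] /=; [exact: sw'|exact: sw].
apply/funext => a; apply/funext => p; apply/funext => i; rewrite big_ord_recl unlift_none /=.
by congr (_ + _); apply: eq_bigr => k _; rewrite liftK.
Qed.

Definition lspan_lim V := smooth_form V /\ forall B, form_nbhs V B -> exists W, lspan W /\ B W.

Lemma lspan_llim W : lspan W -> lspan_lim W.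
Proof.
move=> hW; split; first exact: lspan_smooth.
move=> B [m [a [j [K [s [e [hK e0 h]]]]]]]; exists W; split => //.
apply: h; first exact: lspan_smooth.
by move=> k x _; rewrite subrr normr0 /toC ltcR.
Qed.

Lemma llim_closed V : smooth_form V ->
  (forall B, form_nbhs V B -> exists W, lspan_lim W /\ B W) -> lspan_lim V.
Proof.
move=> sV h; split => // B hB.
have [W [[_ cW] BW]] := h _ (frechet_nbhs_nbhs hB).
exact: cW.
Qed.

(** A continuous operation that maps lspan to limits of lspan maps limits of
    lspan to such limits. *)
Lemma llim_form (L : one_form M Q1 -> one_form M Q1) V :
  (forall W, smooth_form W -> smooth_form (L W)) ->
  (forall sV : smooth_form V, ccform (exist _ V sV) (wnear V) (fun t => L (sval t))) ->
  (forall W, lspan W -> lspan_lim (L W)) -> lspan_lim V -> lspan_lim (L V).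
Proof.
move=> sL cL hL [sV hV]; apply: (llim_closed (sL V sV)) => B hB.
have FF := wnear_filter V.
have hn : form_nbhs V [set W | B (L W)].
  apply: wnear_nbhs; exact: (ccform_tends (fun t => sL _ (svalP t)) (cL sV) hB).
have [W [lW BW]] := hV _ hn.
by exists (L W); split; [exact: hL|exact: BW].
Qed.

Lemma llim_fun (L : (M -> Q1) -> one_form M Q1) F : smooth F ->
  (forall G, smooth G -> smooth_form (L G)) ->
  (forall sF : smooth F, ccform (exist _ F sF) (fnear F) (fun t => L (sval t))) ->
  (forall (m : nat) (f : 'I_m -> M -> R[i]^o) (q : 'I_m -> Q1),
     (forall k, smooth (f k)) -> lspan_lim (L (fun p => \sum_k alpha (f k) p ** q k))) ->
  lspan_lim (L F).
Proof.
move=> sF sL cL hL; apply: (llim_closed (sL F sF)) => B hB.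
have FF := fnear_filter F.
have hn : fun_nbhs F [set G | B (L G)].
  apply: fnear_nbhs; exact: (ccform_tends (fun t => sL _ (svalP t)) (cL sF) hB).
have [G [[m [f [q [sf GE]]]] BG]] := action_dense aP sF hn.
by exists (L G); split; [rewrite GE; exact: hL|exact: BG].
Qed.

Lemma ccformD (T : Type) (t0 : T) (FT : set_system T) {FF : Filter FT}
  (V W : T -> one_form M Q1) : ccform t0 FT V -> ccform t0 FT W ->
  ccform t0 FT (fun t a p i => V t a p i + W t a p i).
Proof. by move=> hV hW k a i; exact: (ccD (hV k a i) (hW k a i)). Qed.

Lemma llim_add V W : lspan_lim V -> lspan_lim W -> lspan_lim (fun a p i => V a p i + W a p i).
Proof.
move=> cV cW; have [sV _] := cV; have [sW _] := cW.
apply: (llim_form (L := fun V => fun a p i => V a p i + W a p i) _ _ _ cV).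
- by move=> V' sV'; exact: sformD.
- move=> sV'; have FF := wnear_filter V.
  exact: (ccformD (wnear_ccform sV') (ccform_const _ sW)).
move=> V' lV'; have sV' := lspan_smooth lV'.
apply: (llim_form (L := fun W => fun a p i => V' a p i + W a p i) _ _ _ cW).
- by move=> W' sW'; exact: sformD.
- move=> sW'; have FF := wnear_filter W.
  exact: (ccformD (ccform_const _ sV') (wnear_ccform sW')).
by move=> W' lW'; apply: lspan_llim; exact: lspan_add.
Qed.

Lemma llim_sum (I : Type) (r : seq I) (V : I -> one_form M Q1) :
  (forall k, lspan_lim (V k)) -> lspan_lim (fun a p i => \sum_(k <- r) V k a p i).
Proof.
move=> hV; elim: r => [|k r IH].
  by under eq_fun do under eq_fun do under eq_fun do rewrite big_nil; apply: lspan_llim; exact: lspan0.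
by under eq_fun do under eq_fun do under eq_fun do rewrite big_cons; exact: llim_add.
Qed.

(** For F = alpha(h) r the form is Gamma(df h) r; the general case follows by
    density of the action. *)
Lemma llim_dalpha_mul f F : smooth f -> smooth F ->
  lspan_lim (fun a p i => ext_d (alpha f) a p i ** F p).
Proof.
move=> sf sF0; have sd := ext_d_smooth (alpha_smooth aP sf).
apply: (llim_fun (L := fun F => fun a p i => ext_d (alpha f) a p i ** F p) sF0).
- by move=> G sG; exact: sformM.
- move=> sF; have FF := fnear_filter F.
  exact: (ccformM (ccform_const _ sd) (fnear_ccfun sF)).
move=> m h r sh; apply: lspan_llim.
have -> : (fun a p i => ext_d (alpha f) a p i ** (\sum_k alpha (h k) p ** r k)) =
    (fun a p i => \sum_k form_lift alpha D (fun a p i => ext_d f a p i ** h k p) a p i ** r k).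
  apply/funext => a; apply/funext => p; apply/funext => i; rewrite amul_sumr.
  apply: eq_bigr => k _.
  by rewrite (lift_mulr aP ipp D (ext_d_smooth sf) (sh k)) (lift_d aP ipp D sf) amulA.
apply: lspan_sum => k.
have -> : (fun a p i => form_lift alpha D (fun a p i => ext_d f a p i ** h k p) a p i ** r k) =
    (fun a p i => form_lift alpha D (fun a p i => ext_d f a p i ** h k p) a p i ** r k + 0).
  by apply/funext => a; apply/funext => p; apply/funext => i; rewrite addr0.
exact: (lspanD (r k) (sformM (ext_d_smooth sf) (sh k)) lspan0).
Qed.

(** For F = alpha(f) q the form is d(alpha f) (q G), covered by
    llim_dalpha_mul; the general case follows by density of the action. *)
Lemma llim_ext_d_mul F G : smooth F -> smooth G -> lspan_lim (fun a p i => ext_d F a p i ** G p).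
Proof.
move=> sF0 sG.
apply: (llim_fun (L := fun F => fun a p i => ext_d F a p i ** G p) sF0).
- by move=> F' sF'; exact: (sformM (ext_d_smooth sF') sG).
- move=> sF; have FF := fnear_filter F.
  exact: (ccformM (ccfun_d (fnear_ccfun sF)) (ccfun_const _ sG)).
move=> m f q sf.
have sq k : smooth (fun p => q k ** G p).
  exact: (smooth_bilin (amul_bilin Q1) (smooth_cst (q k)) sG).
have sfq k : smooth (fun p => alpha (f k) p ** q k).
  exact: (smooth_bilin (amul_bilin Q1) (alpha_smooth aP (sf k)) (smooth_cst (q k))).
have -> : (fun a p i => ext_d (fun p => \sum_k alpha (f k) p ** q k) a p i ** G p) =
    (fun a p i => \sum_k ext_d (alpha (f k)) a p i ** (q k ** G p)).
  apply/funext => a; apply/funext => p; apply/funext => i.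
  rewrite (ext_d_sum _ a p i sfq) amul_suml; apply: eq_bigr => k _.
  by rewrite (ext_d_mulr (q k) a p i (alpha_smooth aP (sf k))) amulA.
apply: (llim_sum _ (V := fun k a p i => ext_d (alpha (f k)) a p i ** (q k ** G p))) => k.
exact: (llim_dalpha_mul (sf k) (sq k)).
Qed.

Lemma llim_all W : smooth_form W -> lspan_lim W.
Proof.
move=> sW.
have -> : W = (fun a p m =>
    \sum_(i : dI D) ext_d (fun q => dg i q *: (aone : Q1)) a p m ** coef i W p).
  apply/funext => a; apply/funext => p; apply/funext => m; exact: (decompM D sW).
apply: (llim_sum _ (V := fun (i : dI D) a p m => ext_d (fun q => dg i q *: (aone : Q1)) a p m ** coef i W p)) => i.
exact: (llim_ext_d_mul (smoothZ (dg_smooth i) (smooth_cst (aone : Q1))) (coef_smooth i sW)).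
Qed.

Lemma lift_dense : smooth_dense (@smooth_form _ _ M Q1) (@form_nbhs _ _ M Q1)
    [set W | exists (m : nat) (w : 'I_m -> one_form M R[i]^o) (q : 'I_m -> Q1),
       (forall k, smooth_form (w k)) /\
       W = fun a p i => \sum_k form_lift alpha D (w k) a p i ** q k].
Proof.
move=> W sW B hB; have [_ h] := llim_all sW; have [V [lV BV]] := h B hB.
by exists V; split; [exact: lspan_family|exact: BV].
Qed.

End Dense.

Section Equivalence.
Variables (R : realType) (n : nat) (M : manifold R n) (Q : cqg R[i]).
Variable alpha : (M -> R[i]^o) -> (M -> Q).
Hypothesis Mc : compact [set: M].
Hypothesis aP : smooth_action alpha.
Variable g : riemannian M.

Lemma form_lift_rep (D : decomp M) : inner_product_preserving g alpha ->
  equivariant_rep g alpha (form_lift alpha D).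
Proof.
move=> ipp; split.
- exact: lift_lin.
- by move=> w f sw sf; exact: (lift_mulr aP ipp D sw sf).
- by move=> w f sw sf; exact: (lift_mull aP ipp D sw sf).
- by move=> w w' sw sw'; exact: (lift_ip aP ipp D sw sw').
- have [alpha2 [h1 h2 h3 h4]] := action_coassoc aP.
  exists (lift2 alpha D alpha2); split.
  + exact: lift2_lin.
  + exact: lift2_continuous.
  + by move=> w q; exact: lift2_tens.
  + by move=> w sw; exact: (lift2_lift Mc aP ipp D h1 h2 h3 h4 sw).
- exact: (lift_dense aP ipp D).
Qed.

Lemma rep_ipp dalpha : equivariant_rep g alpha dalpha ->
  (forall f : M -> R[i]^o, smooth f -> dalpha (ext_d f) = ext_d (alpha f)) ->
  inner_product_preserving g alpha.
Proof.
move=> rP dP f f' sf sf'; rewrite -(dP f sf) -(dP f' sf').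
exact: (rep_ip rP (ext_d_smooth sf) (ext_d_smooth sf')).
Qed.

End Equivalence.

Theorem theorem4p2 (R : realType) (n : nat) (M : manifold R n) (Q : cqg R[i])
    (alpha : (M -> R[i]^o) -> (M -> Q)) :
  compact [set: M] -> smooth_action alpha ->
  ((exists (g : riemannian M) (dalpha : one_form M R[i]^o -> one_form M Q),
      equivariant_rep g alpha dalpha /\
      forall f : M -> R[i]^o, smooth f ->
        dalpha (ext_d f) = ext_d (alpha f))
   <->
   (exists g : riemannian M, inner_product_preserving g alpha)).
Proof.
move=> Mc aP; split=> [[g [dalpha [rP dP]]]|[g ipp]].
  by exists g; exact: (rep_ipp rP dP).
have [D _] := decomp_ex Mc.
exists g, (form_lift alpha D); split; first exact: form_lift_rep.
by move=> f sf; exact: (lift_d aP ipp D sf).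
Qed.
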